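(* Let $\mu\in\mathbb{C}$ with $|\mathrm{Re}\,\mu|<\frac12$ and let $m$ be an even integer. Then for every $c\in\mathbb{C}\smallsetminus\{0\}$ with $|\arg c|<\frac12\pi$, $$\int_0^{2\pi}\int_0^\infty\boldsymbol{J}_{\mu,m}\left(xe^{i\phi}\right)\exp(-2\pi cx)\,dx\,d\phi=\frac{4\pi i^m}{c}\,K_{2\mu}\left(\frac{4\pi}{c}\right)I_{\frac12m}\left(\frac{4\pi}{c}\right).$$
   Context: $J_\nu$ is the classical Bessel function of the first kind of order $\nu$; $I_\nu$ and $K_\nu$ are the modified Bessel functions of the first and second kind of order $\nu$. For $\mu\in\mathbb{C}$ and $m\in\mathbb{Z}$ put $$J_{\mu,m}(z)=J_{-2\mu-\frac12 m}(z)\,J_{-2\mu+\frac12 m}(\overline z),\qquad z\in\mathbb{C}\smallsetminus\{0\},$$ where one takes $\arg\overline z=-\arg z$; this does not depend on the choice of $\arg z$ modulo $2\pi$. For $m$ even define $$\boldsymbol{J}_{\mu,m}(z)=\frac{2\pi^2}{\sin(2\pi\mu)}\left(J_{\mu,m}(4\pi\sqrt z)-J_{-\mu,-m}(4\pi\sqrt z)\right),$$ which does not depend on the choice of the square root; in the nongeneric case $4\mu\in2\mathbb{Z}+m$ the right-hand side is replaced by its limit (in $\mu$). *)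

(* Defs.v *)
From Stdlib Require Import Reals ZArith ClassicalEpsilon.
From Coquelicot Require Import Coquelicot.

Open Scope C_scope.

Definition Cexp (z : C) : C :=
  RtoC (exp (Re z)) * (cos (Im z), sin (Im z)).

Definition Csin (z : C) : C :=
  (Cexp (Ci * z) - Cexp (- (Ci * z))) / (2 * Ci).

(* Principal argument, with values in ]-PI, PI]; meaningful for z <> 0. *)
Definition Carg (z : C) : R :=
  if Rle_dec 0 (Im z) then acos (Re z / Cmod z) else (- acos (Re z / Cmod z))%R.

Definition Clog (z : C) : C := (ln (Cmod z), Carg z).

Definition Csqrt (z : C) : C := Cexp (Clog z / 2).

Definition Cpowz (z : C) (n : Z) : C :=
  match n with
  | Z0 => 1
  | Zpos p => z ^ Pos.to_nat p
  | Zneg p => / z ^ Pos.to_nat p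
  end.

(* The limit of f along F when it exists, an unspecified value otherwise. *)
Definition Clim {T : Type} (F : (T -> Prop) -> Prop) (f : T -> C) : C :=
  @iota C_R_CompleteNormedModule
    (fun l : C_R_CompleteNormedModule => filterlim f F (locally l)).

Definition CSeries (a : nat -> C) : C :=
  @iota C_R_CompleteNormedModule
    (fun l : C_R_CompleteNormedModule =>
       @is_series R_AbsRing C_R_CompleteNormedModule a l).

(* z (z + 1) ... (z + n) *)
Fixpoint rising (z : C) (n : nat) : C :=
  match n with
  | O => z
  | S p => rising z p * (z + INR (S p))
  end.

(* The entire function 1 / Gamma, by the Euler-Gauss limit
   1 / Gamma(z) = lim z (z + 1) ... (z + n) / (n! n^z). *)
Definition RGamma (z : C) : C :=
  Clim eventually
    (fun n : nat => rising z n / (INR (fact n) * Cexp (z * ln (INR n)))).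

(* J_nu at the point exp w of the Riemann surface of the logarithm, i.e. at
   exp w taken with argument Im w:
   sum_k (-1)^k / (k! Gamma(nu + k + 1)) (exp w / 2)^(nu + 2 k). *)
Definition BesselJ_log (nu w : C) : C :=
  CSeries (fun k : nat =>
    ((-1) ^ k / INR (fact k)) * RGamma (nu + INR k + 1)
    * Cexp ((nu + 2 * INR k) * (w - ln 2))).

(* Principal branch, for z <> 0. *)
Definition BesselI (nu z : C) : C :=
  CSeries (fun k : nat =>
    (1 / INR (fact k)) * RGamma (nu + INR k + 1)
    * Cexp ((nu + 2 * INR k) * Clog (z / 2))).

Definition BesselK_generic (nu z : C) : C :=
  (PI / 2) * (BesselI (- nu) z - BesselI nu z) / Csin (PI * nu).

(* For integral order, the limit in the order. *)
Definition BesselK (nu z : C) : C :=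
  if excluded_middle_informative (exists k : Z, nu = IZR k)
  then Clim (locally' nu) (fun nu' => BesselK_generic nu' z)
  else BesselK_generic nu z.

(* J_{mu,m}(z) = J_{-2mu-m/2}(z) J_{-2mu+m/2}(conj z): conjugating Clog z
   gives conj z the argument - arg z. *)
Definition J2 (mu : C) (m : Z) (z : C) : C :=
  BesselJ_log (- (2 * mu) - IZR m / 2) (Clog z)
  * BesselJ_log (- (2 * mu) + IZR m / 2) (Cconj (Clog z)).

Definition bJ_generic (mu : C) (m : Z) (z : C) : C :=
  (2 * PI ^ 2) / Csin (2 * PI * mu)
  * (J2 mu m (4 * PI * Csqrt z) - J2 (- mu) (- m) (4 * PI * Csqrt z)).

(* The Bessel function (boldface J)_{mu,m}, for m even. *)
Definition bJ (mu : C) (m : Z) (z : C) : C :=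
  if excluded_middle_informative (exists k : Z, 4 * mu = 2 * IZR k + IZR m)
  then Clim (locally' mu) (fun mu' => bJ_generic mu' m z)
  else bJ_generic mu m z.

(* f is absolutely integrable on ]0, +oo[, with integral l, as an improper
   integral at both ends. *)
Definition is_int_half_line (f : R -> C) (l : C) : Prop :=
  ex_RInt_gen (fun x : R => Cmod (f x)) (at_right 0) (Rbar_locally p_infty)
  /\ @is_RInt_gen C_R_CompleteNormedModule f
       (at_right 0) (Rbar_locally p_infty) l.

(* The iterated integral int_0^{2 PI} int_0^oo f x phi dx dphi exists and is
   equal to l. *)
Definition is_polar_integral (f : R -> R -> C) (l : C) : Prop :=
  exists G : R -> C,
    (forall phi : R, (0 <= phi <= 2 * PI)%R ->
       is_int_half_line (fun x : R => f x phi) (G phi))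
    /\ @is_RInt C_R_CompleteNormedModule G 0 (2 * PI) l.

(* Main.v *)
Require Import Defs.
From Stdlib Require Import Reals ZArith Lra Lia Psatz ClassicalEpsilon.
From Coquelicot Require Import Coquelicot.

(** Put [M = m/2], [a = -2 mu] and [z = x e^(i phi)]. Up to its branch factor, [J_nu(w)] is the entire
    function [h_nu(u) = sum_k u^k / (k! Gamma(nu + k + 1))] at [u = -w^2/4], so that
      [J_{mu,m}(4 pi sqrt z) = (4 pi^2 x)^a e^(-i M phi) h_{a-M}(-4 pi^2 z) h_{a+M}(-4 pi^2 conj z)],
    in which the choice of the square root has disappeared ([J2_bessel_pair]). This is [x^a] times a
    double power series in [z] and [conj z] whose coefficients decay like [1/(j!^2 k!^2)]. It therefore
    grows more slowly in [x] than any exponential ([clifford_estimates]), and against [e^(-2 pi c x)]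
    with [Re c > 0] everything may be integrated term by term. The integral over [phi] keeps the terms
    with [j = k + M]; the integral over [x] turns [x^(a+2k+M)] into
    [Gamma(a+2k+M+1) / (2 pi c)^(a+2k+M+1)]. By the Chu-Vandermonde identity the coefficients
    [Gamma(a+2k+M+1) / (k! (k+M)! Gamma(a+k+1) Gamma(a+M+k+1))] that remain are those of the product of
    the series of [I_a] and [I_M] ([clifford_product]), so the sum is
    [(-1)^M I_a(4 pi/c) I_M(4 pi/c) / c] ([cvg_pair_diagonal]). The difference of the cases [mu] and
    [-mu] is the combination of [I_{-2 mu}] and [I_{2 mu}] that defines [K_{2 mu}]
    ([polar_integral_generic]).

    The term by term integration is organized as a limit of finite sums. If [|f - f_n| <= e_n B(x)],
    with [B] integrable on the half-line and [e_n -> 0], then the integrals of [f_n] converge to that of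
    [f], absolute integrability included ([polar_integral_approx]). Truncating the two power series
    gives such an approximation with [e_n = 2^(-n)].

    The Gamma integral is needed with a complex exponent [s] and a complex scale [p]. The scale is
    removed by a differential equation along the path [p = e^(t L)] ([gamma_int_scale]). The remaining
    integral is compared with Euler's limit for [1/Gamma] through [(1 - x/n)^n -> e^(-x)]
    ([euler_limit], [RGamma_gamma_int]).

    The only exceptional parameter in the strip is [mu = 0], where both the kernel and [K_{2 mu}] are
    limits of difference quotients. The same approximation principle applies to [mu_n -> 0] once the
    convergence of the kernels has a rate with an integrable weight. Such rates come from expansions
    [f(t) = f(0) + b t + O(t^2)] whose size is controlled by a submultiplicative norm ([jet]); the
    expansions propagate through Gauss' product for [1/Gamma], through the power series and through
    [x^a] ([jet_RGamma_decay], [jet_bessel_pair], [jet_sin_quotient], [polar_integral_nongeneric]). *)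

Local Open Scope R_scope.

(** * Complex sequences and series *)

Definition cvg (u : nat -> C) (l : C) : Prop :=
  forall eps, 0 < eps -> exists N, forall n, (N <= n)%nat -> Cmod (u n - l)%C < eps.

(** The sum of [n] terms, unlike [sum_n], which has [n + 1]: the truncations below are then empty at
    [n = 0] and shift without an offset. *)
Fixpoint psum (a : nat -> C) (n : nat) : C :=
  match n with O => 0%C | S p => (psum a p + a p)%C end.

Fixpoint rsum (b : nat -> R) (n : nat) : R :=
  match n with O => 0 | S p => rsum b p + b p end.

Definition sums (a : nat -> C) (l : C) : Prop := cvg (psum a) l.

Lemma Cmod_minus_sym (x y : C) : Cmod (x - y)%C = Cmod (y - x)%C.
Proof. rewrite <- Cmod_opp. f_equal. ring. Qed.

Lemma Cmod_tri3 (x y z : C) : Cmod (x - z)%C <= Cmod (x - y)%C + Cmod (y - z)%C.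
Proof.
  replace (x - z)%C with ((x - y) + (y - z))%C by ring. apply Cmod_triangle.
Qed.

Lemma Cmod_sub_le (x y : C) : Cmod (x - y)%C <= Cmod x + Cmod y.
Proof.
  unfold Cminus. rewrite <- (Cmod_opp y). apply Cmod_triangle.
Qed.

Lemma Cmod_rev_tri (x y : C) : Cmod x - Cmod y <= Cmod (x - y)%C.
Proof.
  assert (H := Cmod_triangle (x - y)%C y).
  replace (x - y + y)%C with x in H by ring. lra.
Qed.

Lemma Cmod_small_eq0 (z : C) : (forall eps, 0 < eps -> Cmod z < eps) -> z = 0%C.
Proof.
  intros H. apply Cmod_eq_0. destruct (Cmod_ge_0 z) as [H0|H0]; [|auto].
  specialize (H _ H0). lra.
Qed.

Lemma im_le_Cmod (c : C) : Rabs (Im c) <= Cmod c.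
Proof. eapply Rle_trans; [|apply Rmax_Cmod]. apply Rmax_r. Qed.

Lemma Cmod_le_Re_Im (c : C) : Cmod c <= Rabs (Re c) + Rabs (Im c).
Proof.
  destruct c as [x y]. simpl.
  replace (x, y) with (RtoC x + RtoC y * Ci)%C
    by (apply injective_projections; simpl; ring).
  eapply Rle_trans; [apply Cmod_triangle|].
  rewrite Cmod_mult, Cmod_Ci, !Cmod_R. lra.
Qed.

Lemma norm_C_R (z : C) : @norm R_AbsRing C_R_NormedModule z = Cmod z.
Proof. symmetry. apply Cmod_norm. Qed.

Lemma cvg_filterlim (u : nat -> C) (l : C) :
  cvg u l <->
  filterlim u eventually (locally (T := C_R_CompleteNormedModule) l).
Proof.
  rewrite (@filterlim_locally_ball_norm _ _ C_R_NormedModule eventually _). split.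
  - intros H eps. destruct (H eps (cond_pos eps)) as [N HN].
    exists N. intros n Hn. unfold ball_norm. rewrite norm_C_R. apply HN, Hn.
  - intros H eps Heps. destruct (H (mkposreal eps Heps)) as [N HN].
    exists N. intros n Hn. specialize (HN n Hn). unfold ball_norm in HN.
    rewrite norm_C_R in HN. exact HN.
Qed.

Lemma cvg_unique u l l' : cvg u l -> cvg u l' -> l = l'.
Proof.
  intros H H'. apply Ceq_minus, Cmod_small_eq0. intros eps Heps.
  destruct (H (eps/2)) as [N HN]; [lra|]. destruct (H' (eps/2)) as [N' HN']; [lra|].
  specialize (HN (max N N') ltac:(lia)). specialize (HN' (max N N') ltac:(lia)).
  assert (T := Cmod_tri3 l (u (max N N')) l'). rewrite (Cmod_minus_sym l (u _)) in T. lra.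
Qed.

Lemma cvg_const c : cvg (fun _ => c) c.
Proof.
  intros eps Heps. exists O. intros. replace (c - c)%C with (RtoC 0) by ring.
  rewrite Cmod_0. lra.
Qed.

Lemma cvg_ext_ge u v l N : (forall n, (N <= n)%nat -> u n = v n) -> cvg u l -> cvg v l.
Proof.
  intros E H eps Heps. destruct (H eps Heps) as [N' HN]. exists (max N N').
  intros n Hn. rewrite <- E by lia. apply HN. lia.
Qed.

Lemma cvg_ext u v l : (forall n, u n = v n) -> cvg u l -> cvg v l.
Proof. intros E. apply cvg_ext_ge with O. auto. Qed.

Lemma cvg_plus u v a b : cvg u a -> cvg v b -> cvg (fun n => (u n + v n)%C) (a + b)%C.
Proof.
  intros H H' eps Heps.
  destruct (H (eps/2)) as [N HN]; [lra|]. destruct (H' (eps/2)) as [N' HN']; [lra|].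
  exists (max N N'). intros n Hn. specialize (HN n ltac:(lia)). specialize (HN' n ltac:(lia)).
  replace (u n + v n - (a + b))%C with ((u n - a) + (v n - b))%C by ring.
  eapply Rle_lt_trans; [apply Cmod_triangle|]. lra.
Qed.

Lemma cvg_bounded u l : cvg u l -> exists K, 0 < K /\ exists N, forall n, (N <= n)%nat -> Cmod (u n) <= K.
Proof.
  intros H. destruct (H 1) as [N HN]; [lra|]. exists (Cmod l + 1). split.
  { assert (T := Cmod_ge_0 l). lra. }
  exists N. intros n Hn. specialize (HN n Hn). assert (T := Cmod_rev_tri (u n) l). lra.
Qed.

Lemma small_factor K eps : 0 < eps -> exists d, 0 < d /\ forall y, 0 <= y < d -> K * y < eps.
Proof.
  intros He. assert (HK := Rabs_pos K). assert (HK' := Rle_abs K).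
  exists (eps / (Rabs K + 1)). split; [apply Rdiv_lt_0_compat; lra|]. intros y Hy.
  apply Rle_lt_trans with ((Rabs K + 1) * y); [apply Rmult_le_compat_r; lra|].
  apply Rlt_le_trans with ((Rabs K + 1) * (eps / (Rabs K + 1))); [apply Rmult_lt_compat_l; lra|].
  right. field. lra.
Qed.

Lemma cvg_mult u v a b : cvg u a -> cvg v b -> cvg (fun n => (u n * v n)%C) (a * b)%C.
Proof.
  intros H H' eps Heps.
  destruct (cvg_bounded _ _ H) as [K [HK [N1 HN1]]].
  destruct (small_factor (Cmod b) (eps / 2)) as [d [Hd Sd]]; [lra|].
  destruct (small_factor K (eps / 2)) as [d' [Hd' Sd']]; [lra|].
  destruct (H _ Hd) as [N HN]. destruct (H' _ Hd') as [N' HN'].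
  exists (max N1 (max N N')). intros n Hn.
  specialize (HN n ltac:(lia)). specialize (HN' n ltac:(lia)). specialize (HN1 n ltac:(lia)).
  replace (u n * v n - a * b)%C with (b * (u n - a) + u n * (v n - b))%C by ring.
  eapply Rle_lt_trans; [apply Cmod_triangle|]. rewrite !Cmod_mult.
  specialize (Sd _ (conj (Cmod_ge_0 _) HN)). specialize (Sd' _ (conj (Cmod_ge_0 _) HN')).
  assert (Cmod (u n) * Cmod (v n - b)%C <= K * Cmod (v n - b)%C)
    by (apply Rmult_le_compat_r; [apply Cmod_ge_0|lra]).
  lra.
Qed.

Lemma cvg_scal c u a : cvg u a -> cvg (fun n => (c * u n)%C) (c * a)%C.
Proof. intros H. apply cvg_mult; [apply cvg_const|exact H]. Qed.

Lemma cvg_minus u v a b : cvg u a -> cvg v b -> cvg (fun n => (u n - v n)%C) (a - b)%C.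
Proof.
  intros H H'. replace (a - b)%C with (a + (-(1)) * b)%C by ring.
  apply cvg_ext with (fun n => (u n + (-(1)) * v n)%C); [intros; ring|].
  apply cvg_plus; [exact H|]. apply cvg_scal, H'.
Qed.

Lemma cvg_shift u l k : cvg (fun n => u (n + k)%nat) l <-> cvg u l.
Proof.
  split; intros H eps Heps; destruct (H eps Heps) as [N HN].
  - exists (N + k)%nat. intros n Hn. specialize (HN (n - k)%nat ltac:(lia)).
    replace (n - k + k)%nat with n in HN by lia. exact HN.
  - exists N. intros n Hn. apply HN. lia.
Qed.

Lemma cvg_norm_le u l K : cvg u l -> (forall n, Cmod (u n) <= K) -> Cmod l <= K.
Proof.
  intros H HK. apply Rnot_lt_le. intros HC. destruct (H (Cmod l - K)) as [N HN]; [lra|].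
  specialize (HN N (le_n _)). assert (T := Cmod_rev_tri l (u N)).
  rewrite Cmod_minus_sym in T. specialize (HK N). lra.
Qed.

Lemma cvg_dom u l (e : nat -> R) :
  (forall n, Cmod (u n - l)%C <= e n) ->
  (forall eps, 0 < eps -> exists N, forall n, (N <= n)%nat -> e n < eps) -> cvg u l.
Proof.
  intros H He eps Heps. destruct (He eps Heps) as [N HN]. exists N. intros n Hn.
  eapply Rle_lt_trans; [apply H|]. apply HN, Hn.
Qed.

Lemma cvg_cauchy u :
  (forall eps, 0 < eps -> exists N, forall n m, (N <= n)%nat -> (N <= m)%nat ->
      Cmod (u n - u m)%C < eps) -> exists l, cvg u l.
Proof.
  intros H.
  destruct (proj1 (@filterlim_locally_cauchy nat C_R_CompleteNormedModule eventually _ u))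
    as [l Hl].
  - intros eps. destruct (H eps (cond_pos eps)) as [N HN].
    exists (fun n => (N <= n)%nat). split; [exists N; auto|].
    intros n m Hn Hm. apply (@norm_compat1 _ C_R_NormedModule). rewrite norm_C_R. apply (HN m n Hm Hn).
  - exists l. apply cvg_filterlim, Hl.
Qed.

Lemma psum_ext a b n : (forall k, (k < n)%nat -> a k = b k) -> psum a n = psum b n.
Proof.
  induction n; intros H; simpl; [reflexivity|]. rewrite IHn, H; auto.
Qed.

Lemma psum_plus a b n : psum (fun k => (a k + b k)%C) n = (psum a n + psum b n)%C.
Proof. induction n; simpl; [ring|]. rewrite IHn. ring. Qed.

Lemma psum_scal c a n : psum (fun k => (c * a k)%C) n = (c * psum a n)%C.
Proof. induction n; simpl; [ring|]. rewrite IHn. ring. Qed.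

Lemma psum_shift a k n : psum a (k + n) = (psum a k + psum (fun i => a (k + i)%nat) n)%C.
Proof.
  induction n; simpl.
  - rewrite Nat.add_0_r. ring.
  - rewrite Nat.add_succ_r. simpl. rewrite IHn. ring.
Qed.

Lemma psum_zero (a : nat -> C) n : (forall k, (k < n)%nat -> a k = RtoC 0) -> psum a n = 0%C.
Proof. induction n; intros H; simpl; [reflexivity|]. rewrite IHn, H; auto. ring. Qed.

Lemma psum_indicator (v : C) (i n : nat) :
  psum (fun j => if Nat.eqb j i then v else 0%C) n = if Nat.ltb i n then v else 0%C.
Proof.
  induction n; simpl; [reflexivity|]. rewrite IHn.
  destruct (Nat.eqb_spec n i) as [->|Hn].
  - rewrite Nat.ltb_irrefl. destruct (Nat.ltb_spec i (S i)); [ring|lia].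
  - destruct (Nat.ltb_spec i n), (Nat.ltb_spec i (S n)); try lia; ring.
Qed.

Lemma rsum_le a b n : (forall k, a k <= b k) -> rsum a n <= rsum b n.
Proof. intros H. induction n; simpl; [lra|]. specialize (H n). lra. Qed.

Lemma rsum_scal c a n : rsum (fun k => c * a k) n = c * rsum a n.
Proof. induction n; simpl; [ring|]. rewrite IHn. ring. Qed.

Lemma rsum_mono b n m : (forall k, 0 <= b k) -> (n <= m)%nat -> rsum b n <= rsum b m.
Proof. intros Hb H. induction H; simpl; [lra|]. specialize (Hb m). lra. Qed.

Lemma psum_norm_le a b n : (forall k, Cmod (a k) <= b k) -> Cmod (psum a n) <= rsum b n.
Proof.
  intros H. induction n; simpl; [rewrite Cmod_0; lra|].
  eapply Rle_trans; [apply Cmod_triangle|]. specialize (H n). lra.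
Qed.

Lemma psum_tail_le a b n m : (forall k, Cmod (a k) <= b k) -> (n <= m)%nat ->
  Cmod (psum a m - psum a n)%C <= rsum b m - rsum b n.
Proof.
  intros H Hnm. induction Hnm; simpl.
  - replace (psum a n - psum a n)%C with (RtoC 0) by ring. rewrite Cmod_0. lra.
  - replace (psum a m + a m - psum a n)%C with ((psum a m - psum a n) + a m)%C by ring.
    eapply Rle_trans; [apply Cmod_triangle|]. specialize (H m). lra.
Qed.

(** Weierstrass majorant test. *)
Lemma sums_majorant a b B :
  (forall k, Cmod (a k) <= b k) -> (forall n, rsum b n <= B) ->
  exists l, sums a l /\ Cmod l <= B.
Proof.
  intros H HB.
  assert (Hb : forall k, 0 <= b k)
    by (intros k; eapply Rle_trans; [apply Cmod_ge_0|apply H]).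
  assert (Hg : Un_growing (rsum b)) by (intros n; simpl; specialize (Hb n); lra).
  destruct (growing_cv (rsum b) Hg) as [s Hs].
  { exists B. intros x [n ->]. apply HB. }
  destruct (cvg_cauchy (psum a)) as [l Hl].
  - intros eps Heps. destruct (Hs (eps/2)) as [N HN]; [lra|]. exists N.
    assert (A : forall n, (N <= n)%nat -> Cmod (psum a n - psum a N)%C < eps / 2).
    { intros n Hn. eapply Rle_lt_trans; [apply psum_tail_le with (b := b); auto|].
      assert (rsum b n <= s) by (apply growing_ineq; auto).
      specialize (HN N (le_n _)). unfold Rdist in HN.
      apply Rabs_def2 in HN. lra. }
    intros n m Hn Hm. eapply Rle_lt_trans; [apply (Cmod_tri3 _ (psum a N))|].
    rewrite (Cmod_minus_sym (psum a N)). specialize (A n Hn) as A1. specialize (A m Hm). lra.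
  - exists l. split; [exact Hl|]. apply cvg_norm_le with (psum a); [exact Hl|].
    intros n. eapply Rle_trans; [apply psum_norm_le with (b := b); auto|apply HB].
Qed.

Lemma sums_unique a l l' : sums a l -> sums a l' -> l = l'.
Proof. apply cvg_unique. Qed.

Lemma sums_ext a b l : (forall k, a k = b k) -> sums a l -> sums b l.
Proof. intros E. apply cvg_ext. intros n. apply psum_ext. auto. Qed.

Lemma sums_plus a b l m : sums a l -> sums b m -> sums (fun k => (a k + b k)%C) (l + m)%C.
Proof.
  intros H H'. eapply cvg_ext; [intros n; symmetry; apply psum_plus|].
  apply cvg_plus; assumption.
Qed.

Lemma sums_scal c a l : sums a l -> sums (fun k => (c * a k)%C) (c * l)%C.
Proof.
  intros H. eapply cvg_ext; [intros n; symmetry; apply psum_scal|].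
  apply cvg_scal; assumption.
Qed.

Lemma sums_shift a l k : sums a l -> sums (fun i => a (k + i)%nat) (l - psum a k)%C.
Proof.
  intros H. apply cvg_ext with (fun n => (psum a (n + k) - psum a k)%C).
  { intros n. rewrite Nat.add_comm, psum_shift. ring. }
  apply cvg_minus; [|apply cvg_const]. apply cvg_shift, H.
Qed.

Lemma sums_norm_le a b l B :
  (forall k, Cmod (a k) <= b k) -> (forall n, rsum b n <= B) -> sums a l -> Cmod l <= B.
Proof.
  intros H HB Hl. destruct (sums_majorant a b B H HB) as [l' [Hl' HB']].
  rewrite (sums_unique _ _ _ Hl Hl'). exact HB'.
Qed.

(** A majorant of the series weighted by [2 ^ k] gives geometric truncation error. *)
Lemma sums_tail_geom a b l B N :
  (forall k, Cmod (a k) * 2 ^ k <= b k) -> (forall n, rsum b n <= B) -> sums a l ->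
  Cmod (l - psum a N)%C <= (/ 2) ^ N * B.
Proof.
  intros H HB Hl.
  assert (H2 : forall k, 0 < 2 ^ k) by (intros; apply pow_lt; lra).
  assert (Hb : forall k, 0 <= b k).
  { intros k. eapply Rle_trans; [|apply H].
    apply Rmult_le_pos; [apply Cmod_ge_0|left; apply H2]. }
  apply sums_norm_le with (a := fun i => a (N + i)%nat)
    (b := fun i => (/2)^N * b (N + i)%nat).
  - intros k. rewrite pow_inv. apply Rmult_le_reg_l with (2 ^ N); [apply H2|].
    rewrite <- Rmult_assoc, Rinv_r, Rmult_1_l by (specialize (H2 N); lra).
    eapply Rle_trans; [|apply H]. rewrite Rmult_comm.
    apply Rmult_le_compat_l; [apply Cmod_ge_0|].
    apply Rle_pow; [lra|lia].
  - intros n. rewrite (rsum_scal ((/2)^N) (fun i => b (N + i)%nat)).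
    apply Rmult_le_compat_l; [apply pow_le; lra|].
    eapply Rle_trans; [|apply (HB (N + n)%nat)].
    assert (E : rsum b (N + n) = rsum b N + rsum (fun i => b (N + i)%nat) n).
    { clear. induction n; simpl; [rewrite Nat.add_0_r; ring|].
      rewrite Nat.add_succ_r. simpl. rewrite IHn. ring. }
    rewrite E. assert (T := rsum_mono b 0 N Hb ltac:(lia)). simpl in T. lra.
  - apply sums_shift, Hl.
Qed.

Lemma psum_sum_n (a : nat -> C) n : psum a (S n) = sum_n (G := C_R_NormedModule) a n.
Proof.
  induction n.
  - rewrite sum_O. simpl. ring.
  - rewrite sum_Sn, <- IHn. reflexivity.
Qed.

Lemma sums_is_series a l :
  sums a l <-> @is_series R_AbsRing C_R_CompleteNormedModule a l.
Proof.
  unfold sums, is_series.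
  rewrite <- (cvg_shift (psum a) l 1), cvg_filterlim.
  split; apply filterlim_ext; intros n; rewrite Nat.add_1_r, psum_sum_n; reflexivity.
Qed.

Lemma CSeries_sums a l : sums a l -> CSeries a = l.
Proof.
  intros H. apply (@iota_unique _ C_R_CompleteNormedModule).
  - intros l' Hl'. apply sums_is_series in Hl'. eapply sums_unique; eauto.
  - apply sums_is_series, H.
Qed.

Lemma Clim_eventually u l : cvg u l -> Clim eventually u = l.
Proof.
  intros H. apply (@iota_filterlim_locally _ C_R_CompleteNormedModule).
  - apply Proper_StrongProper, eventually_filter.
  - apply cvg_filterlim, H.
Qed.

Lemma psum_Re a n : Re (psum a n) = rsum (fun k => Re (a k)) n.
Proof. induction n; simpl; [reflexivity|]. rewrite <- IHn. reflexivity. Qed.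

Lemma psum_Im a n : Im (psum a n) = rsum (fun k => Im (a k)) n.
Proof. induction n; simpl; [reflexivity|]. rewrite <- IHn. reflexivity. Qed.

Lemma rsum_sum_f a n : rsum a (S n) = sum_f_R0 a n.
Proof. induction n; simpl in *; [ring|]. rewrite IHn. reflexivity. Qed.

Definition rcvg (u : nat -> R) (l : R) : Prop :=
  forall eps, 0 < eps -> exists N, forall n, (N <= n)%nat -> Rabs (u n - l) < eps.

Lemma rcvg_Un_cv u l : rcvg u l <-> Un_cv (fun n => u (S n)) l.
Proof.
  split; intros H eps Heps; destruct (H eps Heps) as [N HN].
  - exists N. intros n Hn. apply HN. lia.
  - exists (S N). intros n Hn. destruct n; [lia|]. apply HN. lia.
Qed.

Lemma rsum_is_series a l : rcvg (rsum a) l <-> is_series a l.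
Proof.
  rewrite rcvg_Un_cv, is_series_Reals. unfold infinite_sum, Un_cv.
  split; intros H eps Heps; destruct (H eps Heps) as [N HN]; exists N; intros n Hn;
    specialize (HN n Hn); rewrite rsum_sum_f in *; exact HN.
Qed.

Lemma cvg_Re_Im u l :
  cvg u l <-> rcvg (fun n => Re (u n)) (Re l) /\ rcvg (fun n => Im (u n)) (Im l).
Proof.
  assert (ER : forall x y : C, Re x - Re y = Re (x - y)%C) by (intros; reflexivity).
  assert (EI : forall x y : C, Im x - Im y = Im (x - y)%C) by (intros; reflexivity).
  split.
  - intros H; split; intros eps Heps; destruct (H eps Heps) as [N HN]; exists N;
      intros n Hn; (eapply Rle_lt_trans; [|apply (HN n Hn)]).
    + rewrite ER. apply re_le_Cmod.
    + rewrite EI. apply im_le_Cmod.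
  - intros [H H'] eps Heps. destruct (H (eps/2)) as [N HN]; [lra|].
    destruct (H' (eps/2)) as [N' HN']; [lra|].
    exists (max N N'). intros n Hn. specialize (HN n ltac:(lia)). specialize (HN' n ltac:(lia)).
    eapply Rle_lt_trans; [apply Cmod_le_Re_Im|]. rewrite <- ER, <- EI. lra.
Qed.

Lemma rcvg_plus u v a b : rcvg u a -> rcvg v b -> rcvg (fun n => u n + v n) (a + b).
Proof.
  intros H H' eps Heps. destruct (H (eps/2)) as [N HN]; [lra|].
  destruct (H' (eps/2)) as [N' HN']; [lra|].
  exists (max N N'). intros n Hn. specialize (HN n ltac:(lia)). specialize (HN' n ltac:(lia)).
  replace (u n + v n - (a + b)) with ((u n - a) + (v n - b)) by ring.
  eapply Rle_lt_trans; [apply Rabs_triang|]. lra.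
Qed.

Lemma rcvg_opp u a : rcvg u a -> rcvg (fun n => - u n) (- a).
Proof.
  intros H eps Heps. destruct (H eps Heps) as [N HN]. exists N. intros n Hn.
  replace (- u n - - a) with (- (u n - a)) by ring. rewrite Rabs_Ropp. auto.
Qed.

Lemma rcvg_ext u v l : (forall n, u n = v n) -> rcvg u l -> rcvg v l.
Proof.
  intros E H eps Heps. destruct (H eps Heps) as [N HN]. exists N. intros n Hn.
  rewrite <- E. auto.
Qed.

(** The theorem on products of absolutely convergent real series, applied to the four products of
    real and imaginary parts. *)
Lemma sums_Cauchy_product a b la lb (ma mb : nat -> R) A B :
  (forall k, Cmod (a k) <= ma k) -> (forall n, rsum ma n <= A) ->
  (forall k, Cmod (b k) <= mb k) -> (forall n, rsum mb n <= B) ->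
  sums a la -> sums b lb ->
  sums (fun n => psum (fun k => (a k * b (n - k)%nat)%C) (S n)) (la * lb)%C.
Proof.
  intros Ha HA Hb HB Sa Sb.
  apply cvg_Re_Im in Sa. apply cvg_Re_Im in Sb.
  destruct Sa as [Sa1 Sa2], Sb as [Sb1 Sb2].
  assert (Abs : forall (u m : nat -> R) M, (forall k, Rabs (u k) <= m k) ->
            (forall n, rsum m n <= M) -> ex_series (fun n => Rabs (u n))).
  { intros u m M Hu HM. apply (@ex_series_le R_AbsRing R_CompleteNormedModule) with m.
    - intros n. change (norm (Rabs (u n))) with (Rabs (Rabs (u n))).
      rewrite Rabs_Rabsolu. apply Hu.
    - destruct (growing_cv (rsum m)) as [s Hs].
      + intros n. simpl. assert (0 <= m n); [|lra].
        eapply Rle_trans; [apply Rabs_pos|apply Hu].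
      + exists M. intros x [n ->]. apply HM.
      + exists s. apply rsum_is_series. intros eps Heps. apply (Hs eps Heps). }
  assert (P : forall u v lu lv, rcvg (rsum u) lu -> rcvg (rsum v) lv ->
     ex_series (fun n => Rabs (u n)) -> ex_series (fun n => Rabs (v n)) ->
     rcvg (rsum (fun n => rsum (fun k => u k * v (n - k)%nat) (S n))) (lu * lv)).
  { intros u v lu lv Hu Hv Eu Ev. apply rsum_is_series.
    apply is_series_ext with (fun n => sum_f_R0 (fun k => u k * v (n - k)%nat) n).
    - intros n. rewrite rsum_sum_f. reflexivity.
    - apply is_series_mult; auto; apply rsum_is_series; auto. }
  assert (Ra := Abs (fun k => Re (a k)) ma A (fun k => Rle_trans _ _ _ (re_le_Cmod _) (Ha k)) HA).
  assert (Ia := Abs (fun k => Im (a k)) ma A (fun k => Rle_trans _ _ _ (im_le_Cmod _) (Ha k)) HA).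
  assert (Rb := Abs (fun k => Re (b k)) mb B (fun k => Rle_trans _ _ _ (re_le_Cmod _) (Hb k)) HB).
  assert (Ib := Abs (fun k => Im (b k)) mb B (fun k => Rle_trans _ _ _ (im_le_Cmod _) (Hb k)) HB).
  assert (ext : forall (u v : nat -> R) n, (forall k, u k = v k) -> rsum u n = rsum v n).
  { intros u v n E. induction n; simpl; [auto|]. rewrite IHn, E. auto. }
  assert (radd : forall (u v : nat -> R) n, rsum (fun k => u k + v k) n = rsum u n + rsum v n).
  { intros u v n. induction n; simpl; [ring|]. rewrite IHn. ring. }
  assert (ropp : forall (u : nat -> R) n, rsum (fun k => - u k) n = - rsum u n).
  { intros u n. induction n; simpl; [ring|]. rewrite IHn. ring. }
  assert (Sa1' : rcvg (rsum (fun k => Re (a k))) (Re la)).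
  { eapply rcvg_ext; [intros n; apply psum_Re|exact Sa1]. }
  assert (Sa2' : rcvg (rsum (fun k => Im (a k))) (Im la)).
  { eapply rcvg_ext; [intros n; apply psum_Im|exact Sa2]. }
  assert (Sb1' : rcvg (rsum (fun k => Re (b k))) (Re lb)).
  { eapply rcvg_ext; [intros n; apply psum_Re|exact Sb1]. }
  assert (Sb2' : rcvg (rsum (fun k => Im (b k))) (Im lb)).
  { eapply rcvg_ext; [intros n; apply psum_Im|exact Sb2]. }
  apply cvg_Re_Im; split.
  - replace (Re (la * lb)%C) with (Re la * Re lb + - (Im la * Im lb))
      by (unfold Re, Im, Cmult; simpl; ring).
    eapply rcvg_ext; [|apply rcvg_plus; [|apply rcvg_opp]; eapply P; eauto].
    intros n. cbv beta. rewrite psum_Re, <- ropp, <- radd. apply ext. intros j.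
    rewrite psum_Re, <- ropp, <- radd. apply ext. intros k.
    unfold Re, Im, Cmult; simpl; ring.
  - replace (Im (la * lb)%C) with (Re la * Im lb + Im la * Re lb)
      by (unfold Re, Im, Cmult; simpl; ring).
    eapply rcvg_ext; [|apply rcvg_plus; eapply P; eauto].
    intros n. cbv beta. rewrite psum_Im, <- radd. apply ext. intros j.
    rewrite psum_Im, <- radd. apply ext. intros k.
    unfold Re, Im, Cmult; simpl; ring.
Qed.

Lemma rsum_exp_le y n : 0 <= y -> rsum (fun k => y ^ k / INR (fact k)) n <= exp y.
Proof.
  intros Hy. destruct n; [simpl; left; apply exp_pos|].
  rewrite rsum_sum_f. apply exp_ge_taylor, Hy.
Qed.

(** [sum_k y^k / k!^2] grows slower than every exponential, because
    [d^(-k) / k! <= exp (1/d)]. *)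
Lemma rsum_inv_fact2_le d y n : 0 < d -> 0 <= y ->
  rsum (fun k => y ^ k / (INR (fact k) * INR (fact k))) n <= exp (/ d) * exp (d * y).
Proof.
  intros Hd Hy.
  apply Rle_trans with (rsum (fun k => exp (/ d) * ((d * y) ^ k / INR (fact k))) n).
  - apply rsum_le. intros k.
    assert (F := INR_fact_lt_0 k).
    assert (T := exp_ge_taylor (/ d) k ltac:(left; apply Rinv_0_lt_compat; auto)).
    assert (T2 : (/ d) ^ k / INR (fact k) <= exp (/ d)).
    { eapply Rle_trans; [|exact T]. destruct k; [simpl; lra|]. rewrite tech5.
      assert (0 <= sum_f_R0 (fun k0 => (/ d) ^ k0 / INR (fact k0)) k); [|lra].
      apply cond_pos_sum. intros i. apply Rmult_le_pos.
      - apply pow_le. left. apply Rinv_0_lt_compat; auto.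
      - left. apply Rinv_0_lt_compat, INR_fact_lt_0. }
    replace (y ^ k / (INR (fact k) * INR (fact k)))
      with (((/ d) ^ k / INR (fact k)) * ((d * y) ^ k / INR (fact k))).
    + apply Rmult_le_compat_r; [|exact T2].
      apply Rmult_le_pos; [apply pow_le, Rmult_le_pos; lra|left; apply Rinv_0_lt_compat; auto].
    + rewrite Rpow_mult_distr, pow_inv. field. split; [lra|]. apply pow_nonzero. lra.
  - rewrite (rsum_scal (exp (/ d)) (fun k => (d * y) ^ k / INR (fact k))).
    apply Rmult_le_compat_l; [left; apply exp_pos|]. apply rsum_exp_le, Rmult_le_pos; lra.
Qed.

(** * The complex exponential and logarithm *)

Lemma Cexp_pair z : Cexp z = (exp (Re z) * cos (Im z), exp (Re z) * sin (Im z)).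
Proof. apply injective_projections; unfold Cexp; simpl; ring. Qed.

Lemma Cexp_plus z w : Cexp (z + w)%C = (Cexp z * Cexp w)%C.
Proof.
  rewrite !Cexp_pair. unfold Re, Im, Cmult, Cplus; simpl.
  rewrite exp_plus, cos_plus, sin_plus. apply injective_projections; simpl; ring.
Qed.

Lemma Cexp_RtoC x : Cexp (RtoC x) = RtoC (exp x).
Proof.
  rewrite Cexp_pair. unfold RtoC, Re, Im; simpl. rewrite cos_0, sin_0.
  apply injective_projections; simpl; ring.
Qed.

Lemma Cexp_0 : Cexp (RtoC 0) = RtoC 1.
Proof. rewrite Cexp_RtoC, exp_0. reflexivity. Qed.

Lemma Cmod_Cexp z : Cmod (Cexp z) = exp (Re z).
Proof.
  unfold Cexp. rewrite Cmod_mult, Cmod_R, Rabs_pos_eq by (left; apply exp_pos).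
  assert (H : Cmod (cos (Im z), sin (Im z)) = 1).
  { unfold Cmod; simpl.
    replace (cos (Im z) * (cos (Im z) * 1) + sin (Im z) * (sin (Im z) * 1)) with 1.
    - apply sqrt_1.
    - assert (T := sin2_cos2 (Im z)). unfold Rsqr in T. lra. }
  rewrite H. ring.
Qed.

Lemma Cexp_neq_0 z : Cexp z <> RtoC 0.
Proof. apply Cmod_gt_0. rewrite Cmod_Cexp. apply exp_pos. Qed.

Lemma Cexp_opp z : Cexp (- z)%C = (/ Cexp z)%C.
Proof.
  assert (H : (Cexp (- z) * Cexp z)%C = RtoC 1).
  { rewrite <- Cexp_plus. replace (- z + z)%C with (RtoC 0) by ring. apply Cexp_0. }
  rewrite <- (Cmult_1_l (/ Cexp z)%C), <- H. field. apply Cexp_neq_0.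
Qed.

Lemma Cexp_pow z n : (Cexp z ^ n)%C = Cexp (INR n * z)%C.
Proof.
  induction n.
  - simpl. replace (0 * z)%C with (RtoC 0) by ring. symmetry; apply Cexp_0.
  - rewrite Cpow_S, IHn, <- Cexp_plus. f_equal. rewrite S_INR, RtoC_plus. ring.
Qed.

Lemma Cconj_Cexp z : Cconj (Cexp z) = Cexp (Cconj z).
Proof.
  rewrite !Cexp_pair. unfold Cconj, Re, Im; simpl. rewrite cos_neg, sin_neg.
  apply injective_projections; simpl; ring.
Qed.

Lemma Cexp_Clog z : z <> RtoC 0 -> Cexp (Clog z) = z.
Proof.
  intros Hz. assert (Hm : 0 < Cmod z) by (apply Cmod_gt_0; auto).
  rewrite Cexp_pair. unfold Clog. unfold Re at 1 2, Im at 1 2. cbn [fst snd].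
  rewrite exp_ln by exact Hm.
  assert (Hb : -1 <= Re z / Cmod z <= 1).
  { assert (T := re_le_Cmod z). apply Rabs_le_between in T.
    split; apply Rmult_le_reg_r with (Cmod z); auto; unfold Rdiv;
      rewrite Rmult_assoc, Rinv_l by lra; lra. }
  assert (S : Cmod z * sin (acos (Re z / Cmod z)) = Rabs (Im z)).
  { rewrite sin_acos by exact Hb.
    rewrite <- (sqrt_Rsqr (Cmod z)) at 1 by lra. rewrite <- sqrt_mult_alt by apply Rle_0_sqr.
    replace (Rsqr (Cmod z) * (1 - Rsqr (Re z / Cmod z))) with (Rsqr (Im z)).
    - apply sqrt_Rsqr_abs.
    - assert (T := Cmod2_alt z). unfold Rsqr.
      replace (Im z * Im z) with (Im z ^ 2) by ring.
      replace (Im z ^ 2) with (Cmod z ^ 2 - Re z ^ 2) by lra. field. lra. }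
  assert (C0 : Cmod z * cos (acos (Re z / Cmod z)) = Re z).
  { rewrite cos_acos by exact Hb. field. lra. }
  unfold Carg. destruct (Rle_dec 0 (Im z)) as [Hi|Hi].
  - apply injective_projections; cbn [fst snd]; [exact C0|].
    rewrite S, Rabs_pos_eq by exact Hi. reflexivity.
  - rewrite cos_neg, sin_neg. apply injective_projections; cbn [fst snd]; [exact C0|].
    replace (Cmod z * - sin (acos (Re z / Cmod z)))
      with (- (Cmod z * sin (acos (Re z / Cmod z)))) by ring.
    rewrite S, Rabs_left by lra. unfold Im. ring.
Qed.

Lemma Re_pos_of_Carg c : c <> RtoC 0 -> Rabs (Carg c) < PI / 2 -> 0 < Re c.
Proof.
  intros Hc H. rewrite <- (Cexp_Clog c Hc), Cexp_pair. unfold Re at 1, Clog; simpl.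
  apply Rmult_lt_0_compat; [apply exp_pos|]. apply Rabs_def2 in H. apply cos_gt_0; lra.
Qed.

(** On the right half-plane the principal logarithm is compatible with inversion. *)
Lemma Clog_div c r : 0 < Re c -> 0 < r -> Clog (r / c)%C = (ln r - Clog c)%C.
Proof.
  intros Hc Hr.
  assert (Hc0 : c <> RtoC 0) by (intros ->; simpl in Hc; lra).
  assert (Hm : 0 < Cmod c) by (apply Cmod_gt_0; auto).
  assert (Hmr : Cmod (r / c)%C = r / Cmod c).
  { rewrite Cmod_div, Cmod_R, Rabs_pos_eq by (auto; lra). reflexivity. }
  assert (ER : Re (r / c)%C = r * Re c / Cmod c ^ 2).
  { rewrite Cmod2_alt. destruct c as [a b]. unfold Re, Im, Cdiv, Cinv, Cmult, RtoC in *; simpl in *.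
    field. nra. }
  assert (EI : Im (r / c)%C = - (r * Im c / Cmod c ^ 2)).
  { rewrite Cmod2_alt. destruct c as [a b]. unfold Re, Im, Cdiv, Cinv, Cmult, RtoC in *; simpl in *.
    field. nra. }
  assert (Hq : Re (r / c)%C / Cmod (r / c)%C = Re c / Cmod c).
  { rewrite Hmr, ER. field. lra. }
  unfold Clog. rewrite Hmr. unfold Carg. rewrite Hq.
  assert (Hln : ln (r / Cmod c) = ln r - ln (Cmod c)) by (apply ln_div; auto).
  rewrite Hln.
  assert (P : 0 < r / Cmod c ^ 2) by (apply Rdiv_lt_0_compat; [auto|apply pow_lt; auto]).
  assert (EI' : Im (r / c)%C = - (r / Cmod c ^ 2 * Im c)) by (rewrite EI; field; lra).
  assert (Z : Im c = 0 -> acos (Re c / Cmod c) = 0).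
  { intros Z. assert (T := Cmod2_alt c). rewrite Z in T.
    assert (Cmod c = Re c) by nra. rewrite H. unfold Rdiv. rewrite Rinv_r by lra. apply acos_1. }
  destruct (Rle_dec 0 (Im (r / c)%C)) as [H1|H1], (Rle_dec 0 (Im c)) as [H2|H2];
    apply injective_projections; cbn [fst snd Cminus Cplus Copp RtoC]; try ring.
  - assert (Im c = 0) by nra. rewrite Z by auto. ring.
  - exfalso. nra.
Qed.

(** * Complex functions of a real variable *)

Definition Cder (f : R -> C) (t : R) (l : C) : Prop :=
  is_derive (fun s => Re (f s)) t (Re l) /\ is_derive (fun s => Im (f s)) t (Im l).

Definition Ccont (f : R -> C) (t : R) : Prop :=
  continuous (fun s => Re (f s)) t /\ continuous (fun s => Im (f s)) t.

Lemma C_R_decomp (z : C) :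
  z = plus (G := C_R_NormedModule)
        (scal (V := C_R_NormedModule) (Re z) (RtoC 1)) (scal (V := C_R_NormedModule) (Im z) Ci).
Proof. apply injective_projections; unfold Re, Im, scal, plus; simpl; unfold scal, plus; simpl; unfold mult; simpl; ring. Qed.

Lemma Cder_is_derive f t l : Cder f t l -> is_derive (V := C_R_NormedModule) f t l.
Proof.
  intros [H1 H2]. rewrite (C_R_decomp l).
  apply is_derive_ext with (fun s => plus (G := C_R_NormedModule)
        (scal (V := C_R_NormedModule) (Re (f s)) (RtoC 1)) (scal (V := C_R_NormedModule) (Im (f s)) Ci)).
  - intros s. symmetry. apply C_R_decomp.
  - apply (is_derive_plus (V := C_R_NormedModule)); apply (is_derive_scal_l (V := C_R_NormedModule)); assumption.
Qed.

Lemma Ccont_continuous f t : Ccont f t -> continuous (U := C_R_NormedModule) f t.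
Proof.
  intros [H1 H2].
  apply continuous_ext with (fun s => plus (G := C_R_NormedModule)
        (scal (V := C_R_NormedModule) (Re (f s)) (RtoC 1)) (scal (V := C_R_NormedModule) (Im (f s)) Ci)).
  - intros s. symmetry. apply C_R_decomp.
  - apply (continuous_plus (V := C_R_NormedModule));
      apply (continuous_scal_l (V := C_R_NormedModule)); assumption.
Qed.

Lemma Cder_Ccont f t l : Cder f t l -> Ccont f t.
Proof. intros [H1 H2]; split; apply (@ex_derive_continuous R_AbsRing R_NormedModule); eexists; eassumption. Qed.

Lemma Ccont_ext f g t : (forall s, f s = g s) -> Ccont f t -> Ccont g t.
Proof.
  intros E [H1 H2]. split.
  - apply continuous_ext with (fun s => Re (f s)); [intros s; rewrite E; reflexivity|exact H1].
  - apply continuous_ext with (fun s => Im (f s)); [intros s; rewrite E; reflexivity|exact H2].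
Qed.

Lemma Cder_ext f g t l : (forall s, f s = g s) -> Cder f t l -> Cder g t l.
Proof.
  intros E [H1 H2]. split.
  - apply is_derive_ext with (fun s => Re (f s)); [intros s; rewrite E; reflexivity|exact H1].
  - apply is_derive_ext with (fun s => Im (f s)); [intros s; rewrite E; reflexivity|exact H2].
Qed.

Lemma Ccont_const c t : Ccont (fun _ => c) t.
Proof. split; apply continuous_const. Qed.

Lemma Cder_const c t : Cder (fun _ => c) t (RtoC 0).
Proof.
  split; [exact (@is_derive_const R_AbsRing R_NormedModule (Re c) t)
         |exact (@is_derive_const R_AbsRing R_NormedModule (Im c) t)].
Qed.

Lemma Ccont_RtoC (f : R -> R) t : continuous f t -> Ccont (fun s => RtoC (f s)) t.
Proof. intros H. split; [exact H|apply continuous_const]. Qed.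

Lemma Cder_RtoC (f : R -> R) t l : is_derive f t l -> Cder (fun s => RtoC (f s)) t l.
Proof. intros H. split; [exact H|exact (@is_derive_const R_AbsRing R_NormedModule 0 t)]. Qed.

Lemma Ccont_plus f g t : Ccont f t -> Ccont g t -> Ccont (fun s => (f s + g s)%C) t.
Proof.
  intros [H1 H2] [H3 H4]. split; apply (continuous_plus (V := R_NormedModule)); assumption.
Qed.

Lemma Cder_plus f g t l m : Cder f t l -> Cder g t m -> Cder (fun s => (f s + g s)%C) t (l + m)%C.
Proof.
  intros [H1 H2] [H3 H4]. split; apply (is_derive_plus (V := R_NormedModule)); assumption.
Qed.

Lemma Ccont_mult f g t : Ccont f t -> Ccont g t -> Ccont (fun s => (f s * g s)%C) t.
Proof.
  intros [H1 H2] [H3 H4]. split; unfold Cmult; simpl.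
  - apply (continuous_minus (V := R_NormedModule)); apply (continuous_mult (K := R_AbsRing)); assumption.
  - apply (continuous_plus (V := R_NormedModule)); apply (continuous_mult (K := R_AbsRing)); assumption.
Qed.

Lemma Cder_mult f g t l m : Cder f t l -> Cder g t m ->
  Cder (fun s => (f s * g s)%C) t (l * g t + f t * m)%C.
Proof.
  intros [H1 H2] [H3 H4].
  assert (M : forall (u v : R -> R) du dv, is_derive u t du -> is_derive v t dv ->
     is_derive (fun s => u s * v s) t (du * v t + u t * dv)).
  { intros u v du dv Hu Hv. apply (is_derive_mult (K := R_AbsRing)); auto.
    intros; apply Rmult_comm. }
  split; unfold Re, Im, Cmult, Cplus in *; simpl in *.
  - eapply is_derive_ext; [intros s; reflexivity|].
    replace (_ + _) with ((fst l * fst (g t) + fst (f t) * fst m)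
        - (snd l * snd (g t) + snd (f t) * snd m)) by ring.
    apply (is_derive_minus (V := R_NormedModule)); apply M; assumption.
  - replace (_ + _) with ((fst l * snd (g t) + fst (f t) * snd m)
        + (snd l * fst (g t) + snd (f t) * fst m)) by ring.
    apply (is_derive_plus (V := R_NormedModule)); apply M; assumption.
Qed.

Lemma Cder_scal c f t l : Cder f t l -> Cder (fun s => (c * f s)%C) t (c * l)%C.
Proof.
  intros H. replace (c * l)%C with (RtoC 0 * f t + c * l)%C by ring.
  apply (Cder_mult (fun _ => c)); [apply Cder_const|exact H].
Qed.

Lemma Cder_exp g t l : Cder g t l -> Cder (fun s => Cexp (g s)) t (l * Cexp (g t))%C.
Proof.
  intros [H1 H2].
  apply Cder_ext with (fun s => (exp (Re (g s)) * (cos (Im (g s)) + Ci * sin (Im (g s))))%C).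
  { intros s. unfold Cexp. f_equal. apply injective_projections; simpl; ring. }
  replace (l * Cexp (g t))%C with
    (RtoC (Re l * exp (Re (g t))) * (cos (Im (g t)) + Ci * sin (Im (g t)))
     + exp (Re (g t)) * (RtoC (Im l * (- sin (Im (g t)))) + Ci * RtoC (Im l * cos (Im (g t)))))%C.
  - apply Cder_mult with (f := fun s => RtoC (exp (Re (g s))))
      (g := fun s => (cos (Im (g s)) + Ci * sin (Im (g s)))%C).
    + apply Cder_RtoC. apply (is_derive_comp exp (fun s => Re (g s))); [apply is_derive_exp|exact H1].
    + apply Cder_plus; [|apply Cder_scal]; apply Cder_RtoC.
      * apply (is_derive_comp cos (fun s => Im (g s))); [apply is_derive_cos|exact H2].
      * apply (is_derive_comp sin (fun s => Im (g s))); [apply is_derive_sin|exact H2].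
  - rewrite Cexp_pair. apply injective_projections; unfold Re, Im; simpl; ring.
Qed.

Lemma Ccont_exp g t : Ccont g t -> Ccont (fun s => Cexp (g s)) t.
Proof.
  intros [H1 H2].
  apply Ccont_ext with (fun s => (exp (Re (g s)) * (cos (Im (g s)) + Ci * sin (Im (g s))))%C).
  { intros s. unfold Cexp. f_equal. apply injective_projections; simpl; ring. }
  apply Ccont_mult; [|apply Ccont_plus; [|apply Ccont_mult; [apply Ccont_const|]]]; apply Ccont_RtoC.
  - apply continuous_comp; [exact H1|]. apply (@ex_derive_continuous R_AbsRing R_NormedModule). eexists; apply is_derive_exp.
  - apply continuous_comp; [exact H2|]. apply (@ex_derive_continuous R_AbsRing R_NormedModule). eexists; apply is_derive_cos.
  - apply continuous_comp; [exact H2|]. apply (@ex_derive_continuous R_AbsRing R_NormedModule). eexists; apply is_derive_sin.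
Qed.

Lemma Ccont_ln x : 0 < x -> Ccont (fun s => RtoC (ln s)) x.
Proof.
  intros Hx. apply Ccont_RtoC, (@ex_derive_continuous R_AbsRing R_NormedModule). eexists. apply is_derive_ln, Hx.
Qed.

Lemma Ccont_id x : Ccont (fun s => RtoC s) x.
Proof. apply Ccont_RtoC, continuous_id. Qed.

Lemma Ccont_Cmod f t : Ccont f t -> continuous (fun s => Cmod (f s)) t.
Proof.
  intros [H1 H2]. unfold Cmod. apply continuous_comp with (g := sqrt).
  - apply (continuous_plus (V := R_NormedModule)); simpl;
      (apply (continuous_mult (K := R_AbsRing)); [assumption|]);
      (apply (continuous_mult (K := R_AbsRing)); [assumption|apply continuous_const]).
  - apply continuous_sqrt.
Qed.

Notation is_CInt := (@is_RInt C_R_CompleteNormedModule).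
Notation ex_CInt := (@ex_RInt C_R_CompleteNormedModule).

Lemma CInt_derive f df a b : a <= b ->
  (forall x, a <= x <= b -> Cder f x (df x)) ->
  (forall x, a <= x <= b -> Ccont df x) ->
  is_CInt df a b (f b - f a)%C.
Proof.
  intros Hab H1 H2.
  apply (@is_RInt_derive C_R_CompleteNormedModule);
    rewrite Rmin_left, Rmax_right by exact Hab; intros x Hx.
  - apply Cder_is_derive, H1, Hx.
  - apply Ccont_continuous, H2, Hx.
Qed.

Lemma CInt_norm_le f (g : R -> R) a b l m : a <= b ->
  (forall x, a <= x <= b -> Cmod (f x) <= g x) ->
  is_CInt f a b l -> is_RInt g a b m -> Cmod l <= m.
Proof.
  intros Hab H Hf Hg. rewrite <- norm_C_R.
  apply (@norm_RInt_le C_R_NormedModule f g a b); auto.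
  intros x Hx. rewrite norm_C_R. auto.
Qed.

(** Integrating the derivative replaces the mean value theorem, which fails for complex values. *)
Lemma Cder_mean_value f df a b K : a <= b ->
  (forall x, a <= x <= b -> Cder f x (df x)) ->
  (forall x, a <= x <= b -> Ccont df x) ->
  (forall x, a <= x <= b -> Cmod (df x) <= K) ->
  Cmod (f b - f a)%C <= K * (b - a).
Proof.
  intros Hab H1 H2 H3.
  apply CInt_norm_le with (f := df) (g := fun _ => K) (a := a) (b := b); auto.
  - apply CInt_derive; auto.
  - rewrite Rmult_comm. apply (@is_RInt_const R_NormedModule).
Qed.

Lemma Cder_lin z t : Cder (fun s => (s * z)%C) t z.
Proof.
  assert (H : Cder (fun s => (s * z)%C) t (RtoC 1 * z + t * RtoC 0)%C).
  { apply (Cder_mult (fun s => RtoC s) (fun _ => z)); [|apply Cder_const].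
    apply Cder_RtoC. exact (@is_derive_id R_AbsRing t). }
  replace (RtoC 1 * z + t * RtoC 0)%C with z in H by ring. exact H.
Qed.

Lemma Re_le_Cmod z : Re z <= Cmod z.
Proof. eapply Rle_trans; [apply Rle_abs|apply re_le_Cmod]. Qed.

Lemma exp_le_compat x y : x <= y -> exp x <= exp y.
Proof. intros [H| ->]; [left; apply exp_increasing, H|apply Rle_refl]. Qed.

Lemma Cexp_sub_1_le z : Cmod (Cexp z - 1)%C <= Cmod z * exp (Cmod z).
Proof.
  assert (H := Cder_mean_value (fun s => Cexp (s * z)%C)
     (fun s => (z * Cexp (s * z))%C) 0 1 (Cmod z * exp (Cmod z)) ltac:(lra)).
  replace (Cexp z - 1)%C with (Cexp (RtoC 1 * z) - Cexp (RtoC 0 * z))%C.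
  - replace (Cmod z * exp (Cmod z)) with (Cmod z * exp (Cmod z) * (1 - 0)) by ring.
    apply H; intros x Hx.
    + apply Cder_exp, Cder_lin.
    + apply Ccont_mult; [apply Ccont_const|]. eapply Cder_Ccont, Cder_exp, Cder_lin.
    + rewrite Cmod_mult, Cmod_Cexp. apply Rmult_le_compat_l; [apply Cmod_ge_0|].
      apply exp_le_compat. eapply Rle_trans; [apply Re_le_Cmod|].
      rewrite Cmod_mult, Cmod_R, Rabs_pos_eq by lra.
      assert (T := Cmod_ge_0 z). nra.
  - rewrite Cmult_1_l, Cmult_0_l, Cexp_0. reflexivity.
Qed.

Lemma Cexp_sub_1_sub_id_le z : Cmod (Cexp z - 1 - z)%C <= Cmod z ^ 2 * exp (Cmod z).
Proof.
  assert (H := Cder_mean_value (fun s => Cexp (s * z) + (-(1)) * (s * z))%C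
     (fun s => (z * Cexp (s * z) + (-(1)) * z)%C) 0 1 (Cmod z ^ 2 * exp (Cmod z)) ltac:(lra)).
  replace (Cexp z - 1 - z)%C with
    (Cexp (RtoC 1 * z) + (-(1)) * (RtoC 1 * z) - (Cexp (RtoC 0 * z) + (-(1)) * (RtoC 0 * z)))%C.
  - replace (Cmod z ^ 2 * exp (Cmod z)) with (Cmod z ^ 2 * exp (Cmod z) * (1 - 0)) by ring.
    apply H; intros x Hx.
    + apply Cder_plus; [apply Cder_exp, Cder_lin|apply Cder_scal, Cder_lin].
    + apply Ccont_plus; [|apply Ccont_const].
      apply Ccont_mult; [apply Ccont_const|]. eapply Cder_Ccont, Cder_exp, Cder_lin.
    + replace (z * Cexp (x * z) + - (1) * z)%C with (z * (Cexp (x * z) - 1))%C by ring.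
      rewrite Cmod_mult. simpl. rewrite Rmult_1_r, Rmult_assoc.
      assert (T := Cmod_ge_0 z).
      apply Rmult_le_compat_l; [auto|].
      eapply Rle_trans; [apply Cexp_sub_1_le|].
      assert (E : Cmod (x * z)%C <= Cmod z).
      { rewrite Cmod_mult, Cmod_R, Rabs_pos_eq by lra. nra. }
      apply Rmult_le_compat; [apply Cmod_ge_0|left; apply exp_pos|auto|].
      apply exp_le_compat, E.
  - rewrite !Cmult_1_l, !Cmult_0_l, Cexp_0. ring.
Qed.

(** * Improper integrals on the half-line *)

Definition is_half (V : CompleteNormedModule R_AbsRing) (f : R -> V) (l : V) : Prop :=
  @is_RInt_gen V f (at_right 0) (Rbar_locally p_infty) l.

Lemma at_right_0_intro (P : R -> Prop) d : 0 < d -> (forall a, 0 < a < d -> P a) -> at_right 0 P.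
Proof.
  intros Hd H. exists (mkposreal d Hd). intros y Hy Hy0. apply H. split; [exact Hy0|].
  assert (T : Rabs (y - 0) < d) by exact Hy. rewrite Rminus_0_r in T.
  apply Rabs_def2 in T. lra.
Qed.

Lemma at_right_0_elim (P : R -> Prop) : at_right 0 P -> exists d, 0 < d /\ forall a, 0 < a < d -> P a.
Proof.
  intros [d H]. exists d. split; [apply cond_pos|]. intros a Ha. apply H; [|lra].
  change (Rabs (a - 0) < d). rewrite Rminus_0_r, Rabs_pos_eq; lra.
Qed.


Lemma is_half_intro (V : CompleteNormedModule R_AbsRing) (f : R -> V) (l : V) :
  (forall a b, 0 < a <= b -> ex_RInt f a b) ->
  (forall eps, 0 < eps -> exists d A, 0 < d /\
     forall a b, 0 < a < d -> A < b -> a <= b -> norm (minus (RInt f a b) l) < eps) ->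
  is_half V f l.
Proof.
  intros Hex Hlim P [eps Heps].
  destruct (Hlim eps (cond_pos eps)) as [d [A [Hd H]]].
  apply Filter_prod with (fun a => 0 < a < d) (fun b => Rmax A d < b).
  - apply at_right_0_intro with d; auto.
  - exists (Rmax A d). auto.
  - intros a b Ha Hb. assert (Hb1 := Rmax_l A d). assert (Hb2 := Rmax_r A d).
    exists (RInt f a b). split.
    + apply RInt_correct, Hex. lra.
    + apply Heps. apply (@norm_compat1 R_AbsRing V), H; lra.
Qed.

Lemma is_half_elim (V : CompleteNormedModule R_AbsRing) (f : R -> V) (l : V) :
  is_half V f l -> forall eps, 0 < eps -> exists d A, 0 < d /\
     forall a b, 0 < a < d -> A < b -> a <= b ->
       ex_RInt f a b /\ norm (minus (RInt f a b) l) < eps.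
Proof.
  intros H eps Heps.
  assert (L : locally l (fun y => norm (minus y l) < eps)).
  { apply (@locally_le_locally_norm R_AbsRing V). exists (mkposreal eps Heps). intros y Hy. exact Hy. }
  destruct (H _ L) as [Q R HQ [A HR] HQR].
  destruct (at_right_0_elim _ HQ) as [d [Hd HQ']].
  exists d, A. split; [exact Hd|]. intros a b Ha Hb Hab.
  destruct (HQR a b (HQ' a Ha) (HR b Hb)) as [y [Hy1 Hy2]]. simpl in Hy1.
  split; [exists y; exact Hy1|]. rewrite (is_RInt_unique _ _ _ _ Hy1). exact Hy2.
Qed.

Lemma is_half_elim_beyond (V : CompleteNormedModule R_AbsRing) (f : R -> V) (l : V) x y eps :
  is_half V f l -> 0 < eps -> 0 < x <= y -> exists a b, 0 < a <= x /\ y <= b /\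
    ex_RInt f a b /\ norm (minus (RInt f a b) l) < eps.
Proof.
  intros H Heps Hxy. destruct (is_half_elim V f l H eps Heps) as [d [A [Hd HH]]].
  exists (Rmin x (d / 2)), (Rmax y (A + 1)).
  assert (M1 := Rmin_l x (d / 2)). assert (M2 := Rmin_r x (d / 2)).
  assert (M3 := Rmax_l y (A + 1)). assert (M4 := Rmax_r y (A + 1)).
  assert (P : 0 < Rmin x (d / 2)) by (apply Rmin_pos; lra).
  split; [lra|]. split; [lra|]. apply HH; lra.
Qed.

Lemma is_half_ex_RInt (V : CompleteNormedModule R_AbsRing) (f : R -> V) (l : V) a b :
  is_half V f l -> 0 < a <= b -> ex_RInt f a b.
Proof.
  intros H Hab. destruct (is_half_elim_beyond V f l a b 1 H) as [a' [b' [Ha [Hb [E _]]]]]; [lra|lra|].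
  apply (@ex_RInt_Chasles_1 V) with b'; [lra|].
  apply (@ex_RInt_Chasles_2 V) with a'; [lra|]. exact E.
Qed.

(** By positivity the integrals over compact intervals increase to the improper one. *)
Lemma is_half_R_tail (B : R -> R) b : is_half R_CompleteNormedModule B b ->
  (forall x, 0 < x -> 0 <= B x) ->
  forall x y, 0 < x <= y -> RInt B x y <= b.
Proof.
  intros H HB x y Hxy. apply Rnot_lt_le. intros HC.
  destruct (is_half_elim_beyond R_CompleteNormedModule B b x y (RInt B x y - b) H)
    as [a' [b' [Ha' [Hb' [E T]]]]]; [lra|lra|].
  assert (T' : Rabs (RInt B a' b' - b) < RInt B x y - b) by exact T. apply Rabs_def2 in T'.
  assert (E1 : ex_RInt B a' x) by (apply (is_half_ex_RInt R_CompleteNormedModule B b); auto; lra).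
  assert (E2 : ex_RInt B x y) by (apply (is_half_ex_RInt R_CompleteNormedModule B b); auto; lra).
  assert (E3 : ex_RInt B y b') by (apply (is_half_ex_RInt R_CompleteNormedModule B b); auto; lra).
  assert (P1 : 0 <= RInt B a' x) by (apply RInt_ge_0; [lra|auto|intros; apply HB; lra]).
  assert (P3 : 0 <= RInt B y b') by (apply RInt_ge_0; [lra|auto|intros; apply HB; lra]).
  assert (S : RInt B a' b' = RInt B a' x + (RInt B x y + RInt B y b')).
  { rewrite <- (@RInt_Chasles R_CompleteNormedModule B a' x b'); auto.
    - rewrite <- (@RInt_Chasles R_CompleteNormedModule B x y b'); auto.
    - apply (@ex_RInt_Chasles R_NormedModule) with y; auto. }
  lra.
Qed.

Lemma plus_minus_cancel (G : AbelianGroup) (x l : G) : plus x (minus l x) = l.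
Proof. unfold minus. rewrite (plus_comm l), plus_assoc, (plus_opp_r x), plus_zero_l. reflexivity. Qed.

Lemma minus_plus_cancel (G : AbelianGroup) (x l : G) : plus (minus l x) x = l.
Proof. rewrite plus_comm. apply plus_minus_cancel. Qed.

Lemma minus_plus3_mid (G : AbelianGroup) (x y z : G) :
  minus (plus x (plus y z)) y = plus x z.
Proof.
  rewrite (plus_comm y z), plus_assoc. unfold minus.
  rewrite <- (plus_assoc (plus x z)), (plus_opp_r y). apply plus_zero_r.
Qed.

Lemma norm_minus_sym (V : CompleteNormedModule R_AbsRing) (x y : V) :
  norm (minus x y) = norm (minus y x).
Proof. rewrite <- (opp_minus y x). apply (@norm_opp R_AbsRing V). Qed.

Lemma norm_minus_tri (V : CompleteNormedModule R_AbsRing) (x y z : V) :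
  norm (minus x z) <= norm (minus x y) + norm (minus y z).
Proof. rewrite (minus_trans y x z). apply (@norm_triangle R_AbsRing V). Qed.

Lemma RInt_norm_le (V : CompleteNormedModule R_AbsRing) (f : R -> V) (g : R -> R) a b :
  a <= b -> ex_RInt f a b -> ex_RInt g a b -> (forall x, a <= x <= b -> norm (f x) <= g x) ->
  norm (RInt f a b) <= RInt g a b.
Proof.
  intros Hab Hf Hg H. apply (norm_RInt_le f g a b); auto.
  - apply (@RInt_correct V), Hf.
  - apply (@RInt_correct R_CompleteNormedModule), Hg.
Qed.

Lemma is_half_norm_le (V : CompleteNormedModule R_AbsRing) (f : R -> V) l (B : R -> R) b :
  is_half V f l -> is_half R_CompleteNormedModule B b ->
  (forall x, 0 < x -> norm (f x) <= B x) -> norm l <= b.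
Proof.
  intros Hf HB H. apply Rnot_lt_le. intros HC.
  destruct (is_half_elim_beyond V f l 1 1 (norm l - b) Hf) as [a' [b' [Ha' [Hb' [E T]]]]]; [lra|lra|].
  assert (EB : ex_RInt B a' b') by (apply (is_half_ex_RInt R_CompleteNormedModule B b); auto; lra).
  assert (N1 : norm (RInt f a' b') <= b).
  { eapply Rle_trans; [apply RInt_norm_le with (g := B); auto; [lra|intros x Hx; apply H; lra]|].
    apply is_half_R_tail; auto; [|lra].
    intros x Hx. eapply Rle_trans; [apply (@norm_ge_0 R_AbsRing V)|apply H, Hx]. }
  assert (T2 := norm_triangle (RInt f a' b') (minus l (RInt f a' b'))).
  rewrite (plus_minus_cancel V), norm_minus_sym in T2. lra.
Qed.

(** Cauchy's criterion: two integrals of [f] over large intervals differ from the one over a common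
    larger interval by at most the mass of [B] near the two ends. *)
Lemma is_half_dominated (V : CompleteNormedModule R_AbsRing) (f : R -> V) (B : R -> R) b :
  (forall x y, 0 < x <= y -> ex_RInt f x y) ->
  is_half R_CompleteNormedModule B b ->
  (forall x, 0 < x -> norm (f x) <= B x) ->
  exists l, is_half V f l.
Proof.
  intros Hex HB H.
  assert (HB0 : forall x, 0 < x -> 0 <= B x)
    by (intros x Hx; eapply Rle_trans; [apply (@norm_ge_0 R_AbsRing V)|apply H, Hx]).
  assert (EB : forall x y, 0 < x <= y -> ex_RInt B x y)
    by (intros; apply (is_half_ex_RInt R_CompleteNormedModule B b); auto).
  destruct (proj1 (@filterlim_locally_cauchy (R * R) V
      (filter_prod (at_right 0) (Rbar_locally p_infty)) _ (fun ab => RInt f (fst ab) (snd ab)))) as [l Hl].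
  - intros eps.
    destruct (is_half_elim R_CompleteNormedModule B b HB (eps / 2)) as [d [A [Hd HH]]];
      [assert (T := cond_pos eps); lra|].
    exists (fun ab => 0 < fst ab < d /\ Rmax A d < snd ab). split.
    { apply Filter_prod with (fun a => 0 < a < d) (fun b => Rmax A d < b).
      - apply at_right_0_intro with d; auto.
      - exists (Rmax A d); auto.
      - intros; simpl; auto. }
    intros [a1 b1] [a2 b2] [Ha1 Hb1] [Ha2 Hb2]. cbn [fst snd] in *.
    assert (M1 := Rmax_l A d). assert (M2 := Rmax_r A d).
    apply (@norm_compat1 R_AbsRing V).
    assert (N : forall a b c e, 0 < a <= c -> c < d -> Rmax A d < e <= b ->
       norm (minus (RInt f a b) (RInt f c e)) <= RInt B a b - RInt B c e).
    { intros a b' c e Hac Hcd Heb.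
      assert (F1 : RInt f a b' = plus (RInt f a c) (plus (RInt f c e) (RInt f e b'))).
      { rewrite (RInt_Chasles f c e b') by (apply Hex; lra).
        rewrite (RInt_Chasles f a c b') by (apply Hex; lra). reflexivity. }
      assert (B1 : RInt B a b' = RInt B a c + (RInt B c e + RInt B e b')).
      { assert (Q1 := RInt_Chasles B c e b' ltac:(apply EB; lra) ltac:(apply EB; lra)).
        assert (Q2 := RInt_Chasles B a c b' ltac:(apply EB; lra) ltac:(apply EB; lra)).
        rewrite <- Q2, <- Q1. reflexivity. }
      assert (E : minus (RInt f a b') (RInt f c e) = plus (RInt f a c) (RInt f e b')).
      { rewrite F1. apply (minus_plus3_mid V). }
      rewrite E. eapply Rle_trans; [apply (@norm_triangle R_AbsRing V)|].
      assert (P1 : norm (RInt f a c) <= RInt B a c).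
      { apply RInt_norm_le; [lra|apply Hex; lra|apply EB; lra|intros x Hx; apply H; lra]. }
      assert (P2 : norm (RInt f e b') <= RInt B e b').
      { apply RInt_norm_le; [lra|apply Hex; lra|apply EB; lra|intros x Hx; apply H; lra]. }
      lra. }
    set (a0 := Rmin a1 a2). set (b0 := Rmax b1 b2).
    assert (Ha0 : 0 < a0 /\ a0 <= a1 /\ a0 <= a2 /\ a0 < d).
    { unfold a0, Rmin. destruct (Rle_dec a1 a2); lra. }
    assert (Hb0 : b1 <= b0 /\ b2 <= b0).
    { unfold b0, Rmax. destruct (Rle_dec b1 b2); lra. }
    assert (bnd : forall c e, a0 <= c < d -> Rmax A d < e <= b0 ->
       RInt B a0 b0 - RInt B c e < eps / 2).
    { intros c e Hc He. destruct (HH c e) as [_ T]; try lra.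
      assert (T' : Rabs (RInt B c e - b) < eps / 2) by exact T. apply Rabs_def2 in T'.
      assert (U := is_half_R_tail B b HB HB0 a0 b0 ltac:(lra)). lra. }
    assert (N1 := N a0 b0 a1 b1 ltac:(lra) ltac:(lra) ltac:(lra)).
    assert (N2 := N a0 b0 a2 b2 ltac:(lra) ltac:(lra) ltac:(lra)).
    assert (X1 := bnd a1 b1 ltac:(lra) ltac:(lra)).
    assert (X2 := bnd a2 b2 ltac:(lra) ltac:(lra)).
    eapply Rle_lt_trans; [apply (norm_minus_tri V _ (RInt f a0 b0))|].
    rewrite (norm_minus_sym V (RInt f a2 b2)). lra.
  - exists l. apply is_half_intro; [exact Hex|].
    intros eps Heps.
    assert (L : locally l (fun y => norm (minus y l) < eps)).
    { apply (@locally_le_locally_norm R_AbsRing V). exists (mkposreal eps Heps). intros y Hy. exact Hy. }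
    destruct (Hl _ L) as [Q R HQ [A HR] HQR].
    destruct (at_right_0_elim _ HQ) as [d [Hd HQ']].
    exists d, A. split; [exact Hd|]. intros a b' Ha Hb Hab.
    apply (HQR a b' (HQ' a Ha) (HR b' Hb)).
Qed.

Lemma is_half_plus (V : CompleteNormedModule R_AbsRing) (f g : R -> V) l m :
  is_half V f l -> is_half V g m -> is_half V (fun t => plus (f t) (g t)) (plus l m).
Proof.
  exact (@is_RInt_gen_plus V (at_right 0) (Rbar_locally p_infty) _ _ f g l m).
Qed.

Lemma is_half_minus (V : CompleteNormedModule R_AbsRing) (f g : R -> V) l m :
  is_half V f l -> is_half V g m -> is_half V (fun t => minus (f t) (g t)) (minus l m).
Proof.
  exact (@is_RInt_gen_minus V (at_right 0) (Rbar_locally p_infty) _ _ f g l m).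
Qed.

Lemma is_Rhalf_scal c (f : R -> R) l : is_half R_CompleteNormedModule f l ->
  is_half R_CompleteNormedModule (fun t => c * f t) (c * l).
Proof.
  exact (@is_RInt_gen_scal R_NormedModule (at_right 0) (Rbar_locally p_infty) _ _ f c l).
Qed.

Lemma is_RInt_uniform_limit (V : CompleteNormedModule R_AbsRing) (f : R -> V) (fn : nat -> R -> V)
  a b (I : nat -> V) (e : nat -> R) :
  a <= b -> (forall n, is_RInt (fn n) a b (I n)) ->
  (forall n t, a <= t <= b -> norm (minus (f t) (fn n t)) <= e n) ->
  (forall eps, 0 < eps -> exists N, forall n, (N <= n)%nat -> e n < eps) ->
  exists L, filterlim I eventually (locally L) /\ is_RInt f a b L.
Proof.
  intros Hab HI Happ He.
  (* Convergence in the function space is uniform on the whole line, hence the truncation. *)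
  set (cut := fun (g : R -> V) t => if Rle_dec a t then (if Rle_dec t b then g t else zero) else zero).
  assert (cutE : forall g t, a <= t <= b -> cut g t = g t).
  { intros g t Ht. unfold cut. destruct (Rle_dec a t); [|lra]. destruct (Rle_dec t b); [auto|lra]. }
  destruct (filterlim_RInt (fun n => cut (fn n)) a b eventually _ (cut f) I) as [L [HL1 HL2]].
  - intros n. apply is_RInt_ext with (fn n); [|apply HI].
    rewrite Rmin_left, Rmax_right by lra. intros t Ht. symmetry; apply cutE; lra.
  - apply filterlim_locally. intros eps. destruct (He eps (cond_pos eps)) as [N HN].
    exists N. intros n Hn t. unfold cut.
    destruct (Rle_dec a t) as [H1|H1]; [destruct (Rle_dec t b) as [H2|H2]|]; try apply ball_center.
    apply (@norm_compat1 R_AbsRing V). rewrite norm_minus_sym.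
    eapply Rle_lt_trans; [apply Happ; lra|]. apply HN, Hn.
  - exists L. split; [exact HL1|]. apply is_RInt_ext with (2 := HL2).
    rewrite Rmin_left, Rmax_right by lra. intros t Ht. apply cutE; lra.
Qed.

(** Dominated convergence with a rate. The limit inherits local integrability, because the
    convergence is uniform wherever the weight [B] is bounded. *)
Lemma is_half_approx (V : CompleteNormedModule R_AbsRing) (f : R -> V) (fn : nat -> R -> V)
  (I : nat -> V) (e : nat -> R) (B : R -> R) b :
  (forall n, is_half V (fn n) (I n)) ->
  is_half R_CompleteNormedModule B b ->
  (forall n, 0 <= e n) -> rcvg e 0 ->
  (forall n x, 0 < x -> norm (minus (f x) (fn n x)) <= e n * B x) ->
  exists l, is_half V f l /\ forall n, norm (minus l (I n)) <= e n * b.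
Proof.
  intros Hfn HB He He0 Happ.
  assert (EB : forall x y, 0 < x <= y -> ex_RInt B x y)
    by (intros; apply (is_half_ex_RInt R_CompleteNormedModule B b); auto).
  assert (Efn : forall n x y, 0 < x <= y -> ex_RInt (fn n) x y)
    by (intros n x y Hxy; apply (is_half_ex_RInt V (fn n) (I n)); auto).
  assert (Hex : forall x y, 0 < x <= y -> ex_RInt f x y).
  { intros x y Hxy.
    destruct (@ex_RInt_ub R_NormedModule B x y (EB x y Hxy)) as [M HM].
    rewrite Rmin_left, Rmax_right in HM by lra.
    destruct (is_RInt_uniform_limit V f fn x y (fun n => RInt (fn n) x y) (fun n => M * e n)) as [L [_ HL]];
      [lra| | | |exists L; exact HL].
    - intros n. apply RInt_correct, Efn, Hxy.
    - intros n t Ht. eapply Rle_trans; [apply Happ; lra|]. rewrite (Rmult_comm M).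
      apply Rmult_le_compat_l; [apply He|]. eapply Rle_trans; [apply Rle_abs|apply HM, Ht].
    - intros eps Heps. destruct (small_factor M eps Heps) as [d [Hd Sd]]. destruct (He0 d Hd) as [N HN].
      exists N. intros n Hn. specialize (HN n Hn). specialize (He n).
      rewrite Rminus_0_r, Rabs_pos_eq in HN by apply He. apply Sd. lra. }
  assert (D : forall n, exists l, is_half V (fun x => minus (f x) (fn n x)) l /\ norm l <= e n * b).
  { intros n.
    assert (HB' : is_half R_CompleteNormedModule (fun x => e n * B x) (e n * b)).
    { apply is_Rhalf_scal, HB. }
    destruct (is_half_dominated V (fun x => minus (f x) (fn n x)) (fun x => e n * B x) (e n * b)) as [l Hl].
    - intros x y Hxy. apply (@ex_RInt_minus V); auto.
    - exact HB'.
    - apply Happ.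
    - exists l. split; [exact Hl|].
      apply (is_half_norm_le V _ l (fun x => e n * B x) (e n * b) Hl HB'). apply Happ. }
  destruct (D O) as [l0 [Hl0 _]].
  assert (F0 : is_half V f (plus l0 (I O))).
  { apply (@is_RInt_gen_ext V) with (fun x => plus (minus (f x) (fn O x)) (fn O x)); try apply _.
    - apply filter_forall. intros [a b'] x _. apply (minus_plus_cancel V).
    - apply is_half_plus; [exact Hl0|apply Hfn]. }
  exists (plus l0 (I O)). split; [exact F0|]. intros n.
  apply (is_half_norm_le V (fun x => minus (f x) (fn n x)) _ (fun x => e n * B x)).
  - apply is_half_minus; [exact F0|apply Hfn].
  - apply is_Rhalf_scal, HB.
  - apply Happ.
Qed.

(** * Integrals of complex functions *)

Notation is_Chalf := (is_half C_R_CompleteNormedModule).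
Notation is_Rhalf := (is_half R_CompleteNormedModule).

Lemma is_CInt_Re f a b l : is_CInt f a b l -> is_RInt (fun t => Re (f t)) a b (Re l).
Proof. apply (@is_RInt_fct_extend_fst R_NormedModule R_NormedModule). Qed.

Lemma is_CInt_Im f a b l : is_CInt f a b l -> is_RInt (fun t => Im (f t)) a b (Im l).
Proof. apply (@is_RInt_fct_extend_snd R_NormedModule R_NormedModule). Qed.

Lemma is_CInt_pair f a b l : is_RInt (fun t => Re (f t)) a b (Re l) ->
  is_RInt (fun t => Im (f t)) a b (Im l) -> is_CInt f a b l.
Proof.
  destruct l as [u v]. apply (@is_RInt_fct_extend_pair R_NormedModule R_NormedModule).
Qed.

Lemma is_CInt_scal c f a b l : is_CInt f a b l -> is_CInt (fun t => (c * f t)%C) a b (c * l)%C.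
Proof.
  intros H. assert (H1 := is_CInt_Re _ _ _ _ H). assert (H2 := is_CInt_Im _ _ _ _ H).
  apply is_CInt_pair; unfold Re, Im, Cmult in *; simpl in *.
  - apply (@is_RInt_minus R_NormedModule); apply (@is_RInt_scal R_NormedModule); assumption.
  - apply (@is_RInt_plus R_NormedModule); apply (@is_RInt_scal R_NormedModule); assumption.
Qed.

Lemma is_CInt_plus f g a b l m : is_CInt f a b l -> is_CInt g a b m ->
  is_CInt (fun t => (f t + g t)%C) a b (l + m)%C.
Proof. apply (@is_RInt_plus C_R_NormedModule). Qed.

Lemma is_Chalf_scal c f l : is_Chalf f l -> is_Chalf (fun t => (c * f t)%C) (c * l)%C.
Proof.
  intros H P HP.
  assert (HP' : locally (T := C_R_NormedModule) l (fun y => P (c * y)%C)).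
  { apply (@locally_norm_le_locally R_AbsRing C_R_NormedModule) in HP.
    destruct HP as [eps HP]. destruct (small_factor (Cmod c) eps (cond_pos eps)) as [e [He Se]].
    apply (@locally_le_locally_norm R_AbsRing C_R_NormedModule).
    exists (mkposreal _ He). intros y Hy. apply HP. unfold ball_norm in *. rewrite norm_C_R in *.
    change (Cmod (c * y - c * l)%C < eps). change (Cmod (y - l)%C < e) in Hy.
    replace (c * y - c * l)%C with (c * (y - l))%C by ring. rewrite Cmod_mult.
    apply Se. split; [apply Cmod_ge_0|exact Hy]. }
  assert (H' := H _ HP'). unfold filtermapi in *. revert H'.
  apply filter_imp. intros [a b] [y [Hy1 Hy2]].
  exists (c * y)%C. split; [apply is_CInt_scal, Hy1|exact Hy2].
Qed.

Lemma is_Chalf_plus f g l m : is_Chalf f l -> is_Chalf g m ->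
  is_Chalf (fun t => (f t + g t)%C) (l + m)%C.
Proof. apply (is_half_plus C_R_CompleteNormedModule). Qed.

Lemma is_half_ext (V : CompleteNormedModule R_AbsRing) (f g : R -> V) l :
  (forall x, 0 < x -> f x = g x) -> is_half V f l -> is_half V g l.
Proof.
  intros E. apply (@is_RInt_gen_ext V); try apply _.
  apply Filter_prod with (fun a => 0 < a < 1) (fun b => 1 < b).
  - apply at_right_0_intro with 1; [lra|auto].
  - exists 1. auto.
  - intros a b Ha Hb x. cbn [fst snd]. rewrite Rmin_left by lra. intros Hx. apply E. lra.
Qed.

Lemma is_half_unique (V : CompleteNormedModule R_AbsRing) (f : R -> V) l l' :
  is_half V f l -> is_half V f l' -> l = l'.
Proof.
  intros H H'. rewrite <- (is_RInt_gen_unique _ _ H). apply (is_RInt_gen_unique _ _ H').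
Qed.

Lemma is_Chalf_unique f l l' : is_Chalf f l -> is_Chalf f l' -> l = l'.
Proof. apply (is_half_unique C_R_CompleteNormedModule). Qed.

Lemma is_Chalf_norm_le f l B b : is_Chalf f l -> is_Rhalf B b ->
  (forall x, 0 < x -> Cmod (f x) <= B x) -> Cmod l <= b.
Proof.
  intros H1 H2 H3. rewrite <- norm_C_R.
  apply (is_half_norm_le C_R_CompleteNormedModule f l B b H1 H2).
  intros x Hx. change (@norm R_AbsRing C_R_NormedModule (f x) <= B x). rewrite norm_C_R. auto.
Qed.

Lemma is_Chalf_dominated f B b :
  (forall x, 0 < x -> Ccont f x) -> is_Rhalf B b ->
  (forall x, 0 < x -> Cmod (f x) <= B x) -> exists l, is_Chalf f l.
Proof.
  intros H1 H2 H3. apply (is_half_dominated C_R_CompleteNormedModule f B b); auto.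
  - intros x y Hxy. apply (@ex_RInt_continuous C_R_CompleteNormedModule).
    rewrite Rmin_left by lra. intros z Hz. apply Ccont_continuous, H1. lra.
  - intros x Hx. change (@norm R_AbsRing C_R_NormedModule (f x) <= B x). rewrite norm_C_R. auto.
Qed.

Lemma is_Rhalf_dominated f B b :
  (forall x, 0 < x -> continuous f x) -> is_Rhalf B b ->
  (forall x, 0 < x -> Rabs (f x) <= B x) -> exists l, is_Rhalf f l.
Proof.
  intros H1 H2 H3. apply (is_half_dominated R_CompleteNormedModule f B b); auto.
  intros x y Hxy. apply (@ex_RInt_continuous R_CompleteNormedModule).
  rewrite Rmin_left by lra. intros z Hz. apply H1. lra.
Qed.

Lemma is_Rhalf_plus f g l m : is_Rhalf f l -> is_Rhalf g m -> is_Rhalf (fun t => f t + g t) (l + m).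
Proof. apply (is_half_plus R_CompleteNormedModule). Qed.

(** * Improper integrals by primitives *)

Definition lim_at_0 (F : R -> C) (l : C) : Prop :=
  forall eps, 0 < eps -> exists d, 0 < d /\ forall x, 0 < x < d -> Cmod (F x - l)%C < eps.

Definition lim_at_infty (F : R -> C) (l : C) : Prop :=
  forall eps, 0 < eps -> exists A, forall x, A < x -> Cmod (F x - l)%C < eps.

Lemma Ccont_ex_CInt f a b : (forall x, 0 < x -> Ccont f x) -> 0 < a <= b -> ex_CInt f a b.
Proof.
  intros H Hab. apply (@ex_RInt_continuous C_R_CompleteNormedModule).
  rewrite Rmin_left by lra. intros z Hz. apply Ccont_continuous, H. lra.
Qed.

Lemma is_Chalf_derive F f l0 l1 :
  (forall x, 0 < x -> Cder F x (f x)) -> (forall x, 0 < x -> Ccont f x) ->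
  lim_at_0 F l0 -> lim_at_infty F l1 -> is_Chalf f (l1 - l0)%C.
Proof.
  intros HF Hf H0 H1. apply is_half_intro.
  - intros a b Hab. apply Ccont_ex_CInt; auto.
  - intros eps Heps. destruct (H0 (eps/2)) as [d [Hd H0']]; [lra|].
    destruct (H1 (eps/2)) as [A H1']; [lra|].
    exists d, A. split; [exact Hd|]. intros a b Ha Hb Hab.
    assert (E : is_CInt f a b (F b - F a)%C).
    { apply CInt_derive; auto; intros; [apply HF|apply Hf]; lra. }
    rewrite (@is_RInt_unique C_R_CompleteNormedModule _ _ _ _ E).
    change (@norm R_AbsRing C_R_NormedModule ((F b - F a) - (l1 - l0))%C < eps). rewrite norm_C_R.
    replace (F b - F a - (l1 - l0))%C with ((F b - l1) - (F a - l0))%C by ring.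
    eapply Rle_lt_trans; [apply Cmod_sub_le|].
    specialize (H0' a Ha). specialize (H1' b Hb). lra.
Qed.

(** The cutoff at [c] expresses a proper integral over [0, c] as one over the half-line, where it can
    be compared with the Gamma integral. *)
Lemma is_Chalf_cut_derive F f l0 c : 0 < c ->
  (forall x, 0 < x -> Cder F x (f x)) -> (forall x, 0 < x -> Ccont f x) ->
  lim_at_0 F l0 -> is_Chalf (fun x => if Rle_dec x c then f x else RtoC 0) (F c - l0)%C.
Proof.
  intros Hc HF Hf H0. set (g := fun x => if Rle_dec x c then f x else RtoC 0).
  change (is_Chalf g (F c - l0)%C).
  assert (G1 : forall a b l, 0 < a <= b -> b <= c -> is_CInt f a b l -> is_CInt g a b l).
  { intros a b l Hab Hbc. apply (@is_RInt_ext C_R_CompleteNormedModule).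
    rewrite Rmin_left, Rmax_right by lra. intros x Hx. unfold g. destruct (Rle_dec x c); [auto|lra]. }
  assert (G2 : forall a b, c <= a <= b -> is_CInt g a b (RtoC 0)).
  { intros a b Hab. apply (@is_RInt_ext C_R_CompleteNormedModule) with (fun _ => RtoC 0).
    - rewrite Rmin_left, Rmax_right by lra. intros x Hx. unfold g. destruct (Rle_dec x c); [lra|auto].
    - assert (T := @is_RInt_const C_R_CompleteNormedModule a b (RtoC 0)).
      assert (Z : scal (V := C_R_CompleteNormedModule) (b - a) (RtoC 0) = RtoC 0)
        by (apply (@scal_zero_r R_AbsRing C_R_CompleteNormedModule)).
      exact (eq_ind _ (fun z => is_CInt (fun _ => RtoC 0) a b z) T _ Z). }
  apply is_half_intro.
  - intros a b Hab.
    destruct (Rle_dec b c) as [H|H].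
    + destruct (Ccont_ex_CInt f a b Hf Hab) as [l Hl]. exists l. apply G1; auto; lra.
    + destruct (Rle_dec c a) as [H'|H'].
      * exists (RtoC 0). apply G2. lra.
      * destruct (Ccont_ex_CInt f a c Hf) as [l Hl]; [lra|].
        apply (@ex_RInt_Chasles C_R_CompleteNormedModule) with c; [exists l; apply G1; auto; lra|].
        exists (RtoC 0). apply G2. lra.
  - intros eps Heps. destruct (H0 eps Heps) as [d [Hd H0']].
    exists (Rmin d c), c. split; [apply Rmin_pos; lra|]. intros a b Ha Hb Hab.
    assert (M1 := Rmin_l d c). assert (M2 := Rmin_r d c).
    assert (E : is_CInt g a b (plus (G := C_R_CompleteNormedModule) (F c - F a)%C (RtoC 0))).
    { apply (@is_RInt_Chasles C_R_CompleteNormedModule) with c; [|apply G2; lra].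
      apply G1; [lra|lra|]. apply CInt_derive; [lra| |]; intros; [apply HF|apply Hf]; lra. }
    rewrite (@is_RInt_unique C_R_CompleteNormedModule _ _ _ _ E).
    change (@norm R_AbsRing C_R_NormedModule ((F c - F a + RtoC 0) - (F c - l0))%C < eps). rewrite norm_C_R.
    replace (F c - F a + 0 - (F c - l0))%C with (- (F a - l0))%C by ring.
    rewrite Cmod_opp. apply H0'. lra.
Qed.

Lemma is_Chalf_Re f l : is_Chalf f l -> is_Rhalf (fun x => Re (f x)) (Re l).
Proof.
  intros H. apply is_half_intro.
  - intros a b Hab. destruct (is_half_ex_RInt C_R_CompleteNormedModule f l a b H Hab) as [y Hy].
    exists (Re y). apply is_CInt_Re, Hy.
  - intros eps Heps. destruct (is_half_elim C_R_CompleteNormedModule f l H eps Heps) as [d [A [Hd HH]]].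
    exists d, A. split; [exact Hd|]. intros a b Ha Hb Hab. destruct (HH a b Ha Hb Hab) as [[y Hy] T].
    rewrite (is_RInt_unique _ _ _ _ Hy) in T.
    change (@norm R_AbsRing C_R_NormedModule (y - l)%C < eps) in T. rewrite norm_C_R in T.
    rewrite (is_RInt_unique _ _ _ _ (is_CInt_Re _ _ _ _ Hy)).
    eapply Rle_lt_trans; [|exact T]. change (Rabs (Re (y - l)%C) <= Cmod (y - l)%C). apply re_le_Cmod.
Qed.

Lemma lim_at_0_scal F l c : lim_at_0 F l -> lim_at_0 (fun x => (c * F x)%C) (c * l)%C.
Proof.
  intros H eps Heps. destruct (small_factor (Cmod c) eps Heps) as [e [He Se]].
  destruct (H e He) as [d [Hd HH]].
  exists d. split; [exact Hd|]. intros x Hx.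
  replace (c * F x - c * l)%C with (c * (F x - l))%C by ring. rewrite Cmod_mult.
  apply Se. split; [apply Cmod_ge_0|auto].
Qed.

(** * The integrands [x^r exp (- q x)] *)

Lemma exp_ln_small t eps : 0 < t -> 0 < eps -> forall x, 0 < x < exp (ln eps / t) ->
  exp (t * ln x) < eps.
Proof.
  intros Ht He x Hx. rewrite <- (exp_ln eps He) at 1. apply exp_increasing.
  assert (ln x < ln eps / t). { rewrite <- (ln_exp (ln eps / t)). apply ln_increasing; lra. }
  apply Rmult_lt_compat_l with (r := t) in H; [|exact Ht].
  replace (t * (ln eps / t)) with (ln eps) in H by (field; lra). exact H.
Qed.

Lemma ln_le_lin r x : 0 < r -> 0 < x -> ln x <= r * x - ln r.
Proof.
  intros Hr Hx. assert (P : 0 < r * x) by (apply Rmult_lt_0_compat; auto).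
  assert (T := exp_ineq1_le (ln (r * x))). rewrite exp_ln in T by exact P.
  rewrite ln_mult in T by auto. lra.
Qed.

Lemma power_exp_le t q : 0 < q -> 0 <= t -> exists K, forall x, 0 < x ->
  exp (t * ln x - q * x) <= K * exp (- (q / 2) * x).
Proof.
  intros Hq Ht. destruct Ht as [Ht| <-].
  - exists (exp (- (t * ln (q / (2 * t))))). intros x Hx.
    rewrite <- exp_plus. apply exp_le_compat.
    assert (P : 0 < q / (2 * t)) by (apply Rdiv_lt_0_compat; lra).
    assert (T := ln_le_lin _ x P Hx).
    apply Rmult_le_compat_l with (r := t) in T; [|lra].
    replace (t * (q / (2 * t) * x - ln (q / (2 * t)))) with (q / 2 * x - t * ln (q / (2 * t))) in T
      by (field; lra). lra.
  - exists 1. intros x Hx. rewrite Rmult_1_l. apply exp_le_compat. nra.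
Qed.

Lemma exp_neg_small q eps : 0 < q -> 0 < eps -> exists A, forall x, A < x -> exp (- q * x) < eps.
Proof.
  intros Hq He. exists (- ln eps / q). intros x Hx.
  rewrite <- (exp_ln eps He) at 1. apply exp_increasing.
  apply Rmult_lt_compat_l with (r := q) in Hx; [|exact Hq].
  replace (q * (- ln eps / q)) with (- ln eps) in Hx by (field; lra). lra.
Qed.

(** The substitution [u = x^t] turns [x^(t-1) exp (- k x^t) dx] into [exp (- k u) du / t]; this weight
    has an explicit primitive and both the singularity at [0] and the decay that are needed to
    dominate [x^r exp (- q x)]. *)
Lemma ex_Rhalf_subst t k : 0 < t -> 0 < k ->
  exists l, is_Rhalf (fun x => exp ((t - 1) * ln x - k * exp (t * ln x))) l.
Proof.
  intros Ht Hk.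
  set (F := fun x => (RtoC (- / (k * t)) * exp (- k * exp (t * ln x)))%C).
  exists (Re (RtoC 0 - RtoC (- / (k * t)))%C).
  apply (is_half_ext R_CompleteNormedModule) with
    (fun x => Re (exp ((t - 1) * ln x - k * exp (t * ln x)))); [reflexivity|].
  apply is_Chalf_Re.
  apply is_Chalf_derive with F.
  - intros x Hx. unfold F.
    assert (D : is_derive (fun x => exp (- k * exp (t * ln x))) x
       (- k * (t * / x * exp (t * ln x)) * exp (- k * exp (t * ln x)))).
    { auto_derive; [exact Hx|]. ring. }
    replace (RtoC (exp ((t - 1) * ln x - k * exp (t * ln x)))) with
      (RtoC (- / (k * t)) * RtoC (- k * (t * / x * exp (t * ln x)) * exp (- k * exp (t * ln x))))%C.
    + apply Cder_scal, Cder_RtoC, D.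
    + rewrite <- RtoC_mult. f_equal.
      replace ((t - 1) * ln x - k * exp (t * ln x))
        with (t * ln x + - ln x + - k * exp (t * ln x)) by ring.
      rewrite !exp_plus, exp_Ropp, exp_ln by exact Hx. field. repeat split; lra.
  - intros x Hx. apply Ccont_RtoC. apply (@ex_derive_continuous R_AbsRing R_NormedModule).
    auto_derive. exact (conj Hx (conj Hx I)).
  - replace (RtoC (- / (k * t))) with (RtoC (- / (k * t)) * RtoC 1)%C by ring.
    apply lim_at_0_scal. intros eps He.
    assert (Pe : 0 < eps / k) by (apply Rdiv_lt_0_compat; auto).
    exists (exp (ln (eps / k) / t)). split; [apply exp_pos|]. intros x Hx.
    assert (T := exp_ln_small t (eps / k) Ht Pe x Hx).
    rewrite <- RtoC_minus, Cmod_R.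
    assert (T1 := exp_ineq1_le (- k * exp (t * ln x))).
    assert (T2 := exp_pos (t * ln x)).
    assert (T3 : exp (- k * exp (t * ln x)) <= 1).
    { rewrite <- exp_0. apply exp_le_compat. nra. }
    rewrite Rabs_left1 by lra.
    apply Rmult_lt_compat_l with (r := k) in T; [|exact Hk].
    replace (k * (eps / k)) with eps in T by (field; lra). lra.
  - intros eps He. unfold F.
    assert (Pkt : 0 < k * t) by (apply Rmult_lt_0_compat; auto).
    destruct (exp_neg_small k (eps * (k * t)) Hk) as [A HA]; [apply Rmult_lt_0_compat; auto|].
    exists (exp (ln (Rmax A 1) / t)). intros x Hx.
    assert (M1 := Rmax_l A 1). assert (M2 := Rmax_r A 1).
    assert (Hx0 : 0 < x) by (eapply Rlt_trans; [apply exp_pos|exact Hx]).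
    assert (A < exp (t * ln x)).
    { eapply Rle_lt_trans; [exact M1|]. rewrite <- (exp_ln (Rmax A 1)) by lra. apply exp_increasing.
      assert (ln (Rmax A 1) / t < ln x).
      { rewrite <- (ln_exp (ln (Rmax A 1) / t)). apply ln_increasing; [apply exp_pos|auto]. }
      apply Rmult_lt_compat_l with (r := t) in H; [|exact Ht].
      replace (t * (ln (Rmax A 1) / t)) with (ln (Rmax A 1)) in H by (field; lra). exact H. }
    specialize (HA _ H).
    rewrite <- RtoC_mult, <- RtoC_minus, Cmod_R, Rminus_0_r, Rabs_mult, Rabs_Ropp.
    rewrite (Rabs_pos_eq (exp _)) by (left; apply exp_pos).
    rewrite Rabs_pos_eq by (left; apply Rinv_0_lt_compat; auto).
    apply Rmult_lt_reg_l with (k * t); [auto|].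
    rewrite <- Rmult_assoc, Rinv_r, Rmult_1_l by lra. lra.
Qed.

Lemma continuous_gamma_kernel r q x : 0 < x -> continuous (fun x => exp (r * ln x - q * x)) x.
Proof.
  intros Hx. apply (@ex_derive_continuous R_AbsRing R_NormedModule). auto_derive. exact Hx.
Qed.

(** For [r <= 0] one has [x^(r+1) <= 1 + x], which compares the integrand with
    [x^r exp (- q x^(r+1))]; for [r > 0] half of the exponential absorbs the power. *)
Lemma ex_Rhalf_gamma r q : -1 < r -> 0 < q -> exists l, is_Rhalf (fun x => exp (r * ln x - q * x)) l.
Proof.
  intros Hr Hq.
  assert (base : forall r q, -1 < r <= 0 -> 0 < q ->
     exists l, is_Rhalf (fun x => exp (r * ln x - q * x)) l).
  { clear. intros r q Hr Hq. destruct (ex_Rhalf_subst (r + 1) q) as [b Hb]; [lra|lra|].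
    apply is_Rhalf_dominated with (fun x => exp q * exp ((r + 1 - 1) * ln x - q * exp ((r + 1) * ln x))) (exp q * b).
    - apply continuous_gamma_kernel.
    - apply is_Rhalf_scal, Hb.
    - intros x Hx. rewrite Rabs_pos_eq by (left; apply exp_pos). rewrite <- exp_plus.
      apply exp_le_compat.
      assert (exp ((r + 1) * ln x) <= 1 + x).
      { destruct (Rle_dec x 1) as [H|H].
        - assert (ln x <= 0) by (rewrite <- ln_1; apply ln_le; lra).
          assert (exp ((r + 1) * ln x) <= exp 0) by (apply exp_le_compat; nra).
          rewrite exp_0 in *. lra.
        - assert (0 <= ln x) by (rewrite <- ln_1; apply ln_le; lra).
          assert (exp ((r + 1) * ln x) <= exp (ln x)) by (apply exp_le_compat; nra).
          rewrite exp_ln in * by lra. lra. }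
      nra. }
  destruct (Rle_dec r 0) as [H|H]; [apply base; lra|].
  destruct (power_exp_le r q Hq ltac:(lra)) as [K HK].
  destruct (base 0 (q / 2)) as [b Hb]; [lra|lra|].
  apply is_Rhalf_dominated with (fun x => K * exp (0 * ln x - q / 2 * x)) (K * b).
  - apply continuous_gamma_kernel.
  - apply is_Rhalf_scal, Hb.
  - intros x Hx. rewrite Rabs_pos_eq by (left; apply exp_pos).
    replace (0 * ln x - q / 2 * x) with (- (q / 2) * x) by ring. apply HK, Hx.
Qed.

(** * The Gamma integral with complex scale *)

Definition gamma_kernel (s p : C) (x : R) : C := Cexp (s * ln x - p * x)%C.

Lemma Cmod_gamma_kernel s p x : Cmod (gamma_kernel s p x) = exp (Re s * ln x - Re p * x).
Proof.
  unfold gamma_kernel. rewrite Cmod_Cexp. f_equal. unfold Re; simpl. ring.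
Qed.

Lemma Ccont_gamma_kernel s p x : 0 < x -> Ccont (gamma_kernel s p) x.
Proof.
  intros Hx. apply Ccont_exp.
  apply Ccont_ext with (fun x => (s * ln x + (- p) * x)%C); [intros; ring|].
  apply Ccont_plus; apply Ccont_mult; try apply Ccont_const; [apply Ccont_ln, Hx|apply Ccont_id].
Qed.

Lemma gamma_kernel_split s p x : gamma_kernel s p x = (Cexp (s * ln x) * Cexp (- (p * x)))%C.
Proof. unfold gamma_kernel. rewrite <- Cexp_plus. f_equal. Qed.

Lemma gamma_kernel_S s p x : 0 < x -> gamma_kernel (s + 1) p x = (x * gamma_kernel s p x)%C.
Proof.
  intros Hx. unfold gamma_kernel. rewrite <- (exp_ln x Hx) at 3. rewrite <- Cexp_RtoC, <- Cexp_plus.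
  f_equal. ring.
Qed.

Definition gamma_int (s p : C) : C :=
  @RInt_gen C_R_CompleteNormedModule (gamma_kernel s p) (at_right 0) (Rbar_locally p_infty).

Lemma gamma_int_correct s p : -1 < Re s -> 0 < Re p -> is_Chalf (gamma_kernel s p) (gamma_int s p).
Proof.
  intros Hs Hp. destruct (ex_Rhalf_gamma (Re s) (Re p) Hs Hp) as [b Hb].
  destruct (is_Chalf_dominated (gamma_kernel s p) (fun x => exp (Re s * ln x - Re p * x)) b) as [l Hl].
  - apply Ccont_gamma_kernel.
  - exact Hb.
  - intros x Hx. rewrite Cmod_gamma_kernel. lra.
  - unfold gamma_int. apply (@RInt_gen_correct C_R_CompleteNormedModule (at_right 0) (Rbar_locally p_infty));
      [apply Proper_StrongProper, _|apply Proper_StrongProper, _|]. exists l. exact Hl.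
Qed.

Lemma Cder_gamma_kernel s p x : 0 < x ->
  Cder (gamma_kernel s p) x ((s * RtoC (/ x) - p) * gamma_kernel s p x)%C.
Proof.
  intros Hx. apply Cder_exp.
  apply Cder_ext with (fun x => (s * ln x + (- p) * x)%C); [intros; ring|].
  replace (s * RtoC (/ x) - p)%C with (s * RtoC (/ x) + (- p) * RtoC 1)%C by ring.
  apply Cder_plus; apply Cder_scal, Cder_RtoC; [apply is_derive_ln, Hx|].
  exact (@is_derive_id R_AbsRing x).
Qed.

Lemma gamma_int_by_parts s p : -1 < Re s -> 0 < Re p ->
  (p * gamma_int (s + 1) p)%C = ((s + 1) * gamma_int s p)%C.
Proof.
  intros Hs Hp. assert (Hs1 : Re (s + 1)%C = Re s + 1) by reflexivity.
  assert (H : is_Chalf (fun x => ((s + 1) * gamma_kernel s p x + (- p) * gamma_kernel (s + 1) p x)%C)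
             (RtoC 0 - RtoC 0)%C).
  { apply is_Chalf_derive with (gamma_kernel (s + 1) p).
    - intros x Hx.
      replace ((s + 1) * gamma_kernel s p x + - p * gamma_kernel (s + 1) p x)%C
        with (((s + 1) * RtoC (/ x) - p) * gamma_kernel (s + 1) p x)%C.
      + apply Cder_gamma_kernel, Hx.
      + rewrite (gamma_kernel_S s p x Hx), RtoC_inv by lra. field. intros E. apply RtoC_inj in E. lra.
    - intros x Hx. apply Ccont_plus; apply Ccont_mult; try apply Ccont_const; apply Ccont_gamma_kernel, Hx.
    - intros eps He. exists (exp (ln eps / (Re s + 1))). split; [apply exp_pos|]. intros x Hx.
      replace (gamma_kernel (s + 1) p x - 0)%C with (gamma_kernel (s + 1) p x) by ring.
      rewrite Cmod_gamma_kernel, Hs1.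
      eapply Rle_lt_trans; [|apply (exp_ln_small (Re s + 1) eps ltac:(lra) He x Hx)].
      apply exp_le_compat. nra.
    - intros eps He. destruct (power_exp_le (Re s + 1) (Re p) Hp ltac:(lra)) as [K HK].
      assert (K0 : 0 < K).
      { specialize (HK 1 ltac:(lra)). assert (T := exp_pos ((Re s + 1) * ln 1 - Re p * 1)).
        assert (T2 := exp_pos (- (Re p / 2) * 1)). nra. }
      destruct (exp_neg_small (Re p / 2) (eps / K)) as [A HA]; [lra|apply Rdiv_lt_0_compat; auto|].
      exists (Rmax A 0). intros x Hx. assert (M1 := Rmax_l A 0). assert (M2 := Rmax_r A 0).
      replace (gamma_kernel (s + 1) p x - 0)%C with (gamma_kernel (s + 1) p x) by ring.
      rewrite Cmod_gamma_kernel, Hs1. eapply Rle_lt_trans; [apply HK; lra|].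
      specialize (HA x ltac:(lra)). apply Rmult_lt_compat_l with (r := K) in HA; [|exact K0].
      replace (K * (eps / K)) with eps in HA by (field; lra). exact HA. }
  assert (H' := is_Chalf_plus _ _ _ _ (is_Chalf_scal (s + 1) _ _ (gamma_int_correct s p Hs Hp))
     (is_Chalf_scal (- p) _ _ (gamma_int_correct (s + 1) p ltac:(lra) Hp))).
  assert (E := is_Chalf_unique _ _ _ H H').
  replace (RtoC 0 - RtoC 0)%C with (RtoC 0) in E by ring.
  rewrite <- (Cplus_0_r (p * gamma_int (s + 1) p)%C), E. ring.
Qed.

Lemma Cder_of_quadratic (f : R -> C) (t : R) (l : C) d K : 0 < d ->
  (forall h, Rabs h < d -> Cmod (f (t + h)%R - f t - h * l)%C <= K * h ^ 2) -> Cder f t l.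
Proof.
  intros Hd H.
  assert (R1 : forall (u : R -> R) m, (forall h, Rabs h < d -> Rabs (u (t + h) - u t - h * m) <= K * h ^ 2) ->
     is_derive u t m).
  { clear H. intros u m H. apply is_derive_Reals. intros eps He.
    assert (Pd : 0 < Rmin d (eps / (Rabs K + 1))).
    { assert (T := Rabs_pos K). apply Rmin_pos; [exact Hd|apply Rdiv_lt_0_compat; lra]. }
    exists (mkposreal _ Pd). intros h Hh0 Hh. simpl in Hh.
    assert (M1 := Rmin_l d (eps / (Rabs K + 1))). assert (M2 := Rmin_r d (eps / (Rabs K + 1))).
    specialize (H h ltac:(lra)).
    replace ((u (t + h) - u t) / h - m) with ((u (t + h) - u t - h * m) / h) by (field; auto).
    unfold Rdiv. rewrite Rabs_mult, Rabs_inv.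
    assert (Ph : 0 < Rabs h) by (apply Rabs_pos_lt; auto).
    apply Rmult_lt_reg_r with (Rabs h); [exact Ph|].
    rewrite Rmult_assoc, Rinv_l, Rmult_1_r by lra.
    eapply Rle_lt_trans; [exact H|]. rewrite <- (pow2_abs h).
    assert (TK := Rle_abs K). assert (TK0 := Rabs_pos K).
    assert ((Rabs K + 1) * Rabs h < eps).
    { apply Rlt_le_trans with ((Rabs K + 1) * (eps / (Rabs K + 1))); [apply Rmult_lt_compat_l; lra|].
      right; field; lra. }
    simpl. nra. }
  assert (Pre : forall z w : C, Re z - Re w = Re (z - w)%C) by reflexivity.
  assert (Pim : forall z w : C, Im z - Im w = Im (z - w)%C) by reflexivity.
  split; apply R1; intros h Hh; (eapply Rle_trans; [|apply (H h Hh)]).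
  - rewrite <- (re_scal_l h l), !Pre. apply re_le_Cmod.
  - rewrite <- (im_scal_l h l), !Pim. apply im_le_Cmod.
Qed.

(** The derivative in [p] is taken under the integral sign; the Taylor remainder of the exponential is
    at most [|h|^2 x^2 exp (- Re p x / 2)] times the power. *)
Lemma gamma_int_quadratic s p : -1 < Re s -> 0 < Re p -> exists K, 0 <= K /\ forall h,
  Cmod h <= Re p / 2 ->
  Cmod (gamma_int s (p + h) - gamma_int s p + h * gamma_int (s + 1) p)%C <= K * Cmod h ^ 2.
Proof.
  intros Hs Hp. destruct (ex_Rhalf_gamma (Re s + 2) (Re p / 2)) as [K HK]; [lra|lra|].
  exists K. split.
  { assert (T : Rabs K <= K).
    { apply (is_half_norm_le R_CompleteNormedModule _ _ _ _ HK HK). intros x Hx.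
      right. apply Rabs_pos_eq. left; apply exp_pos. }
    assert (T2 := Rabs_pos K). change (0 <= K). lra. }
  intros h Hh.
  assert (Hph : Re (p + h)%C = Re p + Re h) by reflexivity.
  assert (Rh : - Cmod h <= Re h <= Cmod h) by (apply Rabs_le_between, re_le_Cmod).
  assert (H1 := gamma_int_correct s (p + h) Hs ltac:(lra)).
  assert (H2 := gamma_int_correct s p Hs Hp).
  assert (H3 := gamma_int_correct (s + 1) p ltac:(change (-1 < Re s + 1); lra) Hp).
  assert (H4 := is_Chalf_plus _ _ _ _ (is_Chalf_plus _ _ _ _ H1 (is_Chalf_scal (-(1)) _ _ H2))
     (is_Chalf_scal h _ _ H3)). cbv beta in H4.
  replace (gamma_int s (p + h) - gamma_int s p + h * gamma_int (s + 1) p)%C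
    with (gamma_int s (p + h) + - (1) * gamma_int s p + h * gamma_int (s + 1) p)%C by ring.
  rewrite Rmult_comm.
  apply (is_Chalf_norm_le _ _ (fun x => Cmod h ^ 2 * exp ((Re s + 2) * ln x - Re p / 2 * x)) _ H4).
  { apply is_Rhalf_scal, HK. }
  intros x Hx.
  rewrite (gamma_kernel_S s p x Hx).
  assert (E : gamma_kernel s (p + h) x = (gamma_kernel s p x * Cexp (- (h * x)))%C).
  { unfold gamma_kernel. rewrite <- Cexp_plus. f_equal. ring. }
  rewrite E.
  replace (gamma_kernel s p x * Cexp (- (h * x)) + - (1) * gamma_kernel s p x + h * (x * gamma_kernel s p x))%C
    with (gamma_kernel s p x * (Cexp (- (h * x)) - 1 - (- (h * x))))%C by ring.
  rewrite Cmod_mult, Cmod_gamma_kernel.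
  assert (T := Cexp_sub_1_sub_id_le (- (h * x))%C).
  rewrite Cmod_opp, Cmod_mult, Cmod_R, (Rabs_pos_eq x) in T by lra.
  apply Rle_trans with (exp (Re s * ln x - Re p * x) * ((Cmod h * x) ^ 2 * exp (Cmod h * x))).
  { apply Rmult_le_compat_l; [left; apply exp_pos|exact T]. }
  replace ((Re s + 2) * ln x - Re p / 2 * x) with (Re s * ln x + ln x + ln x + - (Re p / 2 * x)) by field.
  replace (Re s * ln x - Re p * x) with (Re s * ln x + - (Re p * x)) by ring.
  rewrite !exp_plus, exp_ln by exact Hx.
  assert (T2 : exp (- (Re p * x)) * exp (Cmod h * x) <= exp (- (Re p / 2 * x))).
  { rewrite <- exp_plus. apply exp_le_compat. nra. }
  replace (exp (Re s * ln x) * exp (- (Re p * x)) * ((Cmod h * x) ^ 2 * exp (Cmod h * x)))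
    with (exp (Re s * ln x) * (Cmod h ^ 2 * x ^ 2) * (exp (- (Re p * x)) * exp (Cmod h * x))) by ring.
  replace (Cmod h ^ 2 * (exp (Re s * ln x) * x * x * exp (- (Re p / 2 * x))))
    with (exp (Re s * ln x) * (Cmod h ^ 2 * x ^ 2) * exp (- (Re p / 2 * x))) by ring.
  apply Rmult_le_compat_l; [|exact T2].
  apply Rmult_le_pos; [left; apply exp_pos|]. apply Rmult_le_pos; apply pow2_ge_0.
Qed.

(** By [gamma_int_by_parts] the quantity [gamma_int s p * p^(s+1)] has derivative [0] along the path
    [p = exp (t L)], which stays in the right half-plane. This replaces the rotation of the contour of
    integration. *)
Lemma gamma_int_scale s L : -1 < Re s -> Rabs (Im L) < PI / 2 ->
  gamma_int s (Cexp L) = (gamma_int s 1 * Cexp (- ((s + 1) * L)))%C.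
Proof.
  intros Hs HL.
  (* The path from [1] to [exp L]. *)
  set (p := fun t : R => Cexp (t * L)).
  assert (Hp : forall t, 0 <= t <= 1 -> 0 < Re (p t)).
  { intros t Ht. unfold p. rewrite Cexp_pair. unfold Re at 1; simpl.
    apply Rmult_lt_0_compat; [apply exp_pos|].
    apply Rabs_def2 in HL. apply cos_gt_0; unfold Im in *; simpl; nra. }
  assert (D : forall t, 0 <= t <= 1 ->
     Cder (fun t => gamma_int s (p t)) t (- (L * p t * gamma_int (s + 1) (p t)))%C).
  { intros t Ht. specialize (Hp t Ht).
    destruct (gamma_int_quadratic s (p t) Hs Hp) as [K [HK0 HK]].
    set (g1 := gamma_int (s + 1) (p t)) in *.
    assert (Hl0 := Cmod_ge_0 L).
    set (c := Cmod (p t) * Cmod L * exp (Cmod L)).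
    assert (Hc : 0 <= c).
    { apply Rmult_le_pos; [apply Rmult_le_pos; apply Cmod_ge_0|left; apply exp_pos]. }
    assert (Hpm := Cmod_ge_0 (p t)). assert (Hgm := Cmod_ge_0 g1).
    assert (Pd : 0 < Rmin 1 (Re (p t) / 2 / (c + 1))).
    { apply Rmin_pos; [lra|]. apply Rdiv_lt_0_compat; lra. }
    apply Cder_of_quadratic with (Rmin 1 (Re (p t) / 2 / (c + 1)))
      (K * c ^ 2 + Cmod g1 * (Cmod (p t) * Cmod L ^ 2 * exp (Cmod L))); [exact Pd|].
    intros h Hh.
    assert (M1 := Rmin_l 1 (Re (p t) / 2 / (c + 1))). assert (M2 := Rmin_r 1 (Re (p t) / 2 / (c + 1))).
    assert (Hha := Rabs_pos h).
    (* The increment of [p] at [t], which is [h L p(t)] up to [O(h^2)]. *)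
    set (k := (p t * (Cexp (h * L) - 1))%C).
    assert (Ek : p (t + h) = (p t + k)%C).
    { unfold p, k, p. rewrite RtoC_plus.
      replace ((t + h) * L)%C with (t * L + h * L)%C by ring. rewrite Cexp_plus. ring. }
    assert (EhL : Cmod (h * L)%C = Rabs h * Cmod L) by (rewrite Cmod_mult, Cmod_R; reflexivity).
    assert (Eexp : exp (Cmod (h * L)%C) <= exp (Cmod L)).
    { apply exp_le_compat. rewrite EhL. nra. }
    assert (Nk : Cmod k <= c * Rabs h).
    { unfold k, c. rewrite Cmod_mult.
      assert (T := Cexp_sub_1_le (h * L)%C).
      apply Rle_trans with (Cmod (p t) * (Cmod (h * L)%C * exp (Cmod L))).
      - apply Rmult_le_compat_l; [auto|]. eapply Rle_trans; [exact T|].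
        apply Rmult_le_compat_l; [apply Cmod_ge_0|exact Eexp].
      - rewrite EhL. right. ring. }
    assert (Nk2 : Cmod (k - h * (L * p t))%C <= Cmod (p t) * Cmod L ^ 2 * exp (Cmod L) * h ^ 2).
    { replace (k - h * (L * p t))%C with (p t * (Cexp (h * L) - 1 - h * L))%C by (unfold k; ring).
      rewrite Cmod_mult. assert (T := Cexp_sub_1_sub_id_le (h * L)%C).
      apply Rle_trans with (Cmod (p t) * (Cmod (h * L)%C ^ 2 * exp (Cmod L))).
      - apply Rmult_le_compat_l; [auto|]. eapply Rle_trans; [exact T|].
        apply Rmult_le_compat_l; [apply pow2_ge_0|exact Eexp].
      - rewrite EhL, <- (pow2_abs h). right. ring. }
    assert (Hk : Cmod k <= Re (p t) / 2).
    { eapply Rle_trans; [exact Nk|].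
      apply Rle_trans with ((c + 1) * (Re (p t) / 2 / (c + 1))); [|right; field; lra].
      apply Rmult_le_compat; lra. }
    specialize (HK k Hk).
    replace (gamma_int s (p (t + h)%R) - gamma_int s (p t) - h * - (L * p t * g1))%C with
      ((gamma_int s (p t + k) - gamma_int s (p t) + k * g1) - g1 * (k - h * (L * p t)))%C
      by (rewrite Ek; ring).
    eapply Rle_trans; [apply Cmod_sub_le|]. rewrite Cmod_mult.
    assert (Cmod k ^ 2 <= c ^ 2 * h ^ 2).
    { rewrite <- (pow2_abs h), <- Rpow_mult_distr. apply pow_incr. split; [apply Cmod_ge_0|exact Nk]. }
    assert (K * Cmod k ^ 2 <= K * (c ^ 2 * h ^ 2)) by (apply Rmult_le_compat_l; auto).
    assert (Cmod g1 * Cmod (k - h * (L * p t))%C <=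
       Cmod g1 * (Cmod (p t) * Cmod L ^ 2 * exp (Cmod L) * h ^ 2)) by (apply Rmult_le_compat_l; auto).
    lra. }
  assert (M := Cder_mean_value
     (fun t => (gamma_int s (p t) * Cexp (t * ((s + 1) * L)))%C) (fun _ => RtoC 0) 0 1 0 ltac:(lra)).
  assert (Z : Cmod (gamma_int s (p 1) * Cexp (RtoC 1 * ((s + 1) * L))
                - gamma_int s (p 0) * Cexp (RtoC 0 * ((s + 1) * L)))%C = 0).
  { apply Rle_antisym; [|apply Cmod_ge_0]. rewrite Rmult_0_l in M. apply M.
    - intros t Ht.
      replace (RtoC 0) with
        (- (L * p t * gamma_int (s + 1) (p t)) * Cexp (t * ((s + 1) * L))
         + gamma_int s (p t) * (((s + 1) * L) * Cexp (t * ((s + 1) * L))))%C.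
      + apply Cder_mult; [apply D, Ht|]. apply Cder_exp, Cder_lin.
      + assert (B := gamma_int_by_parts s (p t) Hs (Hp t Ht)).
        transitivity (L * Cexp (t * ((s + 1) * L)) * ((s + 1) * gamma_int s (p t) - p t * gamma_int (s + 1) (p t)))%C;
          [ring|]. rewrite B. ring.
    - intros; apply Ccont_const.
    - intros. rewrite Cmod_0. lra. }
  apply Cmod_eq_0 in Z. unfold p in Z.
  rewrite !Cmult_1_l, !Cmult_0_l, !Cexp_0 in Z.
  rewrite Cexp_opp. apply Ceq_minus in Z. rewrite Cmult_1_r in Z. rewrite <- Z. field. apply Cexp_neq_0.
Qed.

(** * Euler's integral for the Gamma function *)

Lemma rising_S_l z n : rising z (S n) = (z * rising (z + 1) n)%C.
Proof.
  induction n.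
  - simpl. ring.
  - change (rising z (S (S n))) with (rising z (S n) * (z + INR (S (S n))))%C.
    rewrite IHn. change (rising (z + 1) (S n)) with (rising (z + 1) n * (z + 1 + INR (S n)))%C.
    rewrite (S_INR (S n)), RtoC_plus. ring.
Qed.

Lemma neq_0_of_Re_pos z : 0 < Re z -> z <> RtoC 0.
Proof. intros H ->. simpl in H. lra. Qed.

Lemma rising_neq_0 z n : 0 < Re z -> rising z n <> RtoC 0.
Proof.
  intros Hz. induction n; [apply neq_0_of_Re_pos, Hz|].
  change (rising z (S n)) with (rising z n * (z + INR (S n)))%C.
  apply Cmult_neq_0; [exact IHn|]. apply neq_0_of_Re_pos.
  change (0 < Re z + INR (S n)). assert (T := pos_INR (S n)). lra.
Qed.

Lemma is_derive_pow_affine c k x : is_derive (fun x => (1 - x / c) ^ S k) x (- (INR (S k) / c) * (1 - x / c) ^ k).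
Proof.
  auto_derive; [auto|]. replace (Nat.pred (S k)) with k by reflexivity.
  change (match k with O => 1 | S _ => INR k + 1 end) with (INR (S k)).
  unfold Rdiv, Rminus. ring.
Qed.

Lemma Cexp_ln_plus_1 s x : 0 < x -> Cexp ((s + 1) * ln x)%C = (x * Cexp (s * ln x))%C.
Proof.
  intros Hx. rewrite <- (exp_ln x Hx) at 2. rewrite <- Cexp_RtoC, <- Cexp_plus. f_equal. ring.
Qed.

Definition euler_integrand (s : C) (c : R) (k : nat) (x : R) : C :=
  (Cexp (s * ln x) * RtoC ((1 - x / c) ^ k))%C.

Lemma Ccont_euler_integrand s c k x : 0 < x -> Ccont (euler_integrand s c k) x.
Proof.
  intros Hx. apply Ccont_mult.
  - apply Ccont_exp, Ccont_mult; [apply Ccont_const|apply Ccont_ln, Hx].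
  - apply Ccont_RtoC. apply (@ex_derive_continuous R_AbsRing R_NormedModule). auto_derive. auto.
Qed.

Lemma Cder_power s x : 0 < x ->
  Cder (fun x => Cexp ((s + 1) * ln x)%C) x ((s + 1) * Cexp (s * ln x))%C.
Proof.
  intros Hx.
  replace ((s + 1) * Cexp (s * ln x))%C
    with (((s + 1) * RtoC (/ x)) * Cexp ((s + 1) * ln x))%C.
  - apply Cder_exp, Cder_scal, Cder_RtoC, is_derive_ln, Hx.
  - rewrite Cexp_ln_plus_1, RtoC_inv by lra. field. intros E. apply RtoC_inj in E. lra.
Qed.

Lemma lim_at_0_power s c k : -1 < Re s -> 0 < c ->
  lim_at_0 (fun x => (Cexp ((s + 1) * ln x) * RtoC ((1 - x / c) ^ k))%C) (RtoC 0).
Proof.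
  intros Hs Hc eps He. assert (Hs1 : 0 < Re s + 1) by lra.
  exists (Rmin c (exp (ln eps / (Re s + 1)))). split; [apply Rmin_pos; [auto|apply exp_pos]|].
  intros x Hx. assert (M1 := Rmin_l c (exp (ln eps / (Re s + 1)))).
  assert (M2 := Rmin_r c (exp (ln eps / (Re s + 1)))).
  cbv beta. unfold Cminus at 1. rewrite Copp_0, Cplus_0_r, Cmod_mult, Cmod_Cexp, Cmod_R.
  replace (Re ((s + 1) * ln x)%C) with ((Re s + 1) * ln x) by (unfold Re; simpl; ring).
  assert (0 <= x / c <= 1).
  { split; [left; apply Rdiv_lt_0_compat; lra|].
    apply Rmult_le_reg_r with c; [auto|]. unfold Rdiv. rewrite Rmult_assoc, Rinv_l by lra. lra. }
  assert (0 <= (1 - x / c) ^ k <= 1).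
  { split; [apply pow_le; lra|]. assert (T := pow_incr (1 - x / c) 1 k ltac:(lra)). rewrite pow1 in T. exact T. }
  rewrite Rabs_pos_eq by lra.
  assert (T := exp_ln_small _ _ Hs1 He x ltac:(lra)). assert (T2 := exp_pos ((Re s + 1) * ln x)). nra.
Qed.

(** Repeated integration by parts lowers [k] and raises [s]. *)
Lemma euler_integral c k : 0 < c -> forall s, -1 < Re s ->
  is_Chalf (fun x => if Rle_dec x c then euler_integrand s c k x else RtoC 0)
    (INR (fact k) * Cexp ((s + 1) * ln c) / rising (s + 1) k)%C.
Proof.
  intros Hc. induction k; intros s Hs.
  - assert (Hn : (s + 1)%C <> RtoC 0) by (apply neq_0_of_Re_pos; change (0 < Re s + 1); lra).
    replace (INR (fact 0) * Cexp ((s + 1) * ln c) / rising (s + 1) 0)%C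
      with (/ (s + 1) * (Cexp ((s + 1) * ln c) * RtoC ((1 - c / c) ^ 0)) - / (s + 1) * RtoC 0)%C
      by (simpl; field; exact Hn).
    apply (is_Chalf_cut_derive (fun x => (/ (s + 1) * (Cexp ((s + 1) * ln x) * RtoC ((1 - x / c) ^ 0)))%C)); auto.
    + intros x Hx.
      apply Cder_ext with (fun x => (/ (s + 1) * Cexp ((s + 1) * ln x))%C); [intros; simpl; ring|].
      replace (euler_integrand s c 0 x) with (/ (s + 1) * ((s + 1) * Cexp (s * ln x)))%C.
      * apply Cder_scal, Cder_power, Hx.
      * unfold euler_integrand. simpl. field. exact Hn.
    + intros x Hx. apply Ccont_euler_integrand, Hx.
    + apply lim_at_0_scal, lim_at_0_power; auto.
  - assert (Hs1 : 0 < Re s + 1) by lra.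
    assert (Hn : (s + 1)%C <> RtoC 0) by (apply neq_0_of_Re_pos; exact Hs1).
    assert (Hc0 : RtoC c <> RtoC 0) by (intros E; apply RtoC_inj in E; lra).
    (* [K] is the coefficient with which the derivative of [(1 - x/c)^(k+1)] appears. *)
    set (K := (RtoC (INR (S k) / c) / (s + 1))%C).
    assert (IH := IHk (s + 1)%C ltac:(change (-1 < Re s + 1); lra)).
    assert (P : is_Chalf (fun x => if Rle_dec x c
        then (euler_integrand s c (S k) x + (- K) * euler_integrand (s + 1) c k x)%C else RtoC 0)
       (/ (s + 1) * (Cexp ((s + 1) * RtoC (ln c)) * RtoC ((1 - c / c) ^ S k)) - / (s + 1) * RtoC 0)%C).
    { apply (is_Chalf_cut_derive (fun x => (/ (s + 1) * (Cexp ((s + 1) * RtoC (ln x)) * RtoC ((1 - x / c) ^ S k)))%C)); auto.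
      - intros x Hx.
        replace (euler_integrand s c (S k) x + - K * euler_integrand (s + 1) c k x)%C with
          (/ (s + 1) * (((s + 1) * Cexp (s * RtoC (ln x))) * RtoC ((1 - x / c) ^ S k)
             + Cexp ((s + 1) * RtoC (ln x)) * RtoC (- (INR (S k) / c) * (1 - x / c) ^ k)))%C.
        + apply Cder_scal.
          apply (Cder_mult (fun x => Cexp ((s + 1) * RtoC (ln x))%C) (fun x => RtoC ((1 - x / c) ^ S k)));
            [apply Cder_power, Hx|]. apply Cder_RtoC, is_derive_pow_affine.
        + unfold euler_integrand, K. rewrite RtoC_mult, RtoC_opp. field. exact Hn.
      - intros x Hx. apply Ccont_plus; [|apply Ccont_mult; [apply Ccont_const|]];
          apply Ccont_euler_integrand, Hx.
      - apply lim_at_0_scal, lim_at_0_power; auto. }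
    assert (Q := is_Chalf_plus _ _ _ _ P (is_Chalf_scal K _ _ IH)).
    match type of Q with is_Chalf _ ?v => replace (INR (fact (S k)) * Cexp ((s + 1) * ln c) / rising (s + 1) (S k))%C with v end.
    + apply (is_half_ext C_R_CompleteNormedModule) with (2 := Q). intros x Hx. cbv beta.
      destruct (Rle_dec x c); match goal with |- ?a = ?b => change (@eq C a b) end; ring.
    + assert (R1 : rising (s + 1 + 1) k <> RtoC 0)
        by (apply rising_neq_0; change (0 < Re s + 1 + 1); lra).
      rewrite rising_S_l, (Cexp_ln_plus_1 (s + 1) c Hc).
      unfold Rdiv at 1. rewrite Rinv_r, Rminus_diag by lra.
      unfold K. rewrite fact_simpl, mult_INR, RtoC_mult, RtoC_div by lra.
      simpl pow. rewrite Rmult_0_l. field. repeat split; auto.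
Qed.

(** Since [exp x >= (1 + x/n)^n], Bernoulli's inequality gives
    [exp x (1 - x/n)^n >= (1 - x^2/n^2)^n >= 1 - x^2/n]. *)
Lemma exp_minus_pow_le n x : (1 <= n)%nat -> 0 <= x <= INR n ->
  Rabs (exp (- x) - (1 - x / INR n) ^ n) <= / INR n * (x ^ 2 * exp (- x)).
Proof.
  intros Hn Hx. assert (Hn1 : 1 <= INR n) by (apply (le_INR 1 n Hn)).
  set (y := x / INR n).
  assert (Ey : x = INR n * y) by (unfold y; field; lra).
  assert (Hy : 0 <= y <= 1).
  { unfold y. split; [apply Rdiv_le_0_compat; lra|].
    apply Rmult_le_reg_r with (INR n); [lra|]. unfold Rdiv. rewrite Rmult_assoc, Rinv_l by lra. lra. }
  assert (En : forall z k, exp (INR k * z) = exp z ^ k).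
  { intros z k. induction k; [simpl; rewrite Rmult_0_l; apply exp_0|].
    rewrite S_INR. simpl. rewrite <- IHk, <- exp_plus. f_equal. ring. }
  assert (U : (1 - y) ^ n <= exp (- x)).
  { replace (- x) with (INR n * - y) by lra. rewrite En. apply pow_incr. split; [lra|].
    assert (T := exp_ineq1_le (- y)). lra. }
  rewrite Rabs_pos_eq by lra.
  assert (B : forall k u, 0 <= u <= 1 -> 1 - INR k * u <= (1 - u) ^ k).
  { clear. intros k u Hu. induction k; [simpl; lra|]. rewrite S_INR. simpl.
    assert (T := pos_INR k).
    assert ((1 - u) * (1 - INR k * u) <= (1 - u) * (1 - u) ^ k) by (apply Rmult_le_compat_l; lra).
    nra. }
  assert (L : exp (- x) * (1 - INR n * y ^ 2) <= (1 - y) ^ n).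
  { assert (L1 : 1 - INR n * y ^ 2 <= (1 - y ^ 2) ^ n) by (apply B; nra).
    assert (L2 : (1 - y ^ 2) ^ n <= exp x * (1 - y) ^ n).
    { replace (1 - y ^ 2) with ((1 + y) * (1 - y)) by ring. rewrite Rpow_mult_distr.
      apply Rmult_le_compat_r; [apply pow_le; lra|]. rewrite Ey, En. apply pow_incr.
      assert (T := exp_ineq1_le y). lra. }
    apply Rmult_le_reg_l with (exp x); [apply exp_pos|].
    rewrite <- Rmult_assoc, <- exp_plus, Rplus_opp_r, exp_0. lra. }
  replace (/ INR n * (x ^ 2 * exp (- x))) with (exp (- x) * (INR n * y ^ 2))
    by (rewrite Ey at 2; field; lra).
  lra.
Qed.

Lemma rcvg_inv_INR : rcvg (fun n => / INR n) 0.
Proof.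
  intros eps He. destruct (archimed (/ eps)) as [A _].
  exists (S (Z.to_nat (up (/ eps)))). intros n Hn.
  assert (P : 0 < / eps) by (apply Rinv_0_lt_compat; auto).
  assert (L : / eps < INR n).
  { eapply Rlt_le_trans; [exact A|]. eapply Rle_trans; [|apply le_INR, Hn].
    rewrite S_INR, INR_IZR_INZ, Z2Nat.id by (apply le_IZR; lra). lra. }
  rewrite Rminus_0_r, Rabs_pos_eq by (left; apply Rinv_0_lt_compat; lra).
  rewrite <- (Rinv_inv eps). apply Rinv_lt_contravar; [|exact L]. apply Rmult_lt_0_compat; lra.
Qed.

(** Truncated at [n], the function [x^s (1 - x/n)^n] approximates [x^s exp (- x)] with error
    [x^(s+2) exp (- x) / n]; beyond [n] the bound holds because [x^2 >= n] there. *)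
Lemma euler_limit s : -1 < Re s ->
  cvg (fun n => (INR (fact n) * Cexp ((s + 1) * ln (INR n)) / rising (s + 1) n)%C)
    (gamma_int s 1).
Proof.
  intros Hs. destruct (ex_Rhalf_gamma (Re s + 2) 1) as [b Hb]; [lra|lra|].
  set (v := fun n => (INR (fact n) * Cexp ((s + 1) * ln (INR n)) / rising (s + 1) n)%C).
  destruct (is_half_approx C_R_CompleteNormedModule (gamma_kernel s 1)
    (fun n x => if Rle_dec x (INR (S n)) then euler_integrand s (INR (S n)) (S n) x else RtoC 0)
    (fun n => v (S n)) (fun n => / INR (S n))
    (fun x => exp ((Re s + 2) * ln x - 1 * x)) b) as [l [Hl Hln]].
  - intros n. apply euler_integral; auto. apply lt_0_INR. lia.
  - exact Hb.
  - intros n. left. apply Rinv_0_lt_compat, lt_0_INR. lia.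
  - intros eps He. destruct (rcvg_inv_INR eps He) as [N HN]. exists N. intros n Hn. apply HN. lia.
  - intros n x Hx. set (N := S n).
    change (@norm R_AbsRing C_R_NormedModule (gamma_kernel s 1 x -
      (if Rle_dec x (INR N) then euler_integrand s (INR N) N x else RtoC 0))%C
      <= / INR N * exp ((Re s + 2) * ln x - 1 * x)).
    rewrite norm_C_R.
    assert (HN1 : 1 <= INR N) by (apply (le_INR 1 N); unfold N; lia).
    assert (EK : gamma_kernel s 1 x = (Cexp (s * ln x) * exp (- x))%C).
    { rewrite gamma_kernel_split, <- Cexp_RtoC. f_equal. f_equal. rewrite RtoC_opp. ring. }
    assert (EB : exp ((Re s + 2) * ln x - 1 * x) = exp (Re s * ln x) * (x ^ 2 * exp (- x))).
    { replace ((Re s + 2) * ln x - 1 * x) with (Re s * ln x + ln x + ln x + - x) by ring.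
      rewrite !exp_plus, exp_ln by exact Hx. ring. }
    assert (EM : Cmod (Cexp (s * ln x)) = exp (Re s * ln x)).
    { rewrite Cmod_Cexp. f_equal. unfold Re; simpl; ring. }
    rewrite EB. replace (/ INR N * (exp (Re s * ln x) * (x ^ 2 * exp (- x))))
      with (exp (Re s * ln x) * (/ INR N * (x ^ 2 * exp (- x)))) by ring.
    destruct (Rle_dec x (INR N)) as [H|H].
    + unfold euler_integrand. rewrite EK.
      replace (Cexp (s * ln x) * exp (- x) - Cexp (s * ln x) * RtoC ((1 - x / INR N) ^ N))%C
        with (Cexp (s * RtoC (ln x)) * RtoC (exp (- x) - (1 - x / INR N) ^ N))%C
        by (rewrite RtoC_minus; ring).
      rewrite Cmod_mult, EM, Cmod_R.
      apply Rmult_le_compat_l; [left; apply exp_pos|]. apply exp_minus_pow_le; [unfold N; lia|lra].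
    + replace (gamma_kernel s 1 x - 0)%C with (gamma_kernel s 1 x) by ring.
      rewrite EK, Cmod_mult, EM, Cmod_R, Rabs_pos_eq by (left; apply exp_pos).
      apply Rmult_le_compat_l; [left; apply exp_pos|].
      assert (T := exp_pos (- x)).
      apply Rmult_le_reg_l with (INR N); [lra|]. rewrite <- Rmult_assoc, Rinv_r, Rmult_1_l by lra.
      apply Rmult_le_compat_r; nra.
  - assert (El : l = gamma_int s 1).
    { apply (is_Chalf_unique (gamma_kernel s 1)); [exact Hl|]. apply gamma_int_correct; [auto|simpl; lra]. }
    subst l. apply (cvg_shift v _ 1).
    apply cvg_dom with (fun n => / INR (S n) * b).
    + intros n. rewrite Nat.add_1_r. specialize (Hln n).
      change (@norm R_AbsRing C_R_NormedModule (gamma_int s 1 - v (S n))%C <= / INR (S n) * b) in Hln.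
      rewrite norm_C_R in Hln. rewrite Cmod_minus_sym. exact Hln.
    + intros eps He. destruct (small_factor b eps He) as [d [Hd Sd]].
      destruct (rcvg_inv_INR d Hd) as [N HN]. exists N. intros n Hn. specialize (HN (S n) ltac:(lia)).
      assert (Pn : 0 < / INR (S n)) by (apply Rinv_0_lt_compat, lt_0_INR; lia).
      rewrite Rminus_0_r, Rabs_pos_eq in HN by lra. rewrite Rmult_comm. apply Sd. lra.
Qed.

(** * First-order expansions with a submultiplicative norm *)

(** [jet f N]: on the disc of radius 1/8, [f(t) = f(0) + b t + t^2 g(t)] with
    [|f(0)| + |b| + sup |g| <= N]. The coefficient [b] is hidden, so that only [N] has to be followed
    through a computation. The small radius matters for [x^t]: its norm must stay integrable in [x]. *)
Definition jet (f : C -> C) (N : R) : Prop :=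
  exists (b : C) (G : R), 0 <= G /\ Cmod (f (RtoC 0)) + Cmod b + G <= N /\
    forall t, Cmod t <= / 8 -> Cmod (f t - f (RtoC 0) - b * t)%C <= G * Cmod t ^ 2.

Lemma Cmod_C0_le : Cmod (RtoC 0) <= / 8.
Proof. rewrite Cmod_0. lra. Qed.

Lemma jet_le f N N' : N <= N' -> jet f N -> jet f N'.
Proof. intros H [b [G [H1 [H2 H3]]]]. exists b, G. repeat split; auto. lra. Qed.

Lemma jet_nonneg f N : jet f N -> 0 <= N.
Proof.
  intros [b [G [H1 [H2 H3]]]].
  assert (T := Cmod_ge_0 (f (RtoC 0))). assert (T2 := Cmod_ge_0 b). lra.
Qed.

Lemma jet_ext f g N : (forall t, Cmod t <= / 8 -> f t = g t) -> jet f N -> jet g N.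
Proof.
  intros E [b [G [H1 [H2 H3]]]]. exists b, G. rewrite <- (E _ Cmod_C0_le). repeat split; auto.
  intros t Ht. rewrite <- (E t Ht). auto.
Qed.

Lemma jet_bound f N t : jet f N -> Cmod t <= / 8 -> Cmod (f t) <= N.
Proof.
  intros [b [G [H1 [H2 H3]]]] Ht. specialize (H3 t Ht).
  replace (f t) with ((f t - f (RtoC 0) - b * t) + (f (RtoC 0) + b * t))%C by ring.
  eapply Rle_trans; [apply Cmod_triangle|].
  assert (T := Cmod_triangle (f (RtoC 0)) (b * t)%C). rewrite Cmod_mult in T.
  assert (T1 := Cmod_ge_0 t). assert (T2 := Cmod_ge_0 b).
  assert (Cmod b * Cmod t <= Cmod b * 1) by (apply Rmult_le_compat_l; lra).
  assert (G * Cmod t ^ 2 <= G * 1) by (apply Rmult_le_compat_l; [auto|nra]). lra.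
Qed.

Lemma jet_const c : jet (fun _ => c) (Cmod c).
Proof.
  exists (RtoC 0), 0. split; [lra|]. split; [rewrite Cmod_0; lra|]. intros t Ht.
  replace (c - c - 0 * t)%C with (RtoC 0) by ring. rewrite Cmod_0. nra.
Qed.

Lemma jet_affine a c : jet (fun t => (a + c * t)%C) (Cmod a + Cmod c).
Proof.
  exists c, 0. split; [lra|]. split; [replace (a + c * 0)%C with a by ring; lra|]. intros t Ht.
  replace (a + c * t - (a + c * 0) - c * t)%C with (RtoC 0) by ring. rewrite Cmod_0. nra.
Qed.

Lemma jet_plus f g N M : jet f N -> jet g M -> jet (fun t => (f t + g t)%C) (N + M).
Proof.
  intros [b [G [H1 [H2 H3]]]] [b' [G' [H1' [H2' H3']]]].
  exists (b + b')%C, (G + G'). split; [lra|]. split.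
  - assert (T := Cmod_triangle (f (RtoC 0)) (g (RtoC 0))). assert (T2 := Cmod_triangle b b'). lra.
  - intros t Ht.
    replace (f t + g t - (f 0 + g 0) - (b + b') * t)%C
      with ((f t - f 0 - b * t) + (g t - g 0 - b' * t))%C by ring.
    eapply Rle_trans; [apply Cmod_triangle|]. specialize (H3 t Ht). specialize (H3' t Ht). lra.
Qed.

(** Expanding the product gives nine terms, each at most a product of two of the weights, because
    [|t| <= 1]. *)
Lemma jet_mult f g N M : jet f N -> jet g M -> jet (fun t => (f t * g t)%C) (N * M).
Proof.
  intros [b [G [H1 [H2 H3]]]] [b' [G' [H1' [H2' H3']]]].
  set (f0 := f (RtoC 0)) in *. set (g0 := g (RtoC 0)) in *.
  assert (F0 := Cmod_ge_0 f0). assert (B0 := Cmod_ge_0 b).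
  assert (F0' := Cmod_ge_0 g0). assert (B0' := Cmod_ge_0 b').
  exists (f0 * b' + b * g0)%C,
    (Cmod f0 * G' + G * Cmod g0 + Cmod b * Cmod b' + Cmod b * G' + G * Cmod b' + G * G').
  split; [repeat (apply Rplus_le_le_0_compat; [|apply Rmult_le_pos; auto]); apply Rmult_le_pos; auto|].
  split.
  - cbv beta. fold f0 g0.
    apply Rle_trans with ((Cmod f0 + Cmod b + G) * (Cmod g0 + Cmod b' + G')).
    + assert (T := Cmod_triangle (f0 * b')%C (b * g0)%C). rewrite !Cmod_mult in *. lra.
    + apply Rmult_le_compat; lra.
  - intros t Ht. cbv beta. fold f0 g0. specialize (H3 t Ht). specialize (H3' t Ht).
    set (r := (f t - f0 - b * t)%C) in *. set (r' := (g t - g0 - b' * t)%C) in *.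
    replace (f t * g t - f0 * g0 - (f0 * b' + b * g0) * t)%C with
      (f0 * r' + r * g0 + b * b' * (t * t) + b * t * r' + r * (b' * t) + r * r')%C
      by (unfold r, r'; ring).
    assert (T0 := Cmod_ge_0 t). assert (R0 := Cmod_ge_0 r). assert (R0' := Cmod_ge_0 r').
    set (u := Cmod t) in *.
    assert (Hu2 : 0 <= u ^ 2 <= 1) by nra.
    assert (A1 : Cmod f0 * Cmod r' <= Cmod f0 * G' * u ^ 2).
    { rewrite Rmult_assoc. apply Rmult_le_compat_l; auto. }
    assert (A2 : Cmod r * Cmod g0 <= G * Cmod g0 * u ^ 2).
    { replace (G * Cmod g0 * u ^ 2) with (G * u ^ 2 * Cmod g0) by ring. apply Rmult_le_compat_r; auto. }
    assert (A4 : Cmod b * u * Cmod r' <= Cmod b * G' * u ^ 2).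
    { apply Rle_trans with (Cmod b * 1 * (G' * u ^ 2)); [|lra].
      apply Rmult_le_compat; auto; [apply Rmult_le_pos; auto|]. apply Rmult_le_compat_l; auto. lra. }
    assert (A5 : Cmod r * (Cmod b' * u) <= G * Cmod b' * u ^ 2).
    { apply Rle_trans with (G * u ^ 2 * (Cmod b' * 1)); [|lra].
      apply Rmult_le_compat; auto; [apply Rmult_le_pos; auto|]. apply Rmult_le_compat_l; auto. lra. }
    assert (A6 : Cmod r * Cmod r' <= G * G' * u ^ 2).
    { apply Rle_trans with ((G * u ^ 2) * (G' * 1)); [|lra].
      apply Rmult_le_compat; auto. eapply Rle_trans; [exact H3'|]. apply Rmult_le_compat_l; lra. }
    eapply Rle_trans; [apply Cmod_triangle|].
    eapply Rle_trans; [apply Rplus_le_compat_r, Cmod_triangle|].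
    eapply Rle_trans; [apply Rplus_le_compat_r, Rplus_le_compat_r, Cmod_triangle|].
    eapply Rle_trans; [apply Rplus_le_compat_r, Rplus_le_compat_r, Rplus_le_compat_r, Cmod_triangle|].
    eapply Rle_trans; [apply Rplus_le_compat_r, Rplus_le_compat_r, Rplus_le_compat_r, Rplus_le_compat_r, Cmod_triangle|].
    rewrite !Cmod_mult. fold u.
    replace (Cmod b * Cmod b' * (u * u)) with (Cmod b * Cmod b' * u ^ 2) by ring. lra.
Qed.

Lemma jet_scal c f N : jet f N -> jet (fun t => (c * f t)%C) (Cmod c * N).
Proof. intros H. apply (jet_mult (fun _ => c)); [apply jet_const|exact H]. Qed.

Lemma jet_exp a : jet (fun t => Cexp (a * t)%C) (1 + Cmod a + Cmod a ^ 2 * exp (Cmod a / 8)).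
Proof.
  exists a, (Cmod a ^ 2 * exp (Cmod a / 8)).
  split; [apply Rmult_le_pos; [apply pow2_ge_0|left; apply exp_pos]|].
  rewrite Cmult_0_r, Cexp_0, Cmod_1. split; [lra|]. intros t Ht.
  assert (T := Cexp_sub_1_sub_id_le (a * t)%C). rewrite Cmod_mult in T.
  eapply Rle_trans; [exact T|]. rewrite Rpow_mult_distr.
  replace (Cmod a ^ 2 * exp (Cmod a / 8) * Cmod t ^ 2) with (Cmod a ^ 2 * Cmod t ^ 2 * exp (Cmod a / 8)) by ring.
  apply Rmult_le_compat_l.
  - apply Rmult_le_pos; apply pow2_ge_0.
  - apply exp_le_compat. assert (T2 := Cmod_ge_0 a). nra.
Qed.

(** The weights of [1/(w + t)] are at most [1/|w|], [1/|w|^2] and [2/|w|^3]; with [1/|w| <= 4] they add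
    up to at most [(1 + 4 + 32) / |w|]. *)
Lemma jet_inv w : / 4 <= Cmod w -> jet (fun t => (/ (w + t))%C) (37 / Cmod w).
Proof.
  intros Hw.
  assert (W0 : w <> RtoC 0) by (apply Cmod_gt_0; lra).
  assert (Hi : 0 < / Cmod w) by (apply Rinv_0_lt_compat; lra).
  assert (Hi4 : / Cmod w <= 4).
  { rewrite <- (Rinv_inv 4). apply Rinv_le_contravar; lra. }
  exists (- / (w * w))%C, (2 * / Cmod w ^ 3).
  assert (Hi3 : 0 < / Cmod w ^ 3) by (apply Rinv_0_lt_compat, pow_lt; lra).
  split; [lra|]. rewrite Cplus_0_r. split.
  - rewrite Cmod_opp, !Cmod_inv, Cmod_mult by (try apply Cmult_neq_0; auto).
    rewrite Rinv_mult, <- pow_inv. unfold Rdiv. set (i := / Cmod w) in *.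
    assert (i * i <= 4 * i) by nra. assert (i ^ 3 <= 16 * i) by (simpl; nra). lra.
  - intros t Ht.
    assert (Hwt : Cmod w / 2 <= Cmod (w + t)%C).
    { assert (T := Cmod_rev_tri w (- t)%C). replace (w - - t)%C with (w + t)%C in T by ring.
      rewrite Cmod_opp in T. lra. }
    assert (Wt0 : (w + t)%C <> RtoC 0) by (apply Cmod_gt_0; lra).
    replace (/ (w + t) - / w - - / (w * w) * t)%C with (t * t * (/ (w * w) * / (w + t)))%C
      by (field; auto).
    rewrite !Cmod_mult, !Cmod_inv, Cmod_mult by (try apply Cmult_neq_0; auto).
    assert (/ Cmod (w + t)%C <= 2 * / Cmod w).
    { replace (2 * / Cmod w) with (/ (Cmod w / 2)) by (field; lra). apply Rinv_le_contravar; lra. }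
    rewrite Rinv_mult, <- pow_inv. set (i := / Cmod w) in *.
    assert (T0 := Cmod_ge_0 t).
    replace (2 * i ^ 3 * Cmod t ^ 2) with (Cmod t * Cmod t * (i * i * (2 * i))) by ring.
    apply Rmult_le_compat_l; [nra|]. apply Rmult_le_compat_l; nra.
Qed.

Lemma cvg_le_transfer u v w (a b c : C) S T :
  cvg u a -> cvg v b -> cvg w c -> 0 <= T ->
  (forall n, Cmod (w n) <= (S - Cmod (u n) - Cmod (v n)) * T) ->
  Cmod c <= (S - Cmod a - Cmod b) * T.
Proof.
  intros Hu Hv Hw HT H. apply Rnot_lt_le. intros HC.
  set (e := Cmod c - (S - Cmod a - Cmod b) * T) in *.
  assert (He : 0 < e / (2 * T + 1)) by (apply Rdiv_lt_0_compat; unfold e; lra).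
  set (d := e / (2 * T + 1)) in *.
  destruct (Hu d He) as [N1 H1]. destruct (Hv d He) as [N2 H2]. destruct (Hw d He) as [N3 H3].
  set (n := (N1 + N2 + N3)%nat).
  specialize (H1 n ltac:(unfold n; lia)). specialize (H2 n ltac:(unfold n; lia)).
  specialize (H3 n ltac:(unfold n; lia)). specialize (H n).
  assert (A1 := Cmod_rev_tri a (u n)). assert (A2 := Cmod_rev_tri b (v n)). assert (A3 := Cmod_rev_tri c (w n)).
  rewrite Cmod_minus_sym in A1, A2, A3.
  assert ((S - Cmod (u n) - Cmod (v n)) * T <= (S - Cmod a - Cmod b + 2 * d) * T)
    by (apply Rmult_le_compat_r; lra).
  assert (E : d * (2 * T + 1) = e) by (unfold d; field; lra). unfold e in E. nra.
Qed.

(** The coefficient of [t] in the sum is the sum of the coefficients; the bound on the weights passes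
    to the limit from the partial sums. *)
Lemma jet_sums (f : nat -> C -> C) (N : nat -> R) (F : C -> C) S :
  (forall n, jet (f n) (N n)) -> (forall n, rsum N n <= S) ->
  (forall t, Cmod t <= / 8 -> sums (fun n => f n t) (F t)) -> jet F S.
Proof.
  intros Hf HS HF.
  set (b := fun n => proj1_sig (constructive_indefinite_description _ (Hf n))).
  assert (Hb := fun n => proj2_sig (constructive_indefinite_description _ (Hf n))).
  fold b in Hb. change (forall n, exists G, 0 <= G /\ Cmod (f n (RtoC 0)) + Cmod (b n) + G <= N n /\
    forall t, Cmod t <= / 8 -> Cmod (f n t - f n (RtoC 0) - b n * t)%C <= G * Cmod t ^ 2) in Hb.
  set (G := fun n => proj1_sig (constructive_indefinite_description _ (Hb n))).
  assert (HG := fun n => proj2_sig (constructive_indefinite_description _ (Hb n))).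
  change (forall n, 0 <= G n /\ Cmod (f n (RtoC 0)) + Cmod (b n) + G n <= N n /\
    forall t, Cmod t <= / 8 -> Cmod (f n t - f n (RtoC 0) - b n * t)%C <= G n * Cmod t ^ 2) in HG.
  destruct (sums_majorant b N S) as [B [HB _]].
  { intros n. destruct (HG n) as [H1 [H2 _]]. assert (T := Cmod_ge_0 (f n (RtoC 0))). lra. }
  { exact HS. }
  assert (H0 := HF (RtoC 0) Cmod_C0_le).
  assert (P : forall n, Cmod (psum (fun k => f k (RtoC 0)) n) + Cmod (psum b n) + rsum G n <= S).
  { intros n. eapply Rle_trans; [|apply (HS n)].
    induction n; simpl; [rewrite Cmod_0; lra|].
    destruct (HG n) as [H1 [H2 _]].
    assert (T1 := Cmod_triangle (psum (fun k => f k (RtoC 0)) n) (f n (RtoC 0))).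
    assert (T2 := Cmod_triangle (psum b n) (b n)). lra. }
  assert (Key : forall t, Cmod t <= / 8 ->
     Cmod (F t - F (RtoC 0) - B * t)%C <= (S - Cmod (F (RtoC 0)) - Cmod B) * Cmod t ^ 2).
  { intros t Ht.
    apply (cvg_le_transfer (psum (fun k => f k (RtoC 0))) (psum b)
      (psum (fun k => ((f k t + (-(1)) * f k (RtoC 0)) + (- t) * b k)%C))); auto.
    - replace (F t - F 0 - B * t)%C with ((F t + (-(1)) * F (RtoC 0)) + (- t) * B)%C by ring.
      apply sums_plus; [apply sums_plus; [auto|apply sums_scal, H0]|apply sums_scal, HB].
    - apply pow2_ge_0.
    - intros n. apply Rle_trans with (rsum G n * Cmod t ^ 2).
      + rewrite Rmult_comm, <- rsum_scal. apply psum_norm_le. intros k.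
        destruct (HG k) as [_ [_ H3]]. specialize (H3 t Ht).
        replace (f k t + - (1) * f k 0 + - t * b k)%C with (f k t - f k 0 - b k * t)%C by ring. lra.
      + apply Rmult_le_compat_r; [apply pow2_ge_0|]. specialize (P n). lra. }
  exists B, (S - Cmod (F (RtoC 0)) - Cmod B). split; [|split; [lra|exact Key]].
  assert (T := cvg_le_transfer (psum (fun k => f k (RtoC 0))) (psum b) (fun _ => RtoC 0)
     (F (RtoC 0)) B (RtoC 0) S 1 H0 HB (cvg_const _) ltac:(lra)).
  rewrite Cmod_0 in T. assert (0 <= (S - Cmod (F (RtoC 0)) - Cmod B) * 1); [|lra].
  apply T. intros n. cbv beta. rewrite Cmod_0. specialize (P n).
  assert (R0 := rsum_mono G 0 n ltac:(intros k; apply HG) ltac:(lia)). simpl in R0. lra.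
Qed.

Definition inv_prod (k : nat) : R := / (INR (S k) * INR (S (S k))).

Lemma inv_prod_telescope k : inv_prod k = / INR (S k) - / INR (S (S k)).
Proof.
  unfold inv_prod. rewrite (S_INR (S k)).
  assert (T := lt_0_INR (S k) ltac:(lia)). field. split; lra.
Qed.

Lemma rsum_inv_prod n : rsum inv_prod n = 1 - / INR (S n).
Proof.
  induction n; [simpl; field|]. simpl rsum. rewrite IHn, inv_prod_telescope. ring.
Qed.

(** Submultiplicativity bounds the norms of the partial products by [N0 exp V], because the
    [inv_prod k] add up to at most [1]; the product is then the sum of its increments. *)
Lemma jet_product (f v : nat -> C -> C) N0 V :
  jet (f O) N0 -> (forall k, jet (v k) (V * inv_prod k)) ->
  (forall k t, Cmod t <= / 8 -> f (S k) t = (f k t * (1 + v k t))%C) ->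
  (forall t, Cmod t <= / 8 -> exists l, cvg (fun n => f n t) l) /\
  exists N, jet (fun t => Clim eventually (fun n => f n t)) N.
Proof.
  intros H0 Hv Hf. assert (HN0 := jet_nonneg _ _ H0).
  assert (HV : 0 <= V).
  { assert (T := jet_nonneg _ _ (Hv O)). unfold inv_prod in T. simpl in T. lra. }
  assert (Hip : forall k, 0 < inv_prod k).
  { intros k. apply Rinv_0_lt_compat, Rmult_lt_0_compat; apply lt_0_INR; lia. }
  assert (J : forall n, jet (f n) (N0 * exp (V * rsum inv_prod n))).
  { induction n.
    - simpl. rewrite Rmult_0_r, exp_0, Rmult_1_r. exact H0.
    - apply jet_ext with (fun t => (f n t * (1 + v n t))%C); [intros; symmetry; auto|].
      apply jet_le with (N0 * exp (V * rsum inv_prod n) * (1 + V * inv_prod n)).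
      + simpl rsum. rewrite (Rmult_plus_distr_l V), exp_plus, <- Rmult_assoc.
        apply Rmult_le_compat_l; [apply Rmult_le_pos; [auto|left; apply exp_pos]|].
        apply exp_ineq1_le.
      + apply jet_mult; [exact IHn|]. rewrite <- Cmod_1 at 1. apply (jet_plus (fun _ => RtoC 1)); [apply jet_const|apply Hv]. }
  set (M := N0 * exp V).
  assert (J' : forall n, jet (f n) M).
  { intros n. eapply jet_le; [|apply J]. apply Rmult_le_compat_l; [auto|]. apply exp_le_compat.
    rewrite rsum_inv_prod. assert (T : 0 < / INR (S n)) by (apply Rinv_0_lt_compat, lt_0_INR; lia). nra. }
  (* The increments: the first partial product, then the differences of consecutive ones. *)
  set (a := fun k t => match k with O => f O t | S j => (f j t * v j t)%C end).
  set (m := fun k => match k with O => M | S j => M * (V * inv_prod j) end).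
  assert (Ha : forall k, jet (a k) (m k)).
  { intros [|j]; simpl; [apply J'|]. apply jet_mult; auto. }
  assert (M0 : 0 <= M) by (apply (jet_nonneg _ _ (J' O))).
  assert (Hm0 : forall k, 0 <= m k) by (intros k; apply (jet_nonneg _ _ (Ha k))).
  assert (Hm : forall n, rsum m n <= M + M * V).
  { intros n. apply Rle_trans with (rsum m (S n)); [apply rsum_mono; auto|].
    assert (E : rsum m (S n) = M + M * V * rsum inv_prod n).
    { clear. induction n; [simpl; ring|]. change (rsum m (S (S n))) with (rsum m (S n) + M * (V * inv_prod n)).
      rewrite IHn. simpl. ring. }
    rewrite E, rsum_inv_prod.
    assert (T : 0 < / INR (S n)) by (apply Rinv_0_lt_compat, lt_0_INR; lia).
    assert (0 <= M * V) by (apply Rmult_le_pos; auto). nra. }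
  assert (S1 : forall t, Cmod t <= / 8 -> exists l, sums (fun k => a k t) l).
  { intros t Ht. destruct (sums_majorant (fun k => a k t) m (M + M * V)) as [l [Hl _]]; eauto.
    intros k. apply jet_bound; auto. }
  assert (E : forall t, Cmod t <= / 8 -> forall n, psum (fun k => a k t) (S n) = f n t).
  { intros t Ht n. induction n; [simpl; ring|].
    change (psum (fun k => a k t) (S (S n))) with (psum (fun k => a k t) (S n) + f n t * v n t)%C.
    rewrite IHn, (Hf n t Ht). ring. }
  assert (L : forall t, Cmod t <= / 8 -> forall l, sums (fun k => a k t) l -> cvg (fun n => f n t) l).
  { intros t Ht l Hl. apply cvg_ext with (fun n => psum (fun k => a k t) (n + 1)).
    - intros n. rewrite Nat.add_1_r. apply E, Ht.
    - apply cvg_shift, Hl. }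
  split.
  - intros t Ht. destruct (S1 t Ht) as [l Hl]. exists l. apply L; auto.
  - exists (M + M * V). apply jet_sums with a m; auto.
    intros t Ht. destruct (S1 t Ht) as [l Hl]. rewrite (Clim_eventually _ _ (L t Ht l Hl)). exact Hl.
Qed.

(** * The reciprocal Gamma function *)

(** The sequence whose limit defines [RGamma]. *)
Definition gauss (z : C) (n : nat) : C :=
  (rising z n / (INR (fact n) * Cexp (z * ln (INR n))))%C.

Lemma RtoC_neq_0 x : x <> 0 -> RtoC x <> RtoC 0.
Proof. intros H E. apply RtoC_inj in E. auto. Qed.

Lemma RtoC_INR_fact_neq_0 n : RtoC (INR (fact n)) <> RtoC 0.
Proof. apply RtoC_neq_0, INR_fact_neq_0. Qed.

(** One step of Gauss' product multiplies by [(1 + z/N) exp (- z d)] with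
    [d = ln N - ln (N - 1)]; this is [1 + gauss_step]. *)
Definition gauss_step (z : C) (N d : R) : C :=
  ((1 + RtoC (/ N) * z) * (Cexp (- (z * d)) - 1 + z * d)
    + RtoC (/ N - d) * z + (- RtoC (d / N)) * (z * z))%C.

Lemma gauss_S z n : (1 <= n)%nat ->
  gauss z (S n) = (gauss z n * (1 + gauss_step z (INR (S n)) (ln (INR (S n)) - ln (INR n))))%C.
Proof.
  intros Hn. unfold gauss, gauss_step.
  assert (P1 : 0 < INR n) by (apply lt_0_INR; lia).
  assert (P2 : 0 < INR (S n)) by (apply lt_0_INR; lia).
  assert (N1 : RtoC (INR (S n)) <> RtoC 0) by (apply RtoC_neq_0; lra).
  set (d := ln (INR (S n)) - ln (INR n)).
  assert (E : Cexp (z * ln (INR (S n)))%C = (Cexp (z * ln (INR n)) * Cexp (z * d))%C).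
  { rewrite <- Cexp_plus. f_equal. unfold d. rewrite RtoC_minus. ring. }
  rewrite E, Cexp_opp.
  change (rising z (S n)) with (rising z n * (z + INR (S n)))%C.
  rewrite fact_simpl, mult_INR, RtoC_mult, RtoC_minus, RtoC_div, RtoC_inv by lra.
  field. repeat split; auto using Cexp_neq_0, RtoC_INR_fact_neq_0.
Qed.

(** All three summands of [gauss_step] are [O(1/N^2)]: the first by the quadratic remainder of the
    exponential, the others because [1/N <= d <= 1/(N - 1)]. *)
Lemma jet_gauss_step z0 : exists V, forall k,
  jet (fun t => gauss_step (z0 + t) (INR (S (S k))) (ln (INR (S (S k))) - ln (INR (S k)))) (V * inv_prod k).
Proof.
  set (Z := Cmod z0 + 1). assert (HZ : 0 <= Cmod z0) by apply Cmod_ge_0.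
  set (W := (Z ^ 2 + Z + exp 1) * exp Z).
  assert (PW : 0 <= W).
  { apply Rmult_le_pos; [|left; apply exp_pos]. assert (T := exp_pos 1). unfold Z. nra. }
  exists ((1 + Z) * (2 * W) + Z + Z * Z). intros k.
  set (N := INR (S (S k))). set (N1 := INR (S k)).
  assert (HN1 : 1 <= N1) by (apply (le_INR 1 (S k)); lia).
  assert (HN : N = N1 + 1) by (apply S_INR).
  set (d := ln N - ln N1).
  assert (Hd1 : / N <= d).
  { unfold d. assert (T := exp_ineq1_le (ln (N1 / N))). rewrite exp_ln in T by (apply Rdiv_lt_0_compat; lra).
    rewrite ln_div in T by lra. replace (/ N) with (1 - N1 / N) by (rewrite HN; field; lra). lra. }
  assert (Hd2 : d <= / N1).
  { unfold d. assert (T := exp_ineq1_le (ln (N / N1))). rewrite exp_ln in T by (apply Rdiv_lt_0_compat; lra).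
    rewrite ln_div in T by lra. replace (/ N1) with (N / N1 - 1) by (rewrite HN; field; lra). lra. }
  assert (PN : 0 < / N) by (apply Rinv_0_lt_compat; lra).
  assert (PN1 : 0 < / N1 <= 1).
  { split; [apply Rinv_0_lt_compat; lra|]. rewrite <- Rinv_1. apply Rinv_le_contravar; lra. }
  assert (Ip : inv_prod k = / N1 * / N) by (unfold inv_prod; fold N N1; apply Rinv_mult).
  assert (Ip2 : / N1 - / N = inv_prod k) by (symmetry; apply inv_prod_telescope).
  assert (IN1 : / N1 <= 2 * / N).
  { apply Rmult_le_reg_l with (N1 * N); [nra|]. field_simplify; lra. }
  assert (Hdd : d * d <= 2 * inv_prod k).
  { rewrite Ip. apply Rle_trans with (/ N1 * / N1); [apply Rmult_le_compat; lra|]. nra. }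
  assert (Jz : jet (fun t => (z0 + t)%C) Z).
  { apply jet_ext with (fun t => (z0 + 1 * t)%C); [intros; ring|].
    apply jet_le with (Cmod z0 + Cmod 1); [rewrite Cmod_1; unfold Z; lra|apply jet_affine]. }
  assert (Je : jet (fun t => Cexp (- ((z0 + t) * d)) - 1 + (z0 + t) * d)%C (d * d * W)).
  { set (e0 := Cexp (- (z0 * d))%C).
    assert (M0 : Cmod (- (z0 * d))%C = Cmod z0 * d).
    { rewrite Cmod_opp, Cmod_mult, Cmod_R, Rabs_pos_eq; lra. }
    assert (M0' : Cmod z0 * d <= Z) by (unfold Z; nra).
    assert (Ee0 : Cmod e0 <= exp Z).
    { unfold e0. rewrite Cmod_Cexp. apply exp_le_compat.
      eapply Rle_trans; [apply Re_le_Cmod|]. lra. }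
    exists (d * (1 - e0))%C, (exp Z * exp 1 * (d * d)).
    split; [apply Rmult_le_pos; [apply Rmult_le_pos; left; apply exp_pos|nra]|].
    split.
    - rewrite Cplus_0_r. fold e0.
      assert (A1 : Cmod (e0 - 1 + z0 * d)%C <= d * d * (Z ^ 2 * exp Z)).
      { assert (T := Cexp_sub_1_sub_id_le (- (z0 * d))%C). fold e0 in T. rewrite M0 in T.
        replace (e0 - 1 + z0 * d)%C with (e0 - 1 - - (z0 * d))%C by ring.
        eapply Rle_trans; [exact T|].
        replace (d * d * (Z ^ 2 * exp Z)) with ((Z * d) ^ 2 * exp Z) by ring.
        apply Rmult_le_compat; [apply pow2_ge_0|left; apply exp_pos| |apply exp_le_compat; auto].
        apply pow_incr. split; [nra|]. apply Rmult_le_compat_r; unfold Z; lra. }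
      assert (A2 : Cmod (d * (1 - e0))%C <= d * d * (Z * exp Z)).
      { rewrite Cmod_mult, Cmod_R, Rabs_pos_eq, (Cmod_minus_sym 1) by lra.
        assert (T := Cexp_sub_1_le (- (z0 * d))%C). fold e0 in T. rewrite M0 in T.
        rewrite Rmult_assoc. apply Rmult_le_compat_l; [lra|]. eapply Rle_trans; [exact T|].
        replace (d * (Z * exp Z)) with (Z * d * exp Z) by ring.
        apply Rmult_le_compat; [nra|left; apply exp_pos| |apply exp_le_compat; auto].
        apply Rmult_le_compat_r; unfold Z; lra. }
      unfold W. lra.
    - intros t Ht. rewrite Cplus_0_r. fold e0.
      assert (Et : Cexp (- ((z0 + t) * d))%C = (e0 * Cexp (- (t * d)))%C).
      { unfold e0. rewrite <- Cexp_plus. f_equal. ring. }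
      rewrite Et.
      replace (e0 * Cexp (- (t * d)) - 1 + (z0 + t) * d - (e0 - 1 + z0 * d) - d * (1 - e0) * t)%C
        with (e0 * (Cexp (- (t * d)) - 1 - - (t * d)))%C by ring.
      assert (T := Cexp_sub_1_sub_id_le (- (t * d))%C).
      assert (Mt : Cmod (- (t * d))%C = Cmod t * d).
      { rewrite Cmod_opp, Cmod_mult, Cmod_R, Rabs_pos_eq; lra. }
      rewrite Mt in T. rewrite Cmod_mult.
      assert (T0 := Cmod_ge_0 t).
      replace (exp Z * exp 1 * (d * d) * Cmod t ^ 2) with (exp Z * ((Cmod t * d) ^ 2 * exp 1)) by ring.
      apply Rmult_le_compat; [apply Cmod_ge_0|apply Cmod_ge_0|exact Ee0|].
      eapply Rle_trans; [exact T|]. apply Rmult_le_compat_l; [apply pow2_ge_0|].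
      apply exp_le_compat. nra. }
  unfold gauss_step.
  assert (J1 : jet (fun t => 1 + RtoC (/ N) * (z0 + t))%C (1 + Z)).
  { apply jet_le with (Cmod 1 + Cmod (RtoC (/ N)) * Z).
    - rewrite Cmod_1, Cmod_R, Rabs_pos_eq by lra.
      assert (/ N <= 1). { rewrite <- Rinv_1. apply Rinv_le_contravar; lra. } unfold Z. nra.
    - apply (jet_plus (fun _ => RtoC 1)); [apply jet_const|]. apply jet_scal, Jz. }
  eapply jet_le; [|apply jet_plus; [apply jet_plus; [apply jet_mult; [exact J1|exact Je]|apply jet_scal, Jz]
                                  |apply jet_scal, (jet_mult _ _ _ _ Jz Jz)]].
  rewrite Cmod_opp, !Cmod_R.
  rewrite Rabs_left1 by lra. rewrite Rabs_pos_eq by (apply Rmult_le_pos; lra).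
  assert (PZ : 0 <= Z) by (unfold Z; lra).
  assert (B1 : (1 + Z) * (d * d * W) <= (1 + Z) * (2 * W) * inv_prod k).
  { replace ((1 + Z) * (2 * W) * inv_prod k) with ((1 + Z) * (2 * inv_prod k * W)) by ring.
    apply Rmult_le_compat_l; [lra|]. apply Rmult_le_compat_r; auto. }
  assert (B2 : - (/ N - d) * Z <= Z * inv_prod k) by nra.
  assert (B3 : d / N * (Z * Z) <= Z * Z * inv_prod k).
  { rewrite Rmult_comm. apply Rmult_le_compat_l; [nra|]. rewrite Ip. unfold Rdiv.
    apply Rmult_le_compat_r; lra. }
  lra.
Qed.

Lemma Clim_shift u l : cvg (fun n => u (S n)) l -> Clim eventually u = l.
Proof.
  intros H. apply Clim_eventually. apply (cvg_shift u l 1).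
  apply cvg_ext with (2 := H). intros n. rewrite Nat.add_1_r. reflexivity.
Qed.

Lemma RGamma_gauss_jet z0 :
  cvg (gauss z0) (RGamma z0) /\ exists N, jet (fun t => RGamma (z0 + t)%C) N.
Proof.
  destruct (jet_gauss_step z0) as [V HV].
  assert (J0 : exists N0, jet (fun t => gauss (z0 + t) 1) N0).
  { exists ((Cmod z0 + 1) * (Cmod (z0 + 1)%C + 1)).
    apply jet_ext with (fun t => (z0 + 1 * t) * ((z0 + 1) + 1 * t))%C.
    - intros t Ht. unfold gauss. change (INR 1) with 1. change (INR (fact 1)) with 1.
      rewrite ln_1, Cmult_0_r, Cexp_0. simpl. field.
    - apply jet_le with ((Cmod z0 + Cmod 1) * (Cmod (z0 + 1)%C + Cmod 1)); [rewrite Cmod_1; lra|].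
      apply jet_mult; apply jet_affine. }
  destruct J0 as [N0 J0].
  destruct (jet_product (fun n t => gauss (z0 + t) (S n)) _ N0 V J0 HV) as [H1 [N H2]].
  { intros k t Ht. apply gauss_S. lia. }
  assert (E : forall t, Cmod t <= / 8 -> exists l, cvg (fun n => gauss (z0 + t) (S n)) l /\ RGamma (z0 + t)%C = l).
  { intros t Ht. destruct (H1 t Ht) as [l Hl]. exists l. split; [exact Hl|]. apply Clim_shift, Hl. }
  split.
  - destruct (E _ Cmod_C0_le) as [l [Hl El]]. rewrite Cplus_0_r in *. subst l.
    apply (cvg_shift (gauss z0) _ 1).
    apply cvg_ext with (2 := Hl). intros n. rewrite Nat.add_1_r. reflexivity.
  - exists N. apply jet_ext with (2 := H2). intros t Ht. destruct (E t Ht) as [l [Hl ->]].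
    apply Clim_eventually, Hl.
Qed.

Lemma cvg_RGamma z : cvg (gauss z) (RGamma z).
Proof. apply RGamma_gauss_jet. Qed.

Lemma cvg_1_plus_inv z : cvg (fun n => (1 + z * RtoC (/ INR (S n)))%C) (RtoC 1).
Proof.
  apply cvg_dom with (fun n => Cmod z * / INR (S n)).
  - intros n. replace (1 + z * RtoC (/ INR (S n)) - 1)%C with (z * RtoC (/ INR (S n)))%C by ring.
    rewrite Cmod_mult, Cmod_R, Rabs_pos_eq; [lra|]. left. apply Rinv_0_lt_compat, lt_0_INR. lia.
  - intros eps He. destruct (small_factor (Cmod z) eps He) as [d [Hd Sd]].
    destruct (rcvg_inv_INR d Hd) as [N HN]. exists N. intros n Hn. specialize (HN (S n) ltac:(lia)).
    assert (Pn : 0 < / INR (S n)) by (apply Rinv_0_lt_compat, lt_0_INR; lia).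
    rewrite Rminus_0_r, Rabs_pos_eq in HN by lra. apply Sd. lra.
Qed.

Lemma RGamma_rec z : RGamma z = (z * RGamma (z + 1))%C.
Proof.
  apply cvg_unique with (fun n => (gauss z (S n) * (1 + (z + 1) * RtoC (/ INR (S n))))%C).
  - replace (RGamma z) with (RGamma z * 1)%C by ring. apply cvg_mult; [|apply cvg_1_plus_inv].
    apply cvg_ext with (fun n => gauss z (n + 1)); [intros; rewrite Nat.add_1_r; reflexivity|].
    apply cvg_shift, cvg_RGamma.
  - apply cvg_ext with (fun n => (z * gauss (z + 1) (n + 1))%C).
    + intros n. rewrite Nat.add_1_r. unfold gauss.
      assert (P : 0 < INR (S n)) by (apply lt_0_INR; lia).
      rewrite (Cexp_ln_plus_1 z _ P), RtoC_inv by lra.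
      change (rising (z + 1) (S n)) with (rising (z + 1) n * (z + 1 + INR (S n)))%C.
      rewrite rising_S_l. field.
      repeat split; auto using Cexp_neq_0, RtoC_INR_fact_neq_0. apply RtoC_neq_0; lra.
    + apply cvg_scal, cvg_shift, cvg_RGamma.
Qed.

(** Euler's integrals are exactly the inverses of the terms of Gauss' sequence. *)
Lemma RGamma_gamma_int s : -1 < Re s -> (RGamma (s + 1) * gamma_int s 1)%C = RtoC 1.
Proof.
  intros Hs. apply cvg_unique with
    (fun n => (gauss (s + 1) n * (INR (fact n) * Cexp ((s + 1) * ln (INR n)) / rising (s + 1) n))%C).
  - apply cvg_mult; [apply cvg_RGamma|apply euler_limit, Hs].
  - apply cvg_ext with (fun _ => RtoC 1); [|apply cvg_const].
    intros n. unfold gauss. field.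
    repeat split; auto using Cexp_neq_0, RtoC_INR_fact_neq_0.
    apply rising_neq_0. change (0 < Re s + 1). lra.
Qed.

Lemma RGamma_1 : RGamma (RtoC 1) = RtoC 1.
Proof.
  apply cvg_unique with (gauss 1); [apply cvg_RGamma|].
  apply (cvg_shift _ _ 1).
  apply cvg_ext with (fun n => (1 + 1 * RtoC (/ INR (S n)))%C); [|apply cvg_1_plus_inv].
  intros n. rewrite Nat.add_1_r. unfold gauss.
  assert (P : 0 < INR (S n)) by (apply lt_0_INR; lia).
  assert (E : forall k, rising 1 k = RtoC (INR (fact (S k)))).
  { induction k; [simpl; f_equal; ring|].
    change (rising 1 (S k)) with (rising 1 k * (1 + INR (S k)))%C. rewrite IHk.
    rewrite (fact_simpl (S k)), mult_INR, (S_INR (S k)), RtoC_mult, RtoC_plus. ring. }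
  replace (1 * RtoC (ln (INR (S n))))%C with (RtoC (ln (INR (S n)))) by ring.
  rewrite Cexp_RtoC, exp_ln, E, fact_simpl, mult_INR, RtoC_mult by exact P.
  rewrite (S_INR (S n)), RtoC_plus, RtoC_inv by lra. field.
  split; [apply RtoC_neq_0; lra|apply RtoC_INR_fact_neq_0].
Qed.

Lemma RGamma_nat n : RGamma (INR n + 1)%C = RtoC (/ INR (fact n)).
Proof.
  induction n.
  - simpl. rewrite Cplus_0_l, RGamma_1. f_equal. field.
  - assert (H := RGamma_rec (INR n + 1)%C). rewrite IHn in H.
    rewrite S_INR, RtoC_plus. rewrite fact_simpl, mult_INR.
    assert (P : 0 < INR (S n)) by (apply lt_0_INR; lia).
    assert (F := INR_fact_neq_0 n).
    rewrite RtoC_inv, RtoC_mult, S_INR, RtoC_plus by (apply Rmult_integral_contrapositive; split; lra).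
    rewrite RtoC_inv in H by exact F.
    rewrite S_INR in P. assert (N0 : (INR n + 1)%C <> RtoC 0).
    { rewrite <- RtoC_plus. apply RtoC_neq_0. lra. }
    transitivity (((INR n + 1) * RGamma (INR n + 1 + 1)) / (INR n + 1))%C; [field; exact N0|].
    rewrite <- H. field. split; [apply RtoC_INR_fact_neq_0|exact N0].
Qed.

Lemma RGamma_nonpos n : RGamma (- INR n)%C = RtoC 0.
Proof.
  induction n.
  - rewrite RGamma_rec. simpl. ring.
  - rewrite RGamma_rec. replace (- INR (S n) + 1)%C with (- INR n)%C; [rewrite IHn; ring|].
    rewrite S_INR, RtoC_plus. ring.
Qed.

(** Once [k > 2 |a|], one step [RGamma (z + 1) = RGamma z / z] at [z = a + t + k + 1] costs at most
    [37 / |a + k + 1| <= 74 / (k + 1)] by [jet_inv]; the finitely many earlier steps, where [z] may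
    vanish, are absorbed in the constant. *)
Lemma jet_RGamma_decay a : exists K, 0 <= K /\ forall k,
  jet (fun t => RGamma (a + t + INR k + 1)%C) (K * 74 ^ k / INR (fact k)).
Proof.
  assert (H74 : forall k, 0 < 74 ^ k) by (intros; apply pow_lt; lra).
  assert (Init : forall K0, exists K, 0 <= K /\ forall k, (k <= K0)%nat ->
      jet (fun t => RGamma (a + t + INR k + 1)%C) (K * 74 ^ k / INR (fact k))).
  { assert (One : forall k, exists N, jet (fun t => RGamma (a + t + INR k + 1)%C) N).
    { intros k. destruct (RGamma_gauss_jet (a + INR k + 1)%C) as [_ [N HN]].
      exists N. apply jet_ext with (2 := HN). intros t _. f_equal. ring. }
    assert (Fit : forall k N K, 0 <= N -> N * INR (fact k) / 74 ^ k <= K -> N <= K * 74 ^ k / INR (fact k)).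
    { intros k N K HN H. specialize (H74 k). assert (F := INR_fact_lt_0 k).
      apply Rmult_le_reg_r with (INR (fact k)); [auto|]. unfold Rdiv.
      rewrite Rmult_assoc, Rinv_l, Rmult_1_r by lra.
      apply Rmult_le_compat_r with (r := 74 ^ k) in H; [|lra]. unfold Rdiv in H.
      rewrite Rmult_assoc, Rinv_l, Rmult_1_r in H by lra. exact H. }
    induction K0.
    - destruct (One O) as [N HN]. assert (N0 := jet_nonneg _ _ HN).
      exists N. split; [exact N0|]. intros k Hk. replace k with O by lia.
      apply jet_le with (2 := HN). simpl. lra.
    - destruct IHK0 as [K [HK IH]]. destruct (One (S K0)) as [N HN]. assert (N0 := jet_nonneg _ _ HN).
      set (N' := N * INR (fact (S K0)) / 74 ^ S K0).
      exists (Rmax K N'). split; [eapply Rle_trans; [exact HK|apply Rmax_l]|]. intros k Hk.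
      destruct (Nat.eq_dec k (S K0)) as [->|Hne].
      + apply jet_le with (2 := HN). apply Fit; [auto|]. apply Rmax_r.
      + apply jet_le with (2 := IH k ltac:(lia)).
        apply Rmult_le_compat_r; [left; apply Rinv_0_lt_compat, INR_fact_lt_0|].
        apply Rmult_le_compat_r; [left; auto|]. apply Rmax_l. }
  destruct (archimed (2 * Cmod a + 2)) as [Ha _].
  set (K0 := Z.to_nat (up (2 * Cmod a + 2))).
  assert (HK0 : 2 * Cmod a + 2 < INR K0).
  { unfold K0. rewrite INR_IZR_INZ, Z2Nat.id; [exact Ha|]. apply le_IZR.
    assert (T := Cmod_ge_0 a). lra. }
  assert (Step : forall K k, 0 <= K -> (K0 <= k)%nat ->
     jet (fun t => RGamma (a + t + INR k + 1)%C) (K * 74 ^ k / INR (fact k)) ->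
     jet (fun t => RGamma (a + t + INR (S k) + 1)%C) (K * 74 ^ S k / INR (fact (S k)))).
  { intros K k HK Hk HJ.
    assert (Hkr : INR K0 <= INR k) by (apply le_INR; lia).
    set (w := (a + INR k + 1)%C).
    assert (Ha0 := Cmod_ge_0 a).
    assert (Hw : (INR k + 1) / 2 <= Cmod w).
    { assert (T := Cmod_rev_tri (RtoC (INR k + 1)) (- a)%C).
      rewrite Cmod_R, Rabs_pos_eq, Cmod_opp in T by lra.
      replace (RtoC (INR k + 1) - - a)%C with w in T by (unfold w; rewrite RtoC_plus; ring). lra. }
    apply jet_ext with (fun t => (/ (w + t) * RGamma (a + t + INR k + 1))%C).
    - intros t Ht. rewrite (RGamma_rec (a + t + INR k + 1)%C).
      replace (a + t + INR k + 1 + 1)%C with (a + t + INR (S k) + 1)%C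
        by (rewrite S_INR, RtoC_plus; ring).
      replace (a + t + INR k + 1)%C with (w + t)%C by (unfold w; ring).
      field. apply Cmod_gt_0.
      assert (T := Cmod_rev_tri w (- t)%C). replace (w - - t)%C with (w + t)%C in T by ring.
      rewrite Cmod_opp in T. lra.
    - apply jet_le with (37 / Cmod w * (K * 74 ^ k / INR (fact k))).
      + assert (Pk : 0 < INR k + 1) by lra. assert (F := INR_fact_lt_0 k).
        replace (K * 74 ^ S k / INR (fact (S k))) with (74 / (INR k + 1) * (K * 74 ^ k / INR (fact k))).
        * apply Rmult_le_compat_r.
          -- apply Rmult_le_pos; [apply Rmult_le_pos; [auto|left; auto]|left; apply Rinv_0_lt_compat; auto].
          -- unfold Rdiv.
             apply Rle_trans with (37 * / ((INR k + 1) / 2)); [|right; field; lra].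
             apply Rmult_le_compat_l; [lra|]. apply Rinv_le_contravar; lra.
        * rewrite fact_simpl, mult_INR, S_INR. simpl pow. field. lra.
      + apply jet_mult; [apply jet_inv; lra|exact HJ]. }
  destruct (Init K0) as [K [HK H]]. exists K. split; [exact HK|].
  assert (Later : forall j, jet (fun t => RGamma (a + t + INR (K0 + j) + 1)%C)
      (K * 74 ^ (K0 + j) / INR (fact (K0 + j)))).
  { induction j; [rewrite Nat.add_0_r; apply H; lia|].
    rewrite Nat.add_succ_r. apply Step; auto. lia. }
  intros k. destruct (le_lt_dec k K0) as [Hk|Hk]; [apply H, Hk|].
  replace k with (K0 + (k - K0))%nat by lia. apply Later.
Qed.

(** * The entire part of the Bessel functions *)

Definition clifford_term (nu u : C) (k : nat) : C :=
  (RGamma (nu + INR k + 1) * u ^ k * RtoC (/ INR (fact k)))%C.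

(** The entire function [0F1(nu + 1; u) / Gamma(nu + 1)] of Bessel and Clifford: it carries
    [J_nu] and [I_nu] without their branch factor. *)
Definition clifford (nu u : C) : C := CSeries (clifford_term nu u).

(** The terms are at most [K (74 |u|)^k / k!^2], also in jet norm. The factor [2^k] lost to
    [sums_tail_geom] doubles 74, which leads to the constant 148. *)
Lemma clifford_estimates a eps : 0 < eps -> exists K, 0 <= K /\ forall u,
  (forall t, Cmod t <= / 8 -> sums (clifford_term (a + t) u) (clifford (a + t) u)) /\
  jet (fun t => clifford (a + t) u) (K * exp (eps * Cmod u)) /\
  (forall n, Cmod (clifford a u - psum (clifford_term a u) n)%C <= (/ 2) ^ n * (K * exp (eps * Cmod u))) /\
  (forall n, Cmod (psum (clifford_term a u) n) <= K * exp (eps * Cmod u)) /\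
  exists m, (forall k, Cmod (clifford_term a u k) <= m k) /\
            (forall n, rsum m n <= K * exp (eps * Cmod u)).
Proof.
  intros Heps. destruct (jet_RGamma_decay a) as [K [HK HJ]].
  (* [rsum_inv_fact2_le] with this [d] gives the rate [148 d = eps]. *)
  set (d := eps / 148).
  assert (Hd : 0 < d) by (unfold d; lra).
  exists (K * exp (/ d)). split; [apply Rmult_le_pos; [auto|left; apply exp_pos]|]. intros u.
  assert (Hu := Cmod_ge_0 u).
  set (m := fun (c : R) k => K * ((c * Cmod u) ^ k / (INR (fact k) * INR (fact k)))).
  assert (Hm : forall c, 0 <= c <= 148 -> forall n, rsum (m c) n <= K * exp (/ d) * exp (eps * Cmod u)).
  { intros c Hc n. unfold m. rewrite rsum_scal, Rmult_assoc. apply Rmult_le_compat_l; [auto|].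
    eapply Rle_trans; [apply (rsum_inv_fact2_le d); [auto|apply Rmult_le_pos; lra]|].
    apply Rmult_le_compat_l; [left; apply exp_pos|]. apply exp_le_compat.
    replace eps with (d * 148) by (unfold d; field). rewrite Rmult_assoc.
    apply Rmult_le_compat_l; [lra|]. apply Rmult_le_compat_r; lra. }
  assert (Em : forall c k, m c k = K * c ^ k / INR (fact k) * (Cmod u ^ k * / INR (fact k))).
  { intros c k. unfold m. rewrite Rpow_mult_distr. field. apply INR_fact_neq_0. }
  assert (Mt : forall k, Cmod (u ^ k * RtoC (/ INR (fact k)))%C = Cmod u ^ k * / INR (fact k)).
  { intros k. rewrite Cmod_mult, Cmod_pow, Cmod_R, Rabs_pos_eq; [reflexivity|].
    left. apply Rinv_0_lt_compat, INR_fact_lt_0. }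
  assert (Ht : forall t k, Cmod t <= / 8 -> Cmod (clifford_term (a + t) u k) <= m 74 k).
  { intros t k Ht. unfold clifford_term.
    rewrite <- Cmult_assoc, Cmod_mult, Mt, Em.
    apply Rmult_le_compat_r.
    - apply Rmult_le_pos; [apply pow_le; auto|left; apply Rinv_0_lt_compat, INR_fact_lt_0].
    - apply (jet_bound _ _ t (HJ k) Ht). }
  assert (H74 := Hm 74 ltac:(lra)). assert (H148 := Hm 148 ltac:(lra)).
  assert (S1 : forall t, Cmod t <= / 8 -> sums (clifford_term (a + t) u) (clifford (a + t) u)).
  { intros t Htt. destruct (sums_majorant (clifford_term (a + t) u) (m 74) _ (fun k => Ht t k Htt) H74) as [l [Hl _]].
    unfold clifford. rewrite (CSeries_sums _ _ Hl). exact Hl. }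
  assert (Ha : forall k, Cmod (clifford_term a u k) <= m 74 k).
  { intros k. assert (T := Ht _ k Cmod_C0_le). rewrite Cplus_0_r in T. exact T. }
  split; [exact S1|]. split; [|split; [|split]].
  - apply jet_sums with (fun k t => clifford_term (a + t) u k) (m 74); auto.
    intros k. unfold clifford_term.
    apply jet_ext with (fun t => ((u ^ k * RtoC (/ INR (fact k))) * RGamma (a + t + INR k + 1))%C);
      [intros; ring|].
    apply jet_le with (Cmod (u ^ k * RtoC (/ INR (fact k)))%C * (K * 74 ^ k / INR (fact k))).
    + rewrite Mt, Em. right. ring.
    + apply jet_scal, HJ.
  - intros n. apply sums_tail_geom with (m 148); auto.
    + intros k. apply Rle_trans with (m 74 k * 2 ^ k).
      * apply Rmult_le_compat_r; [apply pow_le; lra|apply Ha].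
      * right. rewrite !Em. replace 148 with (74 * 2) by ring. rewrite Rpow_mult_distr. field.
        apply INR_fact_neq_0.
    + assert (T := S1 _ Cmod_C0_le). rewrite Cplus_0_r in T. exact T.
  - intros n. eapply Rle_trans; [apply psum_norm_le with (b := m 74); auto|]. apply H74.
  - exists (m 74). auto.
Qed.

Lemma clifford_sums a u : sums (clifford_term a u) (clifford a u).
Proof.
  destruct (clifford_estimates a 1) as [K [_ H]]; [lra|].
  destruct (H u) as [H1 _]. specialize (H1 _ Cmod_C0_le). rewrite Cplus_0_r in H1. exact H1.
Qed.

(** The first [M] terms of order [- M] vanish at the poles of Gamma, and the others are a shift of
    the series of order [M]. *)
Lemma clifford_neg_nat M u : clifford (- INR M) u = (u ^ M * clifford (INR M) u)%C.
Proof.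
  assert (H := sums_shift _ _ M (clifford_sums (- INR M) u)).
  rewrite (psum_zero (clifford_term (- INR M) u) M) in H.
  - apply (sums_unique (fun i => clifford_term (- INR M) u (M + i))).
    + replace (clifford (- INR M) u) with (clifford (- INR M) u - 0)%C by ring. exact H.
    + apply sums_ext with (fun i => (u ^ M * clifford_term (INR M) u i)%C);
        [|apply sums_scal, clifford_sums].
      intros i. unfold clifford_term.
      replace (- INR M + INR (M + i) + 1)%C with (INR i + 1)%C by (rewrite plus_INR, RtoC_plus; ring).
      replace (INR M + INR i + 1)%C with (INR (M + i) + 1)%C by (rewrite plus_INR, RtoC_plus; ring).
      rewrite !RGamma_nat, Cpow_add_r. ring.
  - intros k Hk. unfold clifford_term.
    replace (- INR M + INR k + 1)%C with (- INR (M - S k))%C.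
    + rewrite RGamma_nonpos. ring.
    + rewrite minus_INR, S_INR, RtoC_minus, RtoC_plus by lia. ring.
Qed.

Lemma BesselI_clifford nu z :
  BesselI nu z = (Cexp (nu * Clog (z / 2)) * clifford nu (Cexp (2 * Clog (z / 2))))%C.
Proof.
  unfold BesselI. apply CSeries_sums. set (L := Clog (z / 2)).
  apply sums_ext with (fun k => (Cexp (nu * L) * clifford_term nu (Cexp (2 * L)) k)%C);
    [|apply sums_scal, clifford_sums].
  intros k. unfold clifford_term. rewrite Cexp_pow.
  replace ((nu + 2 * INR k) * L)%C with (nu * L + INR k * (2 * L))%C by ring.
  rewrite Cexp_plus, RtoC_inv by apply INR_fact_neq_0. field. apply RtoC_INR_fact_neq_0.
Qed.

Lemma BesselJ_clifford nu w :
  BesselJ_log nu w =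
  (Cexp (nu * (w - ln 2)) * clifford nu (- Cexp (2 * (w - ln 2))))%C.
Proof.
  unfold BesselJ_log. apply CSeries_sums. set (L := (w - ln 2)%C).
  apply sums_ext with (fun k => (Cexp (nu * L) * clifford_term nu (- Cexp (2 * L)) k)%C);
    [|apply sums_scal, clifford_sums].
  intros k. unfold clifford_term.
  replace (- Cexp (2 * L))%C with ((-1) * Cexp (2 * L))%C by ring.
  rewrite Cpow_mult_l, Cexp_pow.
  replace ((nu + 2 * INR k) * L)%C with (nu * L + INR k * (2 * L))%C by ring.
  rewrite Cexp_plus, RtoC_inv by apply INR_fact_neq_0. field. apply RtoC_INR_fact_neq_0.
Qed.

(** * Products of Bessel functions *)

Fixpoint gbinom (x : C) (n : nat) : C :=
  match n with O => RtoC 1 | S p => ((x - INR p) / INR (S p) * gbinom x p)%C end.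

Lemma gbinom_S x n : (INR (S n) * gbinom x (S n))%C = ((x - INR n) * gbinom x n)%C.
Proof.
  change (gbinom x (S n)) with ((x - INR n) / INR (S n) * gbinom x n)%C. field.
  apply RtoC_neq_0, not_0_INR. lia.
Qed.

(** Multiplying by [n + 1 = j + (n + 1 - j)] reduces the identity to the recursion [gbinom_S] of the
    two factors. *)
Lemma gbinom_Vandermonde x y n :
  psum (fun j => (gbinom y j * gbinom x (n - j))%C) (S n) = gbinom (x + y) n.
Proof.
  induction n; [simpl; ring|].
  assert (N0 : RtoC (INR (S n)) <> RtoC 0) by (apply RtoC_neq_0, not_0_INR; lia).
  assert (A : psum (fun j => (INR j * gbinom y j * gbinom x (S n - j))%C) (S (S n))
     = psum (fun i => ((y - INR i) * gbinom y i * gbinom x (n - i))%C) (S n)).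
  { change (S (S n)) with (1 + S n)%nat. rewrite psum_shift.
    replace (psum _ 1) with (RtoC 0) by (simpl; ring). rewrite Cplus_0_l.
    apply psum_ext. intros i Hi. change (1 + i)%nat with (S i). rewrite gbinom_S. reflexivity. }
  assert (B : psum (fun j => (gbinom y j * (INR (S n - j) * gbinom x (S n - j)))%C) (S (S n))
     = psum (fun i => (gbinom y i * ((x - INR (n - i)) * gbinom x (n - i)))%C) (S n)).
  { change (psum (fun j => (gbinom y j * (INR (S n - j) * gbinom x (S n - j)))%C) (S (S n))) with
      (psum (fun j => (gbinom y j * (INR (S n - j) * gbinom x (S n - j)))%C) (S n)
        + gbinom y (S n) * (INR (S n - S n) * gbinom x (S n - S n)))%C.
    rewrite Nat.sub_diag. change (INR 0) with 0. rewrite Cmult_0_l, Cmult_0_r, Cplus_0_r.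
    apply psum_ext. intros i Hi. replace (S n - i)%nat with (S (n - i)) by lia.
    rewrite gbinom_S. reflexivity. }
  assert (H : (INR (S n) * psum (fun j => (gbinom y j * gbinom x (S n - j))%C) (S (S n)))%C
     = (INR (S n) * gbinom (x + y) (S n))%C).
  { rewrite gbinom_S, <- IHn, <- !psum_scal.
    rewrite (psum_ext _ (fun j => (INR j * gbinom y j * gbinom x (S n - j)
         + gbinom y j * (INR (S n - j) * gbinom x (S n - j)))%C) (S (S n))).
    2: { intros j Hj. rewrite (minus_INR (S n) j), RtoC_minus by lia. ring. }
    rewrite psum_plus, A, B, <- psum_plus. apply psum_ext. intros i Hi.
    rewrite minus_INR, RtoC_minus by lia. ring. }
  transitivity (/ INR (S n) * (INR (S n) * psum (fun j => (gbinom y j * gbinom x (S n - j))%C) (S (S n))))%C.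
  - field. exact N0.
  - rewrite H. field. exact N0.
Qed.

Lemma RGamma_gbinom x n :
  (RGamma (x - INR n + 1) * RtoC (/ INR (fact n)))%C = (gbinom x n * RGamma (x + 1))%C.
Proof.
  induction n.
  - simpl. replace (x - 0 + 1)%C with (x + 1)%C by ring. rewrite Rinv_1. ring.
  - rewrite (RGamma_rec (x - INR (S n) + 1)%C).
    replace (x - INR (S n) + 1)%C with (x - INR n)%C by (rewrite S_INR, RtoC_plus; ring).
    change (gbinom x (S n)) with ((x - INR n) / INR (S n) * gbinom x n)%C.
    assert (N0 : RtoC (INR (S n)) <> RtoC 0) by (apply RtoC_neq_0, not_0_INR; lia).
    transitivity ((x - INR n) / INR (S n) * (gbinom x n * RGamma (x + 1)))%C; [|ring].
    rewrite <- IHn, fact_simpl, mult_INR, Rinv_mult, RtoC_mult, !RtoC_inv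
      by (try apply INR_fact_neq_0; apply not_0_INR; lia).
    field. split; [apply RtoC_INR_fact_neq_0|exact N0].
Qed.

(** The factor [gamma_int] stands for [Gamma (a + M + 2 n + 1)], in the form in which it comes out of
    the radial integration. *)
Definition clifford_product_coef (a : C) (M n : nat) : C :=
  (RGamma (a + INR n + 1) * RGamma (a + INR M + INR n + 1)
   * RtoC (/ INR (fact n) * / INR (fact (M + n))) * gamma_int (a + INR M + 2 * INR n) 1)%C.

(** In the Cauchy product, [RGamma_gbinom] extracts the factors [RGamma (a + n + 1)] and
    [RGamma (M + n + 1)]; what is left is the sum of [gbinom_Vandermonde]. *)
Lemma clifford_product a M u : -1 < Re a ->
  sums (fun n => (clifford_product_coef a M n * u ^ n)%C) (clifford a u * clifford (INR M) u)%C.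
Proof.
  intros Ha.
  destruct (clifford_estimates a 1) as [K1 [_ H1]]; [lra|].
  destruct (clifford_estimates (INR M) 1) as [K2 [_ H2]]; [lra|].
  destruct (H1 u) as [_ [_ [_ [_ [m1 [A1 B1]]]]]]. destruct (H2 u) as [_ [_ [_ [_ [m2 [A2 B2]]]]]].
  assert (P := sums_Cauchy_product _ _ _ _ _ _ _ _ A1 B1 A2 B2 (clifford_sums a u) (clifford_sums (INR M) u)).
  apply sums_ext with (2 := P). intros n. clear P A1 B1 A2 B2 H1 H2.
  set (G := (RGamma (a + INR n + 1) * RGamma (INR M + INR n + 1) * u ^ n)%C).
  transitivity (G * gbinom ((a + INR n) + (INR M + INR n)) n)%C.
  - rewrite <- gbinom_Vandermonde, <- psum_scal. apply psum_ext. intros j Hj.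
    assert (E1 := RGamma_gbinom (a + INR n)%C (n - j)).
    assert (E2 := RGamma_gbinom (INR M + INR n)%C j).
    replace (a + INR n - INR (n - j) + 1)%C with (a + INR j + 1)%C in E1
      by (rewrite minus_INR, RtoC_minus by lia; ring).
    replace (INR M + INR n - INR j + 1)%C with (INR M + INR (n - j) + 1)%C in E2
      by (rewrite minus_INR, RtoC_minus by lia; ring).
    unfold clifford_term, G.
    transitivity ((RGamma (a + INR j + 1) * RtoC (/ INR (fact (n - j))))
      * (RGamma (INR M + INR (n - j) + 1) * RtoC (/ INR (fact j))) * (u ^ j * u ^ (n - j)))%C; [ring|].
    rewrite E1, E2, <- Cpow_add_r. replace (j + (n - j))%nat with n by lia. ring.
  - unfold G, clifford_product_coef. set (x := (a + INR n + (INR M + INR n))%C).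
    assert (E := RGamma_gbinom x n).
    replace (x - INR n + 1)%C with (a + INR M + INR n + 1)%C in E by (unfold x; ring).
    replace (a + INR M + 2 * INR n)%C with x by (unfold x; ring).
    assert (Hx : -1 < Re x).
    { change (-1 < Re a + INR n + (INR M + INR n)). assert (T := pos_INR n). assert (T' := pos_INR M). lra. }
    assert (EG := RGamma_gamma_int x Hx).
    replace (INR M + INR n + 1)%C with (INR (M + n) + 1)%C by (rewrite plus_INR, RtoC_plus; ring).
    rewrite RGamma_nat.
    transitivity (RGamma (a + INR n + 1) * RtoC (/ INR (fact (M + n))) * u ^ n
       * (gbinom x n * (RGamma (x + 1) * gamma_int x 1)))%C; [rewrite EG; ring|].
    rewrite (Cmult_assoc (gbinom x n)), <- E, RtoC_mult. ring.
Qed.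

(** * Integrals in polar coordinates *)

(** A strengthening of [is_polar_integral] that is stable under linear combinations: continuity
    makes the modulus of a sum locally integrable, domination makes it integrable. *)
Definition polar_regular (f : R -> R -> C) (l : C) : Prop :=
  exists G : R -> C,
    (forall phi, (forall x, 0 < x -> Ccont (fun x => f x phi) x) /\
       (exists B b, is_Rhalf B b /\ forall x, 0 < x -> Cmod (f x phi) <= B x) /\
       is_Chalf (fun x => f x phi) (G phi)) /\
    is_CInt G 0 (2 * PI) l.

Lemma polar_regular_is_polar_integral f l : polar_regular f l -> is_polar_integral f l.
Proof.
  intros [G [H1 H2]]. exists G. split; [|exact H2]. intros phi _.
  destruct (H1 phi) as [Hc [[B [b [HB HfB]]] HG]]. split; [|exact HG].
  destruct (is_Rhalf_dominated (fun x => Cmod (f x phi)) B b) as [l' Hl'].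
  - intros x Hx. apply (Ccont_Cmod (fun x => f x phi)), Hc, Hx.
  - exact HB.
  - intros x Hx. rewrite Rabs_pos_eq by apply Cmod_ge_0. auto.
  - exists l'. exact Hl'.
Qed.

Lemma polar_regular_ext f g l : (forall x phi, f x phi = g x phi) -> polar_regular f l -> polar_regular g l.
Proof.
  intros E [G [H1 H2]]. exists G. split; [|exact H2]. intros phi.
  destruct (H1 phi) as [Hc [[B [b [HB HfB]]] HG]]. split; [|split].
  - intros x Hx. apply Ccont_ext with (fun x => f x phi); auto.
  - exists B, b. split; [exact HB|]. intros x Hx. rewrite <- E. auto.
  - apply (is_half_ext C_R_CompleteNormedModule) with (fun x => f x phi); auto.
Qed.

Lemma polar_regular_scal c f l : polar_regular f l -> polar_regular (fun x phi => (c * f x phi)%C) (c * l)%C.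
Proof.
  intros [G [H1 H2]]. exists (fun phi => (c * G phi)%C). split; [|apply is_CInt_scal, H2]. intros phi.
  destruct (H1 phi) as [Hc [[B [b [HB HfB]]] HG]]. split; [|split].
  - intros x Hx. apply Ccont_mult; [apply Ccont_const|apply Hc, Hx].
  - exists (fun x => Cmod c * B x), (Cmod c * b). split; [apply is_Rhalf_scal, HB|].
    intros x Hx. rewrite Cmod_mult. apply Rmult_le_compat_l; [apply Cmod_ge_0|auto].
  - apply is_Chalf_scal, HG.
Qed.

Lemma polar_regular_plus f g l m : polar_regular f l -> polar_regular g m ->
  polar_regular (fun x phi => (f x phi + g x phi)%C) (l + m)%C.
Proof.
  intros [G [H1 H2]] [G' [H1' H2']]. exists (fun phi => (G phi + G' phi)%C).
  split; [|apply is_CInt_plus; assumption]. intros phi.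
  destruct (H1 phi) as [Hc [[B [b [HB HfB]]] HG]].
  destruct (H1' phi) as [Hc' [[B' [b' [HB' HfB']]] HG']]. split; [|split].
  - intros x Hx. apply Ccont_plus; auto.
  - exists (fun x => B x + B' x), (b + b'). split; [apply is_Rhalf_plus; auto|].
    intros x Hx. eapply Rle_trans; [apply Cmod_triangle|]. specialize (HfB x Hx). specialize (HfB' x Hx). lra.
  - apply is_Chalf_plus; auto.
Qed.

Lemma polar_regular_psum (f : nat -> R -> R -> C) (l : nat -> C) n :
  (forall k, polar_regular (f k) (l k)) ->
  polar_regular (fun x phi => psum (fun k => f k x phi) n) (psum l n).
Proof.
  intros H. induction n; simpl.
  - assert (T := polar_regular_scal (RtoC 0) _ _ (H O)). rewrite Cmult_0_l in T.
    apply polar_regular_ext with (2 := T). intros. ring.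
  - apply polar_regular_plus; auto.
Qed.

Lemma Cexp_2_pi_nat n : Cexp (Ci * RtoC (INR n * (2 * PI)))%C = RtoC 1.
Proof.
  replace (Ci * RtoC (INR n * (2 * PI)))%C with (INR n * (Ci * RtoC (2 * PI)))%C
    by (rewrite !RtoC_mult; ring).
  rewrite <- Cexp_pow.
  assert (E : Cexp (Ci * RtoC (2 * PI))%C = RtoC 1).
  { rewrite Cexp_pair.
    replace (Re (Ci * RtoC (2 * PI))%C) with 0 by (unfold Re; simpl; ring).
    replace (Im (Ci * RtoC (2 * PI))%C) with (2 * PI) by (unfold Im; simpl; ring).
    rewrite exp_0, cos_2PI, sin_2PI. apply injective_projections; simpl; ring. }
  rewrite E. apply Cpow_1_l.
Qed.

Lemma Cexp_2_pi_int k : Cexp (Ci * RtoC (IZR k * (2 * PI)))%C = RtoC 1.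
Proof.
  destruct (Z.le_ge_cases 0 k) as [H|H].
  - rewrite <- (Z2Nat.id k H), <- INR_IZR_INZ. apply Cexp_2_pi_nat.
  - replace k with (- Z.of_nat (Z.to_nat (- k)))%Z by lia.
    rewrite opp_IZR, <- INR_IZR_INZ.
    replace (Ci * RtoC (- INR (Z.to_nat (- k)) * (2 * PI)))%C
      with (- (Ci * RtoC (INR (Z.to_nat (- k)) * (2 * PI))))%C
      by (rewrite !RtoC_mult, RtoC_opp; ring).
    rewrite Cexp_opp, Cexp_2_pi_nat. field.
Qed.

Lemma circle_integral k :
  is_CInt (fun phi => Cexp (Ci * RtoC (IZR k * phi))%C) 0 (2 * PI)
    (if Z.eqb k 0 then RtoC (2 * PI) else RtoC 0).
Proof.
  assert (HPI := PI_RGT_0).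
  assert (D : forall x, Cder (fun phi => Cexp (Ci * RtoC (IZR k * phi))%C) x
                     (Ci * RtoC (IZR k) * Cexp (Ci * RtoC (IZR k * x)))%C).
  { intros x. apply Cder_exp, Cder_scal, Cder_RtoC.
    replace (IZR k) with (IZR k * 1) at 2 by ring.
    apply (is_derive_scal (fun x => x) x (IZR k) 1). exact (@is_derive_id R_AbsRing x). }
  destruct (Z.eqb_spec k 0) as [->|Hk].
  - assert (H : is_CInt (fun phi => RtoC 1) 0 (2 * PI) (RtoC (2 * PI) - RtoC 0)%C).
    { apply (CInt_derive (fun phi => RtoC phi)); [lra| |].
      - intros x _. apply Cder_RtoC. exact (@is_derive_id R_AbsRing x).
      - intros x _. apply Ccont_const. }
    replace (RtoC (2 * PI)) with (RtoC (2 * PI) - RtoC 0)%C by ring.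
    apply (@is_RInt_ext C_R_CompleteNormedModule) with (2 := H). intros x _.
    rewrite Rmult_0_l, Cmult_0_r, Cexp_0. reflexivity.
  - assert (Hk0 : RtoC (IZR k) <> RtoC 0) by (apply RtoC_neq_0; intros E; apply eq_IZR in E; auto).
    assert (H : is_CInt (fun phi => Cexp (Ci * RtoC (IZR k * phi))%C) 0 (2 * PI)
      (/ (Ci * RtoC (IZR k)) * Cexp (Ci * RtoC (IZR k * (2 * PI))) - / (Ci * RtoC (IZR k)) * Cexp (Ci * RtoC (IZR k * 0)))%C).
    { apply (CInt_derive (fun phi => (/ (Ci * RtoC (IZR k)) * Cexp (Ci * RtoC (IZR k * phi)))%C)); [lra| |].
      - intros x _.
        assert (T := Cder_scal (/ (Ci * RtoC (IZR k)))%C _ _ _ (D x)).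
        replace (/ (Ci * IZR k) * (Ci * IZR k * Cexp (Ci * (IZR k * x)%R)))%C
          with (Cexp (Ci * (IZR k * x)%R))%C in T; [exact T|].
        field. split; [exact Hk0|apply Ci_nz].
      - intros x _. eapply Cder_Ccont, D. }
    rewrite Cexp_2_pi_int, Rmult_0_r, Cmult_0_r, Cexp_0 in H.
    replace (/ (Ci * IZR k) * 1 - / (Ci * IZR k) * 1)%C with (RtoC 0) in H by ring. exact H.
Qed.

Lemma polar_regular_term k s p : -1 < Re s -> 0 < Re p ->
  polar_regular (fun x phi => (Cexp (Ci * RtoC (IZR k * phi)) * gamma_kernel s p x)%C)
    (if Z.eqb k 0 then 2 * PI * gamma_int s p else RtoC 0)%C.
Proof.
  intros Hs Hp. exists (fun phi => (gamma_int s p * Cexp (Ci * RtoC (IZR k * phi)))%C). split.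
  - intros phi. split; [|split].
    + intros x Hx. apply Ccont_mult; [apply Ccont_const|apply Ccont_gamma_kernel, Hx].
    + destruct (ex_Rhalf_gamma (Re s) (Re p) Hs Hp) as [b Hb].
      exists (fun x => exp (Re s * ln x - Re p * x)), b. split; [exact Hb|]. intros x Hx.
      rewrite Cmod_mult, Cmod_gamma_kernel, Cmod_Cexp.
      replace (Re (Ci * RtoC (IZR k * phi))%C) with 0 by (unfold Re; simpl; ring).
      rewrite exp_0. lra.
    + assert (T := is_Chalf_scal (Cexp (Ci * RtoC (IZR k * phi))%C) _ _ (gamma_int_correct s p Hs Hp)).
      replace (gamma_int s p * Cexp (Ci * (IZR k * phi)%R))%C
        with (Cexp (Ci * (IZR k * phi)%R) * gamma_int s p)%C by ring. exact T.
  - assert (T := is_CInt_scal (gamma_int s p) _ _ _ _ (circle_integral k)).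
    destruct (Z.eqb k 0); [|rewrite Cmult_0_r in T; exact T].
    replace (2 * PI * gamma_int s p)%C with (gamma_int s p * RtoC (2 * PI))%C
      by (rewrite !RtoC_mult; ring). exact T.
Qed.

(** [is_half_approx] applies to [f] and to its modulus at each angle; as the resulting rate does not
    depend on the angle, the inner integrals converge uniformly in [phi]. *)
Lemma polar_integral_approx f (fn : nat -> R -> R -> C) (ln : nat -> C) l (e : nat -> R) (B : R -> R) b :
  (forall n, is_polar_integral (fn n) (ln n)) ->
  is_Rhalf B b -> (forall n, 0 <= e n) -> rcvg e 0 ->
  (forall n x phi, 0 < x -> 0 <= phi <= 2 * PI -> Cmod (f x phi - fn n x phi)%C <= e n * B x) ->
  cvg ln l -> is_polar_integral f l.
Proof.
  intros Hfn HB He He0 Happ Hl.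
  assert (HPI := PI_RGT_0).
  set (Gn := fun n => proj1_sig (constructive_indefinite_description _ (Hfn n))).
  assert (HGn := fun n => proj2_sig (constructive_indefinite_description _ (Hfn n))).
  change (forall n, (forall phi, 0 <= phi <= 2 * PI -> is_int_half_line (fun x => fn n x phi) (Gn n phi))
    /\ is_CInt (Gn n) 0 (2 * PI) (ln n)) in HGn.
  set (G := fun phi => @RInt_gen C_R_CompleteNormedModule (fun x => f x phi) (at_right 0) (Rbar_locally p_infty)).
  assert (HG : forall phi, 0 <= phi <= 2 * PI -> is_Chalf (fun x => f x phi) (G phi) /\
     forall n, Cmod (G phi - Gn n phi)%C <= e n * b).
  { intros phi Hphi.
    destruct (is_half_approx C_R_CompleteNormedModule (fun x => f x phi) (fun n x => fn n x phi)
      (fun n => Gn n phi) e B b) as [I [HI1 HI2]]; auto.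
    - intros n. destruct (HGn n) as [H _]. destruct (H phi Hphi) as [_ H']. exact H'.
    - intros n x Hx. change (@norm R_AbsRing C_R_NormedModule (f x phi - fn n x phi)%C <= e n * B x).
      rewrite norm_C_R. auto.
    - assert (E : G phi = I).
      { apply (is_Chalf_unique (fun x => f x phi)); [|exact HI1].
        apply (@RInt_gen_correct C_R_CompleteNormedModule (at_right 0) (Rbar_locally p_infty));
          [apply Proper_StrongProper, _|apply Proper_StrongProper, _|]. exists I. exact HI1. }
      rewrite E. split; [exact HI1|]. intros n. specialize (HI2 n).
      change (@norm R_AbsRing C_R_NormedModule (I - Gn n phi)%C <= e n * b) in HI2.
      rewrite norm_C_R in HI2. exact HI2. }
  exists G. split.
  - intros phi Hphi. split; [|apply HG, Hphi].
    assert (A : forall n, exists I, is_Rhalf (fun x => Cmod (fn n x phi)) I).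
    { intros n. destruct (HGn n) as [H _]. destruct (H phi Hphi) as [[I HI] _]. exists I. exact HI. }
    set (In := fun n => proj1_sig (constructive_indefinite_description _ (A n))).
    destruct (is_half_approx R_CompleteNormedModule (fun x => Cmod (f x phi)) (fun n x => Cmod (fn n x phi))
      In e B b) as [I [HI _]]; auto.
    + intros n. apply (proj2_sig (constructive_indefinite_description _ (A n))).
    + intros n x Hx. change (Rabs (Cmod (f x phi) - Cmod (fn n x phi)) <= e n * B x).
      eapply Rle_trans; [|apply (Happ n x phi Hx Hphi)].
      apply Rabs_le. split.
      * assert (T := Cmod_rev_tri (fn n x phi) (f x phi)). rewrite Cmod_minus_sym in T. lra.
      * apply Cmod_rev_tri.
    + exists I. exact HI.
  - destruct (is_RInt_uniform_limit C_R_CompleteNormedModule G Gn 0 (2 * PI) ln (fun n => b * e n))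
      as [L [HL1 HL2]]; [lra|apply HGn| | |].
    + intros n t Ht. change (@norm R_AbsRing C_R_NormedModule (G t - Gn n t)%C <= b * e n).
      rewrite norm_C_R, Rmult_comm. apply HG, Ht.
    + intros eps Heps. destruct (small_factor b eps Heps) as [d [Hd Sd]]. destruct (He0 d Hd) as [N HN].
      exists N. intros n Hn. specialize (HN n Hn). specialize (He n).
      rewrite Rminus_0_r, Rabs_pos_eq in HN by apply He. apply Sd. lra.
    + rewrite <- (cvg_unique ln L l); [exact HL2|apply cvg_filterlim, HL1|exact Hl].
Qed.

(** * The product of two Bessel functions in polar coordinates *)

(** The squared modulus of [4 pi sqrt z / 2] is [kappa * x]. *)
Definition kappa : R := 4 * PI ^ 2.

Lemma kappa_pos : 0 < kappa.
Proof. unfold kappa. assert (T := PI_RGT_0). assert (T2 := pow_lt PI 2 T). lra. Qed.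

(** The common shape of [J2 mu m], where [a = - 2 mu] and [m = 2 M], and of its truncations. *)
Definition twist (a : C) (M : nat) (F G : C -> C) (x phi : R) : C :=
  (Cexp (a * RtoC (ln (kappa * x))) * Cexp (- (INR M * (Ci * RtoC phi)))
   * F (RtoC (- (kappa * x)) * Cexp (Ci * RtoC phi))
   * G (RtoC (- (kappa * x)) * Cexp (- (Ci * RtoC phi))))%C.

Definition bessel_pair (a : C) (M : nat) : R -> R -> C :=
  twist a M (clifford (a - INR M)) (clifford (a + INR M)).

(** The first series gets [M] more terms than the second, so that the diagonal [j = k + M] meets
    exactly the [k < n]. *)
Definition bessel_pair_trunc (a : C) (M n : nat) : R -> R -> C :=
  twist a M (fun u => psum (clifford_term (a - INR M) u) (n + M))
            (fun u => psum (clifford_term (a + INR M) u) n).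

(** With [W = log (y / 2)], one has [exp (2 W) = kappa z], [W + conj W = ln (kappa x)] and
    [exp (W - conj W) = e^(i phi)]; the branch of the logarithm only enters through these, which do not
    depend on it. Changing the sign of [m] exchanges [z] and [conj z]. *)
Lemma J2_bessel_pair (mu : C) (M : nat) (x phi : R) : 0 < x ->
  let y := (4 * PI * Csqrt (x * Cexp (Ci * phi)))%C in
  J2 mu (2 * Z.of_nat M) y = bessel_pair (- (2 * mu)) M x phi /\
  J2 mu (- (2 * Z.of_nat M)) y = bessel_pair (- (2 * mu)) M x (- phi).
Proof.
  intros Hx y. assert (HPI := PI_RGT_0).
  set (om := Cexp (Ci * RtoC phi)%C).
  assert (Om1 : Cmod om = 1).
  { unfold om. rewrite Cmod_Cexp. replace (Re (Ci * RtoC phi)%C) with 0 by (unfold Re; simpl; ring).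
    apply exp_0. }
  set (z := (RtoC x * om)%C).
  assert (Hz : z <> RtoC 0) by (apply Cmult_neq_0; [apply RtoC_neq_0; lra|apply Cexp_neq_0]).
  assert (Mz : Cmod z = x) by (unfold z; rewrite Cmod_mult, Om1, Cmod_R, Rabs_pos_eq; lra).
  assert (Sq : (Csqrt z * Csqrt z)%C = z).
  { unfold Csqrt. rewrite <- Cexp_plus. replace (Clog z / 2 + Clog z / 2)%C with (Clog z) by field.
    apply Cexp_Clog, Hz. }
  assert (Ey : (y * y)%C = (RtoC (4 * kappa) * z)%C).
  { unfold y. fold om. fold z. transitivity (16 * PI * PI * (Csqrt z * Csqrt z))%C; [ring|].
    rewrite Sq. unfold kappa. rewrite !RtoC_mult, RtoC_pow. ring. }
  assert (Hk := kappa_pos).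
  assert (Hy : y <> RtoC 0).
  { intros E. rewrite E in Ey. apply (Cmult_neq_0 (RtoC (4 * kappa)) z); auto.
    - apply RtoC_neq_0. lra.
    - rewrite <- Ey. ring. }
  set (W := (Clog y - RtoC (ln 2))%C).
  assert (EW2 : Cexp (2 * W)%C = (RtoC (kappa * x) * om)%C).
  { unfold W. replace (2 * (Clog y - RtoC (ln 2)))%C
      with (Clog y + Clog y + - (RtoC (ln 2) + RtoC (ln 2)))%C by ring.
    rewrite !Cexp_plus, Cexp_opp, Cexp_plus, (Cexp_Clog y Hy), Ey, Cexp_RtoC, exp_ln by lra.
    unfold z. rewrite !RtoC_mult. field. }
  assert (Ecw : (Cconj (Clog y) - RtoC (ln 2))%C = Cconj W).
  { unfold W. apply injective_projections; simpl; ring. }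
  assert (Ecom : Cconj om = Cexp (- (Ci * RtoC phi))%C).
  { unfold om. rewrite Cconj_Cexp. f_equal. apply injective_projections; simpl; ring. }
  assert (EcW2 : Cexp (2 * Cconj W)%C = (RtoC (kappa * x) * Cconj om)%C).
  { replace (2 * Cconj W)%C with (Cconj (2 * W)%C) by (apply injective_projections; simpl; ring).
    rewrite <- Cconj_Cexp, EW2. apply injective_projections; simpl; ring. }
  assert (Sum : (W + Cconj W)%C = RtoC (ln (kappa * x))).
  { assert (E : Cmod (Cexp (2 * W)%C) = kappa * x).
    { rewrite EW2, Cmod_mult, Om1, Cmod_R, Rabs_pos_eq; nra. }
    rewrite Cmod_Cexp in E.
    assert (EL : ln (kappa * x) = Re (2 * W)%C) by (rewrite <- E; apply ln_exp).
    rewrite EL. apply injective_projections; simpl; ring. }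
  assert (Diff : Cexp (W - Cconj W)%C = om).
  { assert (E : (Cexp (W + Cconj W) * Cexp (W - Cconj W))%C = Cexp (2 * W)%C).
    { rewrite <- Cexp_plus. f_equal. ring. }
    rewrite Sum, Cexp_RtoC, exp_ln, EW2 in E by nra.
    assert (N0 : RtoC (kappa * x) <> RtoC 0) by (apply RtoC_neq_0; nra).
    transitivity (/ RtoC (kappa * x) * (RtoC (kappa * x) * Cexp (W - Cconj W)))%C; [field; exact N0|].
    rewrite E. field. exact N0. }
  assert (Pw : forall n, Cexp (INR n * (W - Cconj W))%C = Cexp (INR n * (Ci * RtoC phi))%C).
  { intros n. rewrite <- !Cexp_pow, Diff. reflexivity. }
  assert (N1 : (- Cexp (2 * W))%C = (RtoC (- (kappa * x)) * om)%C) by (rewrite EW2, RtoC_opp; ring).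
  assert (N2 : (- Cexp (2 * Cconj W))%C = (RtoC (- (kappa * x)) * Cexp (- (Ci * RtoC phi)))%C)
    by (rewrite EcW2, RtoC_opp, Ecom; ring).
  assert (Hm : (RtoC (IZR (2 * Z.of_nat M)) / 2)%C = RtoC (INR M)).
  { rewrite mult_IZR, <- INR_IZR_INZ, RtoC_mult. field. }
  assert (Hm' : (RtoC (IZR (- (2 * Z.of_nat M))) / 2)%C = (- RtoC (INR M))%C).
  { rewrite opp_IZR, RtoC_opp, mult_IZR, <- INR_IZR_INZ, RtoC_mult. field. }
  set (a := (- (2 * mu))%C).
  split; unfold J2, bessel_pair, twist; rewrite !BesselJ_clifford; fold a;
    rewrite ?Hm, ?Hm', Ecw; fold W; rewrite N1, N2, <- Sum.
  - fold om.
    assert (E : (Cexp ((a - INR M) * W) * Cexp ((a + INR M) * Cconj W))%C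
       = (Cexp (a * (W + Cconj W)) * Cexp (- (INR M * (Ci * RtoC phi))))%C).
    { rewrite (Cexp_opp (INR M * (Ci * RtoC phi))%C), <- Pw, <- Cexp_opp, <- !Cexp_plus. f_equal. ring. }
    rewrite <- E. ring.
  - replace (Ci * RtoC (- phi))%C with (- (Ci * RtoC phi))%C by (rewrite RtoC_opp; ring).
    replace (- - (Ci * RtoC phi))%C with (Ci * RtoC phi)%C by ring. fold om.
    assert (E : (Cexp ((a + INR M) * W) * Cexp ((a - INR M) * Cconj W))%C
       = (Cexp (a * (W + Cconj W)) * Cexp (- (INR M * - (Ci * RtoC phi))))%C).
    { replace (- (INR M * - (Ci * RtoC phi)))%C with (INR M * (Ci * RtoC phi))%C by ring.
      rewrite <- Pw, <- !Cexp_plus. f_equal. ring. }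
    replace (a - - INR M)%C with (a + INR M)%C by ring.
    replace (a + - INR M)%C with (a - INR M)%C by ring.
    rewrite <- E. ring.
Qed.

(** * Integrals of the truncations *)

Lemma psum_swap (A : nat -> nat -> C) n m :
  psum (fun j => psum (fun k => A j k) m) n = psum (fun k => psum (fun j => A j k) n) m.
Proof.
  induction n; simpl.
  - symmetry. apply psum_zero. reflexivity.
  - rewrite IHn. symmetry. apply (psum_plus (fun k => psum (fun j => A j k) n) (fun k => A n k)).
Qed.

Definition pair_coef (a : C) (M j k : nat) : C :=
  (RGamma (a - INR M + INR j + 1) * RGamma (a + INR M + INR k + 1)
   * RtoC (/ INR (fact j) * / INR (fact k)) * RtoC (- kappa) ^ (j + k) * Cexp (a * RtoC (ln kappa)))%C.

Lemma gamma_kernel_nat s p n x : 0 < x ->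
  gamma_kernel (s + INR n) p x = (RtoC x ^ n * gamma_kernel s p x)%C.
Proof.
  intros Hx. induction n; [simpl; rewrite Cplus_0_r; ring|].
  rewrite S_INR, RtoC_plus, Cplus_assoc, (gamma_kernel_S _ p x Hx), IHn. simpl. ring.
Qed.

Definition pair_poly (a : C) (M n : nat) (sg : Z) (p : C) (x phi : R) : C :=
  psum (fun j => psum (fun k => (pair_coef a M j k *
     (Cexp (Ci * RtoC (IZR (sg * (Z.of_nat j - Z.of_nat k - Z.of_nat M)) * phi))
      * gamma_kernel (a + INR (j + k)) p x))%C) n) (n + M).

Lemma pair_poly_spec (a : C) (M n : nat) (sg : Z) (p : C) (x phi : R) : 0 < x ->
  (bessel_pair_trunc a M n x (IZR sg * phi) * Cexp (- (p * RtoC x)))%C =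
  pair_poly a M n sg p x phi.
Proof.
  intros Hx. assert (Hk := kappa_pos).
  unfold bessel_pair_trunc, twist, pair_poly. cbv beta.
  set (om := Cexp (Ci * RtoC (IZR sg * phi))%C).
  assert (Ei : Cexp (- (Ci * RtoC (IZR sg * phi)))%C = (/ om)%C) by apply Cexp_opp.
  assert (O0 : om <> RtoC 0) by apply Cexp_neq_0.
  rewrite Ei.
  set (u := (RtoC (- (kappa * x)) * om)%C). set (v := (RtoC (- (kappa * x)) * / om)%C).
  set (H := (Cexp (a * RtoC (ln (kappa * x))) * Cexp (- (INR M * (Ci * RtoC (IZR sg * phi)))))%C).
  transitivity (psum (fun j => psum (fun k =>
     (H * Cexp (- (p * RtoC x)) * (clifford_term (a - INR M) u j * clifford_term (a + INR M) v k))%C) n) (n + M)%nat).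
  - symmetry.
    transitivity (psum (fun j => (H * Cexp (- (p * RtoC x)) * psum (clifford_term (a + INR M) v) n) *
        clifford_term (a - INR M) u j)%C (n + M)).
    + apply psum_ext. intros j _. rewrite psum_scal, psum_scal. ring.
    + rewrite psum_scal. ring.
  - apply psum_ext. intros j _. apply psum_ext. intros k _.
    unfold pair_coef, clifford_term. rewrite (gamma_kernel_nat a p (j + k) x Hx), gamma_kernel_split.
    assert (EH : H = (Cexp (a * RtoC (ln kappa)) * Cexp (a * RtoC (ln x)) * / om ^ M)%C).
    { unfold H, om. rewrite Cexp_pow, <- Cexp_opp, <- !Cexp_plus, ln_mult, RtoC_plus by auto.
      f_equal. ring. }
    assert (EO : Cexp (Ci * RtoC (IZR (sg * (Z.of_nat j - Z.of_nat k - Z.of_nat M)) * phi))%C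
       = (om ^ j * / om ^ k * / om ^ M)%C).
    { unfold om. rewrite !Cexp_pow, <- !Cexp_opp, <- !Cexp_plus. f_equal.
      rewrite mult_IZR, !minus_IZR, <- !INR_IZR_INZ, !RtoC_mult, !RtoC_minus. ring. }
    rewrite EH, EO. unfold u, v.
    replace (RtoC (- (kappa * x))) with (RtoC (- kappa) * RtoC x)%C
      by (rewrite <- RtoC_mult; f_equal; ring).
    rewrite !Cpow_mult_l, Cpow_inv, !Cpow_add_r, RtoC_mult by exact O0. ring.
Qed.

(** Only the terms with [j = k + M] survive the integration over the angle. *)
Lemma polar_regular_pair_poly (a : C) (M n : nat) (sg : Z) (p : C) :
  -1 < Re a -> 0 < Re p -> sg <> 0%Z ->
  polar_regular (pair_poly a M n sg p)
    (psum (fun k => (pair_coef a M (k + M) k * (2 * PI * gamma_int (a + INR (k + M + k)) p))%C) n).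
Proof.
  intros Ha Hp Hsg.
  set (l := fun j k => (pair_coef a M j k *
      (if Z.eqb (sg * (Z.of_nat j - Z.of_nat k - Z.of_nat M)) 0
       then 2 * PI * gamma_int (a + INR (j + k)) p else RtoC 0))%C).
  replace (psum (fun k => (pair_coef a M (k + M) k * (2 * PI * gamma_int (a + INR (k + M + k)) p))%C) n)
    with (psum (fun j => psum (fun k => l j k) n) (n + M)).
  - apply (polar_regular_psum (fun j x phi => psum (fun k => (pair_coef a M j k *
     (Cexp (Ci * RtoC (IZR (sg * (Z.of_nat j - Z.of_nat k - Z.of_nat M)) * phi))
      * gamma_kernel (a + INR (j + k)) p x))%C) n) (fun j => psum (fun k => l j k) n)).
    intros j.
    apply (polar_regular_psum (fun k x phi => (pair_coef a M j k *
     (Cexp (Ci * RtoC (IZR (sg * (Z.of_nat j - Z.of_nat k - Z.of_nat M)) * phi))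
      * gamma_kernel (a + INR (j + k)) p x))%C) (fun k => l j k)).
    intros k. unfold l. apply polar_regular_scal, polar_regular_term; [|exact Hp].
    change (-1 < Re a + INR (j + k)). assert (T := pos_INR (j + k)). lra.
  - rewrite psum_swap. apply psum_ext. intros k Hk.
    rewrite (psum_ext _ (fun j => if Nat.eqb j (k + M)
       then (pair_coef a M (k + M) k * (2 * PI * gamma_int (a + INR (k + M + k)) p))%C else RtoC 0)).
    + rewrite psum_indicator. destruct (Nat.ltb_spec (k + M) (n + M)); [reflexivity|lia].
    + intros j _. unfold l.
      destruct (Nat.eqb_spec j (k + M)) as [->|Hne].
      * destruct (Z.eqb_spec (sg * (Z.of_nat (k + M) - Z.of_nat k - Z.of_nat M)) 0) as [e|e]; [reflexivity|].
        exfalso. apply e. replace (Z.of_nat (k + M) - Z.of_nat k - Z.of_nat M)%Z with 0%Z by lia. lia.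
      * destruct (Z.eqb_spec (sg * (Z.of_nat j - Z.of_nat k - Z.of_nat M)) 0) as [e|e]; [|ring].
        apply Zmult_integral in e. lia.
Qed.

(** * Generic parameters *)

Lemma Cmod_Ci_phase (r : R) : Cmod (Cexp (Ci * RtoC r))%C = 1.
Proof.
  rewrite Cmod_Cexp. replace (Re (Ci * RtoC r)%C) with 0 by (unfold Re; simpl; ring). apply exp_0.
Qed.

Lemma Cmod_Ci_phase_opp (r : R) : Cmod (Cexp (- (Ci * RtoC r)))%C = 1.
Proof. replace (- (Ci * RtoC r))%C with (Ci * RtoC (- r))%C by (rewrite RtoC_opp; ring). apply Cmod_Ci_phase. Qed.

Lemma Cmod_twist_phase (M : nat) (phi : R) : Cmod (Cexp (- (INR M * (Ci * RtoC phi))))%C = 1.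
Proof.
  replace (- (INR M * (Ci * RtoC phi)))%C with (- (Ci * RtoC (INR M * phi)))%C
    by (rewrite RtoC_mult; ring). apply Cmod_Ci_phase_opp.
Qed.

Lemma Cmod_kappa_phase x z : 0 < x -> Cmod z = 1 -> Cmod (RtoC (- (kappa * x)) * z)%C = kappa * x.
Proof.
  intros Hx Hz. assert (Hk := kappa_pos).
  rewrite Cmod_mult, Hz, Cmod_R, Rabs_Ropp, Rabs_pos_eq; nra.
Qed.

(** Each factor grows at most like [exp (eps kappa x)]. With [2 eps kappa = Re p / 2], half of the
    decay of [exp (- p x)] is left. *)
Lemma bessel_pair_trunc_error a M p : 0 < Re p -> exists K, 0 <= K /\ forall n x phi, 0 < x ->
  Cmod ((bessel_pair a M x phi - bessel_pair_trunc a M n x phi) * Cexp (- (p * RtoC x)))%C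
  <= (/ 2) ^ n * (K * exp (Re a * ln x - Re p / 2 * x)).
Proof.
  intros Hp. assert (Hk := kappa_pos).
  set (eps := Re p / (4 * kappa)).
  assert (He : 0 < eps) by (apply Rdiv_lt_0_compat; lra).
  destruct (clifford_estimates (a - INR M)%C eps He) as [K1 [HK1 E1]].
  destruct (clifford_estimates (a + INR M)%C eps He) as [K2 [HK2 E2]].
  assert (Hka := exp_pos (Re a * ln kappa)).
  exists (exp (Re a * ln kappa) * (2 * K1 * K2)). split; [apply Rmult_le_pos; nra|].
  intros n x phi Hx.
  unfold bessel_pair, bessel_pair_trunc, twist.
  set (u := (RtoC (- (kappa * x)) * Cexp (Ci * RtoC phi))%C).
  set (v := (RtoC (- (kappa * x)) * Cexp (- (Ci * RtoC phi)))%C).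
  assert (Mu : Cmod u = kappa * x) by (apply Cmod_kappa_phase; [auto|apply Cmod_Ci_phase]).
  assert (Mv : Cmod v = kappa * x) by (apply Cmod_kappa_phase; [auto|apply Cmod_Ci_phase_opp]).
  destruct (E1 u) as [_ [_ [T1 [B1 _]]]]. destruct (E2 v) as [_ [_ [T2 [B2 _]]]].
  rewrite Mu in *. rewrite Mv in *.
  set (Ex := exp (eps * (kappa * x))) in *. assert (HEx : 0 < Ex) by apply exp_pos.
  set (F := clifford (a - INR M) u) in *. set (G := clifford (a + INR M) v) in *.
  set (Fn := psum (clifford_term (a - INR M) u) (n + M)) in *.
  set (Gn := psum (clifford_term (a + INR M) v) n) in *.
  assert (D1 : Cmod (F - Fn)%C <= (/ 2) ^ n * (K1 * Ex)).
  { eapply Rle_trans; [apply T1|]. apply Rmult_le_compat_r; [nra|].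
    rewrite pow_add. assert (P : 0 < (/ 2) ^ n) by (apply pow_lt; lra).
    assert (Q : (/ 2) ^ M <= 1).
    { assert (T := pow_incr (/ 2) 1 M ltac:(lra)). rewrite pow1 in T. exact T. } nra. }
  assert (D2 : Cmod (G - Gn)%C <= (/ 2) ^ n * (K2 * Ex)) by apply T2.
  assert (BG : Cmod G <= K2 * Ex).
  { assert (T := T2 O). simpl in T. rewrite Rmult_1_l in T.
    replace (G - 0)%C with G in T by ring. exact T. }
  assert (BF : Cmod Fn <= K1 * Ex) by apply B1.
  match goal with |- Cmod ?e <= _ => replace e with
    (Cexp (a * RtoC (ln (kappa * x))) * Cexp (- (INR M * (Ci * RtoC phi)))
      * ((F - Fn) * G + Fn * (G - Gn)) * Cexp (- (p * RtoC x)))%C by ring end.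
  rewrite !Cmod_mult, Cmod_twist_phase, !Cmod_Cexp.
  replace (Re (a * RtoC (ln (kappa * x)))%C) with (Re a * ln kappa + Re a * ln x)
    by (rewrite ln_mult by auto; unfold Re; simpl; ring).
  replace (Re (- (p * RtoC x))%C) with (- (Re p * x)) by (unfold Re; simpl; ring).
  assert (Bd : Cmod ((F - Fn) * G + Fn * (G - Gn))%C <= (/ 2) ^ n * (2 * K1 * K2 * (Ex * Ex))).
  { assert (P : 0 < (/ 2) ^ n) by (apply pow_lt; lra).
    assert (T := Cmod_triangle ((F - Fn) * G)%C (Fn * (G - Gn))%C). rewrite !Cmod_mult in T.
    assert (A1 : Cmod (F - Fn)%C * Cmod G <= (/ 2) ^ n * (K1 * Ex) * (K2 * Ex))
      by (apply Rmult_le_compat; auto using Cmod_ge_0).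
    assert (A2 : Cmod Fn * Cmod (G - Gn)%C <= (K1 * Ex) * ((/ 2) ^ n * (K2 * Ex)))
      by (apply Rmult_le_compat; auto using Cmod_ge_0).
    lra. }
  assert (EE : Ex * Ex = exp (Re p / 2 * x)).
  { unfold Ex. rewrite <- exp_plus. f_equal. unfold eps. field. lra. }
  rewrite EE in Bd. rewrite Rmult_1_r.
  apply Rle_trans with (exp (Re a * ln kappa + Re a * ln x) *
      ((/ 2) ^ n * (2 * K1 * K2 * exp (Re p / 2 * x))) * exp (- (Re p * x))).
  { apply Rmult_le_compat_r; [left; apply exp_pos|]. apply Rmult_le_compat_l; [left; apply exp_pos|auto]. }
  right. replace (Re a * ln x - Re p / 2 * x) with (Re a * ln x + (Re p / 2 * x + - (Re p * x))) by field.
  rewrite !exp_plus. ring.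
Qed.

Lemma BesselI_div c nu : 0 < Re c ->
  BesselI nu (4 * PI / c)%C =
  (Cexp (nu * (RtoC (ln (2 * PI)) - Clog c)) * clifford nu (Cexp (2 * (RtoC (ln (2 * PI)) - Clog c))))%C.
Proof.
  intros Hc. assert (HPI := PI_RGT_0).
  rewrite BesselI_clifford.
  replace (4 * PI / c / 2)%C with (RtoC (2 * PI) / c)%C
    by (rewrite RtoC_mult; field; apply neq_0_of_Re_pos, Hc).
  rewrite Clog_div by lra. reflexivity.
Qed.

Lemma BesselI_neg_nat M c : 0 < Re c ->
  BesselI (- INR M) (4 * PI / c)%C = BesselI (INR M) (4 * PI / c)%C.
Proof.
  intros Hc. rewrite !BesselI_div by exact Hc. set (L := (RtoC (ln (2 * PI)) - Clog c)%C).
  rewrite clifford_neg_nat, Cexp_pow, Cmult_assoc, <- Cexp_plus. f_equal. f_equal. ring.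
Qed.

(** With [L = log (2 pi c)] and [La = log (2 pi / c)], one has [ln kappa - L = La]: the powers of [kappa]
    from the kernel and those of [2 pi c] from the Gamma integral combine to powers of [2 pi / c], half
    the argument of [I_a] and [I_M]. *)
Lemma cvg_pair_diagonal a M c : -1 < Re a -> 0 < Re c -> Rabs (Carg c) < PI / 2 ->
  cvg (fun n => psum (fun k => (pair_coef a M (k + M) k *
        (2 * PI * gamma_int (a + INR (k + M + k)) (2 * PI * c)))%C) n)
    ((-1) ^ M / c * BesselI a (4 * PI / c) * BesselI (INR M) (4 * PI / c))%C.
Proof.
  intros Ha Hc Harg. assert (HPI := PI_RGT_0). assert (Hk := kappa_pos).
  assert (Hc0 : c <> RtoC 0) by (apply neq_0_of_Re_pos, Hc).
  assert (HP0 : RtoC PI <> RtoC 0) by (apply RtoC_neq_0; lra).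
  set (l2 := ln (2 * PI)). set (L := (RtoC l2 + Clog c)%C). set (La := (RtoC l2 - Clog c)%C).
  assert (EL : Cexp L = (2 * PI * c)%C).
  { unfold L, l2. rewrite Cexp_plus, Cexp_RtoC, exp_ln, Cexp_Clog, RtoC_mult by (auto; lra). reflexivity. }
  assert (Elk : ln kappa = l2 + l2).
  { unfold l2. rewrite <- ln_mult by lra. f_equal. unfold kappa. ring. }
  assert (Ek : RtoC kappa = Cexp (RtoC l2 + RtoC l2)).
  { rewrite <- RtoC_plus, Cexp_RtoC, <- Elk, exp_ln by auto. reflexivity. }
  assert (HL : Rabs (Im L) < PI / 2).
  { unfold L. replace (Im (RtoC l2 + Clog c)%C) with (Carg c) by (unfold Im; simpl; ring). exact Harg. }
  rewrite !BesselI_div by exact Hc. fold l2. fold La.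
  assert (H := clifford_product a M (Cexp (2 * La)) Ha).
  apply (sums_scal ((-1) ^ M / c * Cexp (a * La) * Cexp (INR M * La))%C) in H.
  match goal with |- cvg _ ?v => match type of H with sums _ ?w => replace v with w by ring end end.
  apply sums_ext with (2 := H). intros n. clear H.
  rewrite <- EL, gamma_int_scale; [|change (-1 < Re a + INR (n + M + n)); assert (T := pos_INR (n + M + n)); lra|exact HL].
  unfold pair_coef, clifford_product_coef.
  replace (a - INR M + INR (n + M) + 1)%C with (a + INR n + 1)%C by (rewrite plus_INR, RtoC_plus; ring).
  replace (a + INR (n + M + n))%C with (a + INR M + 2 * INR n)%C by (rewrite !plus_INR, !RtoC_plus; ring).
  assert (ES : (RtoC (- kappa) ^ (n + M + n))%C = ((-1) ^ M * Cexp (INR (n + M + n) * (RtoC l2 + RtoC l2)))%C).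
  { replace (RtoC (- kappa)) with ((-1) * RtoC kappa)%C by (rewrite RtoC_opp; ring).
    rewrite Cpow_mult_l, Ek, Cexp_pow. f_equal.
    replace (n + M + n)%nat with (M + (n + n))%nat by lia. rewrite Cpow_add_r.
    replace (n + n)%nat with (2 * n)%nat by lia. rewrite Cpow_mult_r.
    replace ((-1) ^ 2)%C with (RtoC 1) by (simpl; ring). rewrite Cpow_1_l. ring. }
  rewrite ES, Cexp_pow.
  set (X := gamma_int (a + INR M + 2 * INR n) 1).
  rewrite (Nat.add_comm n M), (Rmult_comm (/ INR (fact (M + n)))).
  assert (EE : (Cexp (INR (M + n + n) * (RtoC l2 + RtoC l2)) * Cexp (a * RtoC (ln kappa))
     * (2 * PI * Cexp (- ((a + INR M + 2 * INR n + 1) * L))))%C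
     = (/ c * Cexp (a * La) * Cexp (INR M * La) * Cexp (INR n * (2 * La)))%C).
  { assert (Ec : (/ c)%C = (2 * PI * Cexp (- L))%C).
    { rewrite Cexp_opp, EL. field. auto. }
    rewrite Ec.
    transitivity (2 * PI * (Cexp (INR (M + n + n) * (RtoC l2 + RtoC l2)) * Cexp (a * RtoC (ln kappa))
     * Cexp (- ((a + INR M + 2 * INR n + 1) * L))))%C; [ring|].
    transitivity (2 * PI * (Cexp (- L) * Cexp (a * La) * Cexp (INR M * La) * Cexp (INR n * (2 * La))))%C; [|ring].
    f_equal. rewrite <- !Cexp_plus. f_equal. rewrite Elk, !plus_INR, !RtoC_plus. unfold L, La. ring. }
  set (Y := (RGamma (a + INR n + 1) * RGamma (a + INR M + INR n + 1)
     * RtoC (/ INR (fact n) * / INR (fact (M + n))))%C).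
  transitivity ((-1) ^ M * Y * X * (/ c * Cexp (a * La) * Cexp (INR M * La) * Cexp (INR n * (2 * La))))%C.
  - unfold Y, Cdiv. ring.
  - rewrite <- EE. unfold Y. ring.
Qed.

Lemma rcvg_half_pow : rcvg (fun n => (/ 2) ^ n) 0.
Proof.
  intros eps He. destruct (pow_lt_1_zero (/ 2) ltac:(rewrite Rabs_pos_eq; lra) eps He) as [N HN].
  exists N. intros n Hn. rewrite Rminus_0_r. apply HN. lia.
Qed.

Lemma Cpowz_Ci_even s M : s = 1%Z \/ s = (-1)%Z ->
  Cpowz Ci (s * (2 * Z.of_nat M)) = ((-1) ^ M)%C.
Proof.
  assert (E : forall k, (Ci ^ (2 * k))%C = ((-1) ^ k)%C).
  { intros k. rewrite Cpow_mult_r. f_equal. apply injective_projections; simpl; ring. }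
  assert (I : forall k, (/ ((-1) ^ k))%C = ((-1) ^ k)%C).
  { intros k. rewrite <- Cpow_inv by (apply RtoC_neq_0; lra). f_equal.
    field. }
  intros Hs. destruct M as [|M].
  - destruct Hs as [-> | ->]; reflexivity.
  - assert (P : Z.to_nat (2 * Z.of_nat (S M)) = (2 * S M)%nat) by lia.
    remember (2 * Z.of_nat (S M))%Z as w eqn:Ew. destruct w as [|q|q]; try lia.
    assert (Pq : Pos.to_nat q = (2 * S M)%nat) by exact P.
    destruct Hs as [-> | ->].
    + rewrite Z.mul_1_l. unfold Cpowz. rewrite Pq. apply E.
    + change (-1 * Z.pos q)%Z with (Z.neg q). unfold Cpowz. rewrite Pq, E. apply I.
Qed.

Lemma BesselI_half_int s M c : s = 1%Z \/ s = (-1)%Z -> 0 < Re c ->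
  BesselI (RtoC (IZR (s * (2 * Z.of_nat M))) / 2) (4 * PI / c) = BesselI (INR M) (4 * PI / c)%C.
Proof.
  intros Hs Hc. destruct Hs as [-> | ->].
  - f_equal. rewrite Z.mul_1_l, mult_IZR, <- INR_IZR_INZ, RtoC_mult. field.
  - rewrite <- (BesselI_neg_nat M c Hc). f_equal.
    rewrite !mult_IZR, <- INR_IZR_INZ, !RtoC_mult. field.
Qed.

Lemma J2_signed (mu : C) (s : Z) (M : nat) (x phi : R) : s = 1%Z \/ s = (-1)%Z -> 0 < x ->
  J2 mu (s * (2 * Z.of_nat M)) (4 * PI * Csqrt (x * Cexp (Ci * phi))) =
  bessel_pair (- (2 * mu)) M x (IZR s * phi).
Proof.
  intros Hs Hx. destruct (J2_bessel_pair mu M x phi Hx) as [H1 H2].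
  destruct Hs as [-> | ->].
  - rewrite Z.mul_1_l, Rmult_1_l. exact H1.
  - replace (-1 * (2 * Z.of_nat M))%Z with (- (2 * Z.of_nat M))%Z by lia.
    replace (-1 * phi) with (- phi) by ring. exact H2.
Qed.

Lemma bJ_generic_pair (mu : C) (s : Z) (M : nat) (x phi : R) : s = 1%Z \/ s = (-1)%Z -> 0 < x ->
  bJ_generic mu (s * (2 * Z.of_nat M)) (x * Cexp (Ci * phi)) =
  ((2 * PI ^ 2) / Csin (2 * PI * mu)
   * (bessel_pair (- (2 * mu)) M x (IZR s * phi) - bessel_pair (2 * mu) M x (IZR (- s) * phi)))%C.
Proof.
  intros Hs Hx. unfold bJ_generic.
  rewrite (J2_signed mu s M x phi Hs Hx).
  replace (- (s * (2 * Z.of_nat M)))%Z with ((- s) * (2 * Z.of_nat M))%Z by lia.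
  rewrite (J2_signed (- mu) (- s) M x phi); [|lia|exact Hx].
  replace (- (2 * - mu))%C with (2 * mu)%C by ring. reflexivity.
Qed.

Lemma polar_integral_generic (mu c : C) (s : Z) (M : nat) :
  s = 1%Z \/ s = (-1)%Z -> Rabs (Re mu) < 1 / 2 -> 0 < Re c -> Rabs (Carg c) < PI / 2 ->
  is_polar_integral
    (fun x phi => (bJ_generic mu (s * (2 * Z.of_nat M)) (x * Cexp (Ci * phi)) * Cexp (- (2 * PI * c * x)))%C)
    (4 * PI * Cpowz Ci (s * (2 * Z.of_nat M)) / c
     * BesselK_generic (2 * mu) (4 * PI / c)
     * BesselI (RtoC (IZR (s * (2 * Z.of_nat M))) / 2) (4 * PI / c))%C.
Proof.
  intros Hs Hmu Hc Harg. assert (HPI := PI_RGT_0).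
  apply Rabs_def2 in Hmu.
  rewrite (Cpowz_Ci_even s M Hs), (BesselI_half_int s M c Hs Hc).
  set (p := (2 * PI * c)%C).
  assert (Hp : 0 < Re p).
  { unfold p. replace (Re (2 * PI * c)%C) with (2 * PI * Re c) by (unfold Re; simpl; ring). nra. }
  set (a := (- (2 * mu))%C). set (a' := (2 * mu)%C).
  assert (Ha : -1 < Re a) by (unfold a; replace (Re (- (2 * mu))%C) with (- (2 * Re mu)) by (unfold Re; simpl; ring); lra).
  assert (Ha' : -1 < Re a') by (unfold a'; replace (Re (2 * mu)%C) with (2 * Re mu) by (unfold Re; simpl; ring); lra).
  assert (Hs0 : s <> 0%Z) by lia. assert (Hs0' : (- s)%Z <> 0%Z) by lia.
  set (Q := ((2 * PI ^ 2) / Csin (2 * PI * mu))%C).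
  destruct (bessel_pair_trunc_error a M p Hp) as [K [HK E]].
  destruct (bessel_pair_trunc_error a' M p Hp) as [K' [HK' E']].
  destruct (ex_Rhalf_gamma (Re a) (Re p / 2) Ha ltac:(lra)) as [b Hb].
  destruct (ex_Rhalf_gamma (Re a') (Re p / 2) Ha' ltac:(lra)) as [b' Hb'].
  set (v := fun (a : C) k => (pair_coef a M (k + M) k * (2 * PI * gamma_int (a + INR (k + M + k)) p))%C).
  apply polar_integral_approx with
    (fn := fun n x phi => (Q * (pair_poly a M n s p x phi + (-1) * pair_poly a' M n (- s) p x phi))%C)
    (ln := fun n => (Q * (psum (v a) n + (-1) * psum (v a') n))%C)
    (e := fun n => (/ 2) ^ n)
    (B := fun x => Cmod Q * (K * exp (Re a * ln x - Re p / 2 * x) + K' * exp (Re a' * ln x - Re p / 2 * x)))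
    (b := Cmod Q * (K * b + K' * b')).
  - intros n. apply polar_regular_is_polar_integral. apply polar_regular_scal, polar_regular_plus;
      [|apply polar_regular_scal]; apply polar_regular_pair_poly; auto.
  - apply is_Rhalf_scal, is_Rhalf_plus; apply is_Rhalf_scal; assumption.
  - intros n. apply pow_le. lra.
  - apply rcvg_half_pow.
  - intros n x phi Hx _. rewrite (bJ_generic_pair mu s M x phi Hs Hx). fold Q a a'.
    rewrite <- !(pair_poly_spec _ _ _ _ _ _ _ Hx).
    match goal with |- Cmod ?e <= _ => replace e with
      (Q * ((bessel_pair a M x (IZR s * phi) - bessel_pair_trunc a M n x (IZR s * phi)) * Cexp (- (p * RtoC x))
       - (bessel_pair a' M x (IZR (- s) * phi) - bessel_pair_trunc a' M n x (IZR (- s) * phi)) * Cexp (- (p * RtoC x))))%C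
      by (unfold p; ring) end.
    rewrite Cmod_mult.
    assert (T := E n x (IZR s * phi) Hx). assert (T' := E' n x (IZR (- s) * phi) Hx).
    assert (T2 := Cmod_sub_le
      ((bessel_pair a M x (IZR s * phi) - bessel_pair_trunc a M n x (IZR s * phi)) * Cexp (- (p * RtoC x)))%C
      ((bessel_pair a' M x (IZR (- s) * phi) - bessel_pair_trunc a' M n x (IZR (- s) * phi)) * Cexp (- (p * RtoC x)))%C).
    rewrite <- Rmult_assoc, (Rmult_comm _ (Cmod Q)), Rmult_assoc.
    apply Rmult_le_compat_l; [apply Cmod_ge_0|]. lra.
  - assert (L1 := cvg_pair_diagonal a M c Ha Hc Harg). assert (L2 := cvg_pair_diagonal a' M c Ha' Hc Harg).
    fold p in L1, L2. fold (v a) in L1. fold (v a') in L2.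
    assert (LL := cvg_scal Q _ _ (cvg_plus _ _ _ _ L1 (cvg_scal (-1) _ _ L2))).
    match goal with |- cvg _ ?w => match type of LL with cvg _ ?w' => replace w with w'; [exact LL|] end end.
    unfold BesselK_generic. fold a' a. unfold Q.
    replace (PI * a')%C with (2 * PI * mu)%C by (unfold a'; ring).
    change (- a')%C with a.
    generalize (BesselI a (4 * PI / c)) (BesselI a' (4 * PI / c)) (BesselI (INR M) (4 * PI / c)).
    intros I1 I2 I3. unfold Cdiv. generalize (/ Csin (2 * PI * mu))%C. intros iS.
    field. apply neq_0_of_Re_pos, Hc.
Qed.

(** * The exceptional parameter *)

Lemma Csin_sub_id_le w : Cmod w <= / 8 -> Cmod (Csin w - w)%C <= 2 * Cmod w ^ 2.
Proof.
  intros Hw. set (r := fun z => (Cexp z - 1 - z)%C).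
  assert (E : (Csin w - w)%C = ((r (Ci * w) - r (- (Ci * w))) / (2 * Ci))%C).
  { unfold Csin, r. field. apply Ci_nz. }
  assert (Mi : Cmod (Ci * w)%C = Cmod w) by (rewrite Cmod_mult, Cmod_Ci; ring).
  assert (T1 := Cexp_sub_1_sub_id_le (Ci * w)%C). assert (T2 := Cexp_sub_1_sub_id_le (- (Ci * w))%C).
  rewrite Cmod_opp in T2. rewrite Mi in T1, T2. fold (r (Ci * w)%C) in T1. fold (r (- (Ci * w))%C) in T2.
  assert (Ee : exp (Cmod w) <= 2).
  { assert (T := exp_ineq1_le (- Cmod w)).
    assert (P := exp_pos (Cmod w)). assert (I : exp (Cmod w) * exp (- Cmod w) = 1).
    { rewrite <- exp_plus, Rplus_opp_r, exp_0. reflexivity. } nra. }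
  rewrite E, Cmod_div by (apply Cmult_neq_0; [apply RtoC_neq_0; lra|apply Ci_nz]).
  rewrite Cmod_mult, Cmod_Ci, Cmod_R, (Rabs_pos_eq 2), Rmult_1_r by lra.
  assert (T3 := Cmod_sub_le (r (Ci * w)%C) (r (- (Ci * w))%C)).
  assert (Cmod w ^ 2 * exp (Cmod w) <= Cmod w ^ 2 * 2) by (apply Rmult_le_compat_l; [apply pow2_ge_0|auto]).
  lra.
Qed.

(** L'Hospital's rule at [t = 0]. The rate is linear in the jet norm, hence integrable in a parameter
    as soon as that norm is. *)
Lemma jet_sin_quotient f g N : jet f N -> jet g N -> f (RtoC 0) = g (RtoC 0) ->
  exists beta, forall t, t <> RtoC 0 -> Cmod t <= / 32 ->
    Cmod ((f (- t) - g t) / Csin (PI * t) - beta)%C <= 12 * N * Cmod t.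
Proof.
  intros [bf [Gf [F1 [F2 F3]]]] [bg [Gg [G1 [G2 G3]]]] E0.
  assert (HPI := PI_RGT_0). assert (PI4 := PI_4). assert (PI3 := PI2_3_2).
  assert (HP0 : RtoC PI <> RtoC 0) by (apply RtoC_neq_0; lra).
  exists (- (bf + bg) / PI)%C. intros t Ht0 Ht.
  assert (Htp : 0 < Cmod t) by (apply Cmod_gt_0; auto).
  set (w := (PI * t)%C).
  assert (Mw : Cmod w = PI * Cmod t) by (unfold w; rewrite Cmod_mult, Cmod_R, Rabs_pos_eq; lra).
  assert (Hw : Cmod w <= / 8) by (rewrite Mw; nra).
  assert (Sw := Csin_sub_id_le w Hw).
  assert (Lw : Cmod w / 2 <= Cmod (Csin w)).
  { assert (T := Cmod_rev_tri w (w - Csin w)%C).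
    replace (w - (w - Csin w))%C with (Csin w) in T by ring. rewrite (Cmod_minus_sym w) in T.
    assert (Cmod w ^ 2 <= / 8 * Cmod w).
    { simpl. rewrite Rmult_1_r. apply Rmult_le_compat_r; [apply Cmod_ge_0|exact Hw]. }
    assert (T0 := Cmod_ge_0 w). lra. }
  assert (S0 : Csin w <> RtoC 0).
  { apply Cmod_gt_0. assert (0 < PI * Cmod t) by (apply Rmult_lt_0_compat; auto). lra. }
  specialize (F3 (- t)%C ltac:(rewrite Cmod_opp; lra)). specialize (G3 t ltac:(lra)).
  rewrite Cmod_opp in F3.
  set (rf := (f (- t) - f (RtoC 0) - bf * - t)%C) in *. set (rg := (g t - g (RtoC 0) - bg * t)%C) in *.
  replace ((f (- t) - g t) / Csin w - - (bf + bg) / PI)%C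
    with (((rf - rg) + (bf + bg) * / PI * (Csin w - w)) / Csin w)%C.
  2: { unfold rf, rg. rewrite E0. unfold w at 2. field. auto. }
  rewrite Cmod_div by exact S0.
  assert (B1 := Cmod_ge_0 (f (RtoC 0))). assert (B2 := Cmod_ge_0 (g (RtoC 0))).
  assert (B3 := Cmod_ge_0 bf). assert (B4 := Cmod_ge_0 bg).
  assert (Num : Cmod ((rf - rg) + (bf + bg) * / PI * (Csin w - w))%C <= 18 * N * Cmod t ^ 2).
  { eapply Rle_trans; [apply Cmod_triangle|].
    assert (T1 := Cmod_sub_le rf rg).
    assert (T2 := Cmod_triangle bf bg).
    rewrite !Cmod_mult, Cmod_inv, Cmod_R, (Rabs_pos_eq PI) by (auto; lra).
    assert (U : Cmod (bf + bg)%C * / PI * Cmod (Csin w - w)%C <= (2 * N) * / PI * (2 * (PI * Cmod t) ^ 2)).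
    { rewrite <- Mw. apply Rmult_le_compat.
      - apply Rmult_le_pos; [apply Cmod_ge_0|left; apply Rinv_0_lt_compat; lra].
      - apply Cmod_ge_0.
      - apply Rmult_le_compat_r; [left; apply Rinv_0_lt_compat; lra|lra].
      - exact Sw. }
    replace (2 * N * / PI * (2 * (PI * Cmod t) ^ 2)) with (4 * PI * (N * Cmod t ^ 2)) in U by (field; lra).
    assert (HN : 0 <= N) by lra.
    assert (N * Cmod t ^ 2 >= 0) by (apply Rle_ge, Rmult_le_pos; [auto|apply pow2_ge_0]).
    assert (Gf * Cmod t ^ 2 <= N * Cmod t ^ 2) by (apply Rmult_le_compat_r; [apply pow2_ge_0|lra]).
    assert (Gg * Cmod t ^ 2 <= N * Cmod t ^ 2) by (apply Rmult_le_compat_r; [apply pow2_ge_0|lra]).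
    nra. }
  apply Rmult_le_reg_r with (Cmod (Csin w)); [apply Cmod_gt_0; auto|].
  unfold Rdiv. rewrite Rmult_assoc, Rinv_l, Rmult_1_r by (apply Rgt_not_eq, Cmod_gt_0; auto).
  eapply Rle_trans; [exact Num|].
  apply Rle_trans with (12 * N * Cmod t * (Cmod w / 2)).
  - rewrite Mw. assert (HN : 0 <= N) by lra. assert (0 <= N * Cmod t ^ 2) by (apply Rmult_le_pos; [auto|apply pow2_ge_0]).
    replace (12 * N * Cmod t * (PI * Cmod t / 2)) with (6 * PI * (N * Cmod t ^ 2)) by field. nra.
  - apply Rmult_le_compat_l; [|exact Lw]. apply Rmult_le_pos; lra.
Qed.

Lemma Clim_locally' (f : C -> C) (w0 l : C) K d : 0 < d ->
  (forall w, w <> w0 -> Cmod (w - w0)%C <= d -> Cmod (f w - l)%C <= K * Cmod (w - w0)%C) ->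
  Clim (locally' w0) f = l.
Proof.
  intros Hd H. apply (@iota_filterlim_locally _ C_R_CompleteNormedModule).
  - split; [|apply locally'_filter].
    intros H0. apply (@locally_norm_le_locally R_AbsRing C_R_NormedModule) in H0.
    destruct H0 as [eps Heps].
    apply (Heps (w0 + RtoC (eps / 2))%C).
    + unfold ball_norm. rewrite norm_C_R.
      change (Cmod (w0 + RtoC (eps / 2) - w0)%C < eps).
      replace (w0 + RtoC (eps / 2) - w0)%C with (RtoC (eps / 2)) by ring.
      assert (T := cond_pos eps). rewrite Cmod_R, Rabs_pos_eq; lra.
    + intros E. assert (T := cond_pos eps).
      assert (Z : RtoC (eps / 2) = RtoC 0).
      { transitivity (w0 + RtoC (eps / 2) - w0)%C; [ring|]. rewrite E. ring. }
      apply RtoC_inj in Z. lra.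
  - apply (proj2 (@filterlim_locally_ball_norm R_AbsRing C C_R_NormedModule (locally' w0) _ f l)).
    intros eps. apply (@locally_le_locally_norm R_AbsRing C_R_NormedModule).
    destruct (small_factor K eps (cond_pos eps)) as [e [He Se]].
    exists (mkposreal _ (Rmin_pos _ _ Hd He)). intros w Hw Hne. unfold ball_norm in *. rewrite norm_C_R in *.
    change (Cmod (w - w0)%C < Rmin d e) in Hw. change (Cmod (f w - l)%C < eps).
    assert (M1 := Rmin_l d e). assert (M2 := Rmin_r d e).
    eapply Rle_lt_trans; [apply H; [exact Hne|lra]|].
    apply Se. split; [apply Cmod_ge_0|lra].
Qed.

(** By [clifford_neg_nat] the factor [e^(-i M phi)] is absorbed, and the rest is symmetric under
    conjugation. This is the vanishing of the numerator of the kernel at [mu = 0]. *)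
Lemma bessel_pair_0_sym (M : nat) (x phi : R) :
  bessel_pair 0 M x phi = bessel_pair 0 M x (- phi).
Proof.
  assert (S : forall phi : R, bessel_pair 0 M x phi =
    (RtoC (- (kappa * x)) ^ M * clifford (INR M) (RtoC (- (kappa * x)) * Cexp (Ci * RtoC phi))
      * clifford (INR M) (RtoC (- (kappa * x)) * Cexp (- (Ci * RtoC phi))))%C).
  { intros psi. unfold bessel_pair, twist.
    replace (0 - INR M)%C with (- INR M)%C by ring. rewrite Cplus_0_l, clifford_neg_nat.
    rewrite Cmult_0_l, Cexp_0, Cpow_mult_l, Cexp_pow, Cexp_opp. field. apply Cexp_neq_0. }
  rewrite !S. replace (Ci * RtoC (- phi))%C with (- (Ci * RtoC phi))%C by (rewrite RtoC_opp; ring).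
  replace (- - (Ci * RtoC phi))%C with (Ci * RtoC phi)%C by ring. ring.
Qed.

(** With [y = |r| / 8] the left-hand side is [1 + 8 y + 64 y^2 exp y], and [y^2 <= 2 exp y]; thus
    [137 = 1 + 8 + 128]. At [r = ln (kappa x)] the bound is a combination of [x^(1/4)] and [x^(-1/4)]. *)
Lemma jet_norm_exp_le r : 1 + Rabs r + Rabs r ^ 2 * exp (Rabs r / 8) <= 137 * (exp (r / 4) + exp (- (r / 4))).
Proof.
  set (y := Rabs r / 8). assert (Hy : 0 <= y) by (unfold y; assert (T := Rabs_pos r); lra).
  assert (Er : Rabs r = 8 * y) by (unfold y; field). rewrite Er.
  assert (E2 : exp y * exp y <= exp (r / 4) + exp (- (r / 4))).
  { rewrite <- exp_plus. assert (P1 := exp_pos (r / 4)). assert (P2 := exp_pos (- (r / 4))).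
    unfold y. destruct (Rcase_abs r) as [H|H].
    - rewrite Rabs_left by auto. replace (- r / 8 + - r / 8) with (- (r / 4)) by field. lra.
    - rewrite Rabs_right by auto. replace (r / 8 + r / 8) with (r / 4) by field. lra. }
  assert (T1 := exp_ineq1_le y). assert (T2 := exp_ineq1_le (y / 2)).
  assert (Eh : exp y = exp (y / 2) * exp (y / 2)) by (rewrite <- exp_plus; f_equal; field).
  assert (Q : y ^ 2 <= 2 * exp y).
  { assert (T := exp_ge_taylor y 2 Hy). simpl in T. simpl. lra. }
  assert (P := exp_pos y).
  assert (1 <= exp y * exp y) by nra.
  assert (y <= exp y * exp y) by nra.
  assert (y ^ 2 * exp y <= 2 * exp y * exp y) by nra.
  assert (1 + 8 * y + (8 * y) ^ 2 * exp y <= 137 * (exp y * exp y)) by (simpl; simpl in *; lra).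
  lra.
Qed.

(** The weight is integrable against [exp (- 2 q x)], also at [0], because the jet norm of
    [(kappa x)^t] only costs [x^(1/4)] and [x^(-1/4)]. *)
Lemma jet_bessel_pair (M : nat) (q : R) : 0 < q -> exists K, 0 <= K /\ forall x, 0 < x ->
  exists N, (forall phi, jet (fun t => bessel_pair t M x phi) N) /\
    N <= K * (exp (/ 4 * ln x + q * x) + exp (- / 4 * ln x + q * x)).
Proof.
  intros Hq. assert (Hk := kappa_pos).
  (* The two factors together grow like [exp (2 eps kappa x) = exp (q x)]. *)
  set (eps := q / (2 * kappa)).
  assert (He : 0 < eps) by (apply Rdiv_lt_0_compat; lra).
  destruct (clifford_estimates (- INR M)%C eps He) as [K1 [HK1 E1]].
  destruct (clifford_estimates (INR M)%C eps He) as [K2 [HK2 E2]].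
  set (c0 := exp (ln kappa / 4) + exp (- (ln kappa / 4))).
  assert (P1 := exp_pos (ln kappa / 4)). assert (P2 := exp_pos (- (ln kappa / 4))).
  assert (HK12 : 0 <= K1 * K2) by (apply Rmult_le_pos; auto).
  exists (137 * c0 * (K1 * K2)). split; [apply Rmult_le_pos; [unfold c0; lra|auto]|].
  intros x Hx. set (Ex := exp (eps * (kappa * x))). set (r := ln (kappa * x)).
  assert (HEx : 0 < Ex) by apply exp_pos.
  assert (EE : Ex * Ex = exp (q * x)).
  { unfold Ex. rewrite <- exp_plus. f_equal. unfold eps. field. lra. }
  exists ((1 + Rabs r + Rabs r ^ 2 * exp (Rabs r / 8)) * (K1 * Ex * (K2 * Ex))). split.
  - intros phi. unfold bessel_pair, twist. fold r.
    set (u := (RtoC (- (kappa * x)) * Cexp (Ci * RtoC phi))%C).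
    set (v := (RtoC (- (kappa * x)) * Cexp (- (Ci * RtoC phi)))%C).
    assert (Mu : Cmod u = kappa * x) by (apply Cmod_kappa_phase; [auto|apply Cmod_Ci_phase]).
    assert (Mv : Cmod v = kappa * x) by (apply Cmod_kappa_phase; [auto|apply Cmod_Ci_phase_opp]).
    destruct (E1 u) as [_ [J1 _]]. destruct (E2 v) as [_ [J2' _]].
    rewrite Mu in J1. rewrite Mv in J2'. fold Ex in J1, J2'.
    set (ph := Cexp (- (INR M * (Ci * RtoC phi)))%C).
    assert (Mph : Cmod ph = 1) by apply Cmod_twist_phase.
    apply jet_ext with (fun t => ph * (Cexp (RtoC r * t) * (clifford (- INR M + t) u * clifford (INR M + t) v)))%C.
    + intros t _. replace (t - INR M)%C with (- INR M + t)%C by ring.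
      rewrite (Cplus_comm t (INR M)), (Cmult_comm t). ring.
    + eapply jet_le; [|apply jet_scal, jet_mult; [apply jet_exp|apply jet_mult; [exact J1|exact J2']]].
      rewrite Mph, Rmult_1_l, Cmod_R. lra.
  - assert (T := jet_norm_exp_le r).
    apply Rle_trans with (137 * (exp (r / 4) + exp (- (r / 4))) * (K1 * K2 * exp (q * x))).
    + rewrite <- EE. replace (K1 * K2 * (Ex * Ex)) with (K1 * Ex * (K2 * Ex)) by ring.
      apply Rmult_le_compat_r; [|exact T]. apply Rmult_le_pos; apply Rmult_le_pos; lra.
    + unfold r. rewrite ln_mult by auto.
      replace ((ln kappa + ln x) / 4) with (ln kappa / 4 + / 4 * ln x) by field.
      replace (- (ln kappa / 4 + / 4 * ln x)) with (- (ln kappa / 4) + - / 4 * ln x) by field.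
      rewrite !exp_plus. assert (Q1 := exp_pos (/ 4 * ln x)). assert (Q2 := exp_pos (- / 4 * ln x)).
      assert (Q3 := exp_pos (q * x)). unfold c0.
      set (A := exp (ln kappa / 4)) in *. set (A' := exp (- (ln kappa / 4))) in *.
      set (D := exp (/ 4 * ln x)) in *. set (D' := exp (- / 4 * ln x)) in *.
      replace (137 * (A * D + A' * D') * (K1 * K2 * exp (q * x)))
        with ((A * D + A' * D') * (137 * (K1 * K2) * exp (q * x))) by ring.
      replace (137 * (A + A') * (K1 * K2) * (D * exp (q * x) + D' * exp (q * x)))
        with ((A + A') * (D + D') * (137 * (K1 * K2) * exp (q * x))) by ring.
      apply Rmult_le_compat_r; [apply Rmult_le_pos; lra|]. nra.
Qed.

Lemma bJ_0_approx (s : Z) (M : nat) (q : R) : s = 1%Z \/ s = (-1)%Z -> 0 < q ->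
  exists K, 0 <= K /\ forall (x phi : R), 0 < x -> forall mu, mu <> RtoC 0 -> Cmod mu <= / 64 ->
    Cmod (bJ_generic mu (s * (2 * Z.of_nat M)) (x * Cexp (Ci * phi))
          - bJ 0 (s * (2 * Z.of_nat M)) (x * Cexp (Ci * phi)))%C
    <= Cmod mu * (K * (exp (/ 4 * ln x + q * x) + exp (- / 4 * ln x + q * x))).
Proof.
  intros Hs Hq. destruct (jet_bessel_pair M q Hq) as [K [HK HJ]].
  assert (HPI := PI_RGT_0). assert (PI2 : 0 < PI ^ 2) by (apply pow_lt; auto).
  exists (48 * PI ^ 2 * K). split; [apply Rmult_le_pos; lra|].
  intros x phi Hx. destruct (HJ x Hx) as [N [HN HNle]].
  set (z := (x * Cexp (Ci * phi))%C). set (m := (s * (2 * Z.of_nat M))%Z).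
  destruct (jet_sin_quotient (fun t => bessel_pair t M x (IZR s * phi))
    (fun t => bessel_pair t M x (IZR (- s) * phi)) N (HN _) (HN _)) as [beta Hb].
  { cbv beta. rewrite opp_IZR, bessel_pair_0_sym. f_equal. ring. }
  assert (D : forall mu, mu <> RtoC 0 -> Cmod mu <= / 64 ->
     Cmod (bJ_generic mu m z - 2 * PI ^ 2 * beta)%C <= 48 * PI ^ 2 * N * Cmod mu).
  { intros mu Hmu0 Hmu.
    assert (M2 : Cmod (2 * mu)%C = 2 * Cmod mu) by (rewrite Cmod_mult, Cmod_R, Rabs_pos_eq; lra).
    specialize (Hb (2 * mu)%C). rewrite M2 in Hb.
    specialize (Hb ltac:(apply Cmult_neq_0; [apply RtoC_neq_0; lra|auto]) ltac:(lra)).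
    unfold z, m. rewrite (bJ_generic_pair mu s M x phi Hs Hx).
    replace (2 * PI * mu)%C with (PI * (2 * mu))%C by ring.
    match goal with |- Cmod ?e <= _ => replace e with
      (RtoC (2 * PI ^ 2) * ((bessel_pair (- (2 * mu)) M x (IZR s * phi) - bessel_pair (2 * mu) M x (IZR (- s) * phi))
         / Csin (PI * (2 * mu)) - beta))%C end.
    2: { rewrite RtoC_mult, RtoC_pow. unfold Cdiv. ring. }
    rewrite Cmod_mult, Cmod_R, Rabs_pos_eq by lra.
    (* 48 is 2 * 12 * 2: the prefactor, the rate, and [|2 mu| = 2 |mu|]. *)
    replace (48 * PI ^ 2 * N * Cmod mu) with (2 * PI ^ 2 * (12 * N * (2 * Cmod mu))) by ring.
    apply Rmult_le_compat_l; [lra|exact Hb]. }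
  assert (E : bJ 0 m z = (2 * PI ^ 2 * beta)%C).
  { unfold bJ. destruct (excluded_middle_informative _) as [_|Hn].
    - apply Clim_locally' with (48 * PI ^ 2 * N) (/ 64); [lra|]. intros w Hw0 Hw.
      replace (w - 0)%C with w in * by ring. apply D; auto.
    - exfalso. apply Hn. exists (- (s * Z.of_nat M))%Z. unfold m.
      rewrite opp_IZR, !mult_IZR, RtoC_opp, !RtoC_mult. ring. }
  intros mu Hmu0 Hmu. rewrite E. eapply Rle_trans; [apply D; auto|].
  assert (T := Cmod_ge_0 mu).
  replace (48 * PI ^ 2 * N * Cmod mu) with (Cmod mu * (48 * PI ^ 2 * N)) by ring.
  apply Rmult_le_compat_l; [auto|].
  rewrite (Rmult_assoc (48 * PI ^ 2)). apply Rmult_le_compat_l; [lra|exact HNle].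
Qed.

Lemma BesselK_0_approx z : z <> RtoC 0 -> exists K, forall nu, nu <> RtoC 0 -> Cmod nu <= / 32 ->
  Cmod (BesselK_generic nu z - BesselK 0 z)%C <= K * Cmod nu.
Proof.
  intros Hz. assert (HPI := PI_RGT_0).
  set (L := Clog (z / 2)). set (u := Cexp (2 * L)).
  destruct (clifford_estimates (RtoC 0) 1) as [K1 [HK1 E1]]; [lra|].
  destruct (E1 u) as [_ [J1 _]].
  assert (J : exists N, jet (fun nu => BesselI nu z) N).
  { eexists. apply jet_ext with (fun nu => (Cexp (L * nu) * clifford (0 + nu) u)%C).
    - intros t _. rewrite BesselI_clifford, Cplus_0_l, (Cmult_comm L). reflexivity.
    - apply jet_mult; [apply jet_exp|exact J1]. }
  destruct J as [N J].
  destruct (jet_sin_quotient _ _ N J J eq_refl) as [beta Hb].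
  assert (D : forall nu, nu <> RtoC 0 -> Cmod nu <= / 32 ->
     Cmod (BesselK_generic nu z - PI / 2 * beta)%C <= PI / 2 * (12 * N) * Cmod nu).
  { intros nu H0 H. specialize (Hb nu H0 H). unfold BesselK_generic.
    match goal with |- Cmod ?e <= _ => replace e with
      (RtoC (PI / 2) * ((BesselI (- nu) z - BesselI nu z) / Csin (PI * nu) - beta))%C
      by (rewrite RtoC_div by lra; unfold Cdiv; ring) end.
    rewrite Cmod_mult, Cmod_R, Rabs_pos_eq, Rmult_assoc by lra.
    apply Rmult_le_compat_l; [lra|exact Hb]. }
  exists (PI / 2 * (12 * N)).
  assert (E : BesselK 0 z = (PI / 2 * beta)%C).
  { unfold BesselK. destruct (excluded_middle_informative _) as [_|Hn].
    - apply Clim_locally' with (PI / 2 * (12 * N)) (/ 32); [lra|]. intros w Hw0 Hw.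
      replace (w - 0)%C with w in * by ring. apply D; auto.
    - exfalso. apply Hn. exists 0%Z. reflexivity. }
  intros nu H0 H. rewrite E. apply D; auto.
Qed.

Lemma polar_integral_nongeneric (c : C) (s : Z) (M : nat) :
  s = 1%Z \/ s = (-1)%Z -> 0 < Re c -> Rabs (Carg c) < PI / 2 ->
  is_polar_integral
    (fun x phi => (bJ 0 (s * (2 * Z.of_nat M)) (x * Cexp (Ci * phi)) * Cexp (- (2 * PI * c * x)))%C)
    (4 * PI * Cpowz Ci (s * (2 * Z.of_nat M)) / c
     * BesselK 0 (4 * PI / c)
     * BesselI (RtoC (IZR (s * (2 * Z.of_nat M))) / 2) (4 * PI / c))%C.
Proof.
  intros Hs Hc Harg. assert (HPI := PI_RGT_0).
  assert (Hc0 : c <> RtoC 0) by (apply neq_0_of_Re_pos, Hc).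
  set (p := (2 * PI * c)%C).
  assert (Hp : 0 < Re p).
  { unfold p. replace (Re (2 * PI * c)%C) with (2 * PI * Re c) by (unfold Re; simpl; ring). nra. }
  set (q := Re p / 2). assert (Hq : 0 < q) by (unfold q; lra).
  destruct (bJ_0_approx s M q Hs Hq) as [K [HK HB]].
  destruct (BesselK_0_approx (4 * PI / c)) as [K' HK'].
  { apply Cmult_neq_0; [apply Cmult_neq_0; apply RtoC_neq_0; lra|].
    intros E. apply (Cmult_neq_0 c (/ c)); [auto| |].
    - intros E'. assert (T := Cinv_r c Hc0). rewrite E', Cmult_0_r in T. apply RtoC_inj in T. lra.
    - rewrite E. ring. }
  destruct (ex_Rhalf_gamma (/ 4) q ltac:(lra) Hq) as [b1 Hb1].
  destruct (ex_Rhalf_gamma (- / 4) q ltac:(lra) Hq) as [b2 Hb2].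
  (* Any sequence tending to [0] in the punctured disc of radius 1/64 of [bJ_0_approx] will do. *)
  set (m := fun n => / INR (n + 64)).
  assert (Hm : forall n, 0 < m n <= / 64).
  { intros n. assert (64 <= INR (n + 64)).
    { replace 64 with (INR 64) by (simpl; ring). apply le_INR. lia. }
    unfold m. split; [apply Rinv_0_lt_compat; lra|apply Rinv_le_contravar; lra]. }
  assert (Hm0 : rcvg m 0).
  { intros eps He. destruct (rcvg_inv_INR eps He) as [N HN]. exists N. intros n Hn. apply HN. lia. }
  assert (Nm : forall n, RtoC (m n) <> RtoC 0) by (intros n; apply RtoC_neq_0; specialize (Hm n); lra).
  assert (Mm : forall n, Cmod (RtoC (m n)) = m n).
  { intros n. rewrite Cmod_R, Rabs_pos_eq; [reflexivity|]. specialize (Hm n). lra. }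
  apply polar_integral_approx with
    (fn := fun n x phi => (bJ_generic (RtoC (m n)) (s * (2 * Z.of_nat M)) (x * Cexp (Ci * phi)) * Cexp (- (2 * PI * c * x)))%C)
    (ln := fun n => (4 * PI * Cpowz Ci (s * (2 * Z.of_nat M)) / c
     * BesselK_generic (2 * RtoC (m n)) (4 * PI / c)
     * BesselI (RtoC (IZR (s * (2 * Z.of_nat M))) / 2) (4 * PI / c))%C)
    (e := m)
    (B := fun x => K * (exp (/ 4 * ln x - q * x) + exp (- / 4 * ln x - q * x)))
    (b := K * (b1 + b2)).
  - intros n. apply polar_integral_generic; auto.
    change (Rabs (m n) < 1 / 2). specialize (Hm n). rewrite Rabs_pos_eq; lra.
  - apply is_Rhalf_scal, is_Rhalf_plus; assumption.
  - intros n. left. apply Hm.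
  - exact Hm0.
  - intros n x phi Hx _. fold p.
    match goal with |- Cmod (?A * ?E - ?A' * ?E)%C <= _ =>
      replace (A * E - A' * E)%C with ((- (A' - A)) * E)%C by ring end.
    rewrite Cmod_mult, Cmod_opp, Cmod_Cexp.
    assert (T := HB x phi Hx (RtoC (m n)) (Nm n)). rewrite Mm in T. specialize (T (proj2 (Hm n))).
    replace (Re (- (p * x))%C) with (- (q * x) + - (q * x)) by (unfold q, Re; simpl; field).
    apply Rle_trans with (m n * (K * (exp (/ 4 * ln x + q * x) + exp (- / 4 * ln x + q * x))) * exp (- (q * x) + - (q * x))).
    + apply Rmult_le_compat_r; [left; apply exp_pos|exact T].
    + right. unfold Rminus. rewrite !exp_plus, exp_Ropp. field.
      apply Rgt_not_eq, exp_pos.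
  - apply (cvg_mult _ (fun _ => BesselI (RtoC (IZR (s * (2 * Z.of_nat M))) / 2) (4 * PI / c)));
      [|apply cvg_const].
    apply (cvg_scal (4 * PI * Cpowz Ci (s * (2 * Z.of_nat M)) / c)%C).
    apply cvg_dom with (fun n => K' * (2 * m n)).
    + intros n. specialize (Hm n). assert (M2 : Cmod (2 * RtoC (m n))%C = 2 * m n).
      { rewrite Cmod_mult, Mm, Cmod_R, Rabs_pos_eq; lra. }
      rewrite <- M2. apply HK'; [apply Cmult_neq_0; [apply RtoC_neq_0; lra|auto]|lra].
    + intros eps He. destruct (small_factor K' eps He) as [d [Hd Sd]].
      destruct (Hm0 (d / 2)) as [N HN]; [lra|].
      exists N. intros n Hn. specialize (HN n Hn). specialize (Hm n).
      rewrite Rminus_0_r, Rabs_pos_eq in HN by lra. apply Sd. lra.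
Qed.

(** Carrying the sign of [m] separately makes [M = |m| / 2] a natural number. *)
Lemma Even_signed m : Z.Even m -> exists s M, (s = 1%Z \/ s = (-1)%Z) /\ m = (s * (2 * Z.of_nat M))%Z.
Proof.
  intros [k Hk]. destruct (Z.le_ge_cases 0 k) as [H|H].
  - exists 1%Z, (Z.to_nat k). split; [auto|]. rewrite Z2Nat.id; lia.
  - exists (-1)%Z, (Z.to_nat (- k)). split; [auto|]. rewrite Z2Nat.id; lia.
Qed.

Lemma eq_0_of_double_int mu k : Rabs (Re mu) < 1 / 2 -> (2 * mu)%C = RtoC (IZR k) -> mu = RtoC 0.
Proof.
  intros H E.
  assert (ER : 2 * Re mu = IZR k).
  { assert (T := f_equal Re E). unfold Re in *; simpl in T. lra. }
  apply Rabs_def2 in H.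
  assert (k = 0%Z).
  { assert (IZR (-1) < IZR k) by (simpl; lra). assert (IZR k < IZR 1) by (simpl; lra).
    apply lt_IZR in H0. apply lt_IZR in H1. lia. }
  subst k. transitivity (/ 2 * (2 * mu))%C; [field|]. rewrite E. ring.
Qed.

Theorem theorem1p4 (mu : C) (m : Z)
  (hmu : (Rabs (Re mu) < 1 / 2)%R) (hm : Z.Even m)
  (c : C) (hc : c <> 0%C) (hargc : (Rabs (Carg c) < PI / 2)%R) :
  is_polar_integral
    (fun x phi : R =>
       (bJ mu m (x * Cexp (Ci * phi)) * Cexp (- (2 * PI * c * x)))%C)
    (4 * PI * Cpowz Ci m / c
     * BesselK (2 * mu) (4 * PI / c)
     * BesselI (IZR m / 2) (4 * PI / c))%C.
Proof.
  assert (Hc := Re_pos_of_Carg c hc hargc).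
  destruct (Even_signed m hm) as [s [M [Hs ->]]].
  destruct (excluded_middle_informative (mu = RtoC 0)) as [->|Hmu].
  - rewrite Cmult_0_r. apply polar_integral_nongeneric; auto.
  - assert (EK : BesselK (2 * mu) (4 * PI / c) = BesselK_generic (2 * mu) (4 * PI / c)).
    { unfold BesselK. destruct (excluded_middle_informative _) as [[k Hk]|_]; [|reflexivity].
      exfalso. apply Hmu. apply (eq_0_of_double_int mu k); auto. }
    assert (EJ : bJ mu (s * (2 * Z.of_nat M)) = bJ_generic mu (s * (2 * Z.of_nat M))).
    { unfold bJ. destruct (excluded_middle_informative _) as [[k Hk]|_]; [|reflexivity].
      exfalso. apply Hmu. apply (eq_0_of_double_int mu (k + s * Z.of_nat M)); auto.
      rewrite plus_IZR, RtoC_plus. transitivity (/ 2 * (4 * mu))%C; [field|].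
      rewrite Hk, !mult_IZR, !RtoC_mult. field. }
    rewrite EK, EJ. apply polar_integral_generic; auto.
Qed.
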